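(* Let $(\bar p,\bar x)\in \mathbb{R}^d\times \mathbb{R}^n$, let $F:\mathbb{R}^n\rightrightarrows \mathbb{R}^n$ be maximally monotone, and let $f:\mathbb{R}^d\times \mathbb{R}^n\to \mathbb{R}^n$ be continuously differentiable at $(\bar p,\bar x)$ and such that $f(p,\cdot)$ is monotone for every $p$ near $\bar p$. Define $S:\mathbb{R}^d\rightrightarrows\mathbb{R}^n$ by $$S(p)=\{x\in \mathbb{R}^n \mid 0\in f(p,x)+F(x)\},\qquad p\in\mathbb{R}^d.$$ Assume that $(\bar p,\bar x)\in \operatorname{gph} S$ (i.e. $0\in f(\bar p,\bar x)+F(\bar x)$) and that $$0\in D_x f(\bar p,\bar x)^*w+D^*F(\bar x\mid -f(\bar p,\bar x))(w)\quad\Longrightarrow \quad w=0,$$ or, equivalently, $$\ker D_xf(\bar p,\bar x) \cap \ker D^*F(\bar x\mid -f(\bar p,\bar x))=\{0\}.$$ Then the following hold: (a) $Q:=f(\bar p,\cdot)+F:\mathbb{R}^n\rightrightarrows \mathbb{R}^n$ is strongly metrically regular at $(\bar x,0)\in\operatorname{gph} Q$ (and maximally monotone). (b) $S$ is (single-valued) locally Lipschitz at $\bar p$. (c) If $F$ is proto-differentiable at $(\bar x,-f(\bar p,\bar x))$, then the graphical derivative $DS(\bar p\mid\bar x)$ is single-valued and locally Lipschitz with $$DS(\bar p)(q)=\{w\in\mathbb{R}^n \mid 0\in DG((\bar p,\bar x)\mid 0)(q,w)\},\qquad \forall q\in\mathbb{R}^d,$$ where $G(p,x):=f(p,x)+F(x)$.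 In particular, $S$ is directionally differentiable at $\bar p$ with (locally Lipschitz) directional derivative $S'(\bar p;\cdot)=DS(\bar p)(\cdot)$. In addition, $S$ is locally Lipschitz at $\bar p$ with modulus $$L\le\limsup_{p\to\bar p}\ \max_{\|q\|\le 1}\|DS(p)(q)\|.$$ (d) If $F$ is semismooth* at $(\bar x,-f(\bar p,\bar x))$, then $S$ is semismooth* at $(\bar p,\bar x)$. Thus, if $F$ is also proto-differentiable at $(\bar x,-f(\bar p,\bar x))$, then $S$ is semismooth at $\bar p$.
   Context: All norms are Euclidean. For $S:\mathbb{R}^n\rightrightarrows\mathbb{R}^m$ (set-valued), $\operatorname{gph}S=\{(x,y)\mid y\in S(x)\}$, $S^{-1}(y)=\{x\mid y\in S(x)\}$ and $\ker S=S^{-1}(0)$. Monotone/maximally monotone: $Q:\mathbb{R}^n\rightrightarrows\mathbb{R}^n$ is monotone if $\langle v_1-v_0,x_1-x_0\rangle\ge0$ for all $v_i\in Q(x_i)$; it is maximally monotone if its graph cannot be enlarged without destroying monotonicity. Tangent cone: $T_\Omega(\bar x)$ is the set of $w$ for which there are $t_k\downarrow0$, $w_k\to w$ with $\bar x+t_kw_k\in\Omega$. Regular normal cone: $\hat N_\Omega(\bar x)=\{v\mid\langle v,x-\bar x\rangle\le o(\|x-\bar x\|)\ \forall x\in\Omega\}$. Limiting normal cone: $N_\Omega(\bar x)$ is the set of limits of $v_k\in\hat N_\Omega(x_k)$ with $x_k\to\bar x$, $x_k\in\Omega$. Graphical derivative at $(\bar x,\bar y)\in\operatorname{gph}S$: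 $DS(\bar x\mid\bar y)(w)=\{z\mid(w,z)\in T_{\operatorname{gph}S}(\bar x,\bar y)\}$. Coderivative: $D^*S(\bar x\mid\bar y)(u)=\{v\mid(v,-u)\in N_{\operatorname{gph}S}(\bar x,\bar y)\}$. When $S$ is single-valued at $p$ we write $DS(p)=DS(p\mid S(p))$. In the modulus estimate, $\|DS(p)(q)\|$ is the maximum of $\|w\|$ over $w\in DS(p)(q)$ in case this set is not a singleton. $D_xf$ is the partial Jacobian in $x$, and $^*$ on a linear map denotes its adjoint (transpose). Strong metric regularity: $Q$ is strongly metrically regular at $(\bar x,\bar y)\in\operatorname{gph}Q$ if there are neighborhoods $V$ of $\bar y$ and $W$ of $\bar x$ such that $y\in V\mapsto Q^{-1}(y)\cap W$ is single-valued and Lipschitz continuous. ''$S$ is (single-valued) locally Lipschitz at $\bar p$'' means $S$ is single-valued and Lipschitz continuous on a neighborhood of $\bar p$; the modulus is $L=\limsup_{p,p'\to\bar p,\,p\ne p'}\|S(p)-S(p')\|/\|p-p'\|$. Directional differentiability: $S'(\bar p;q)=\lim_{t\downarrow0}(S(\bar p+tq)-S(\bar p))/t$ exists for all $q$. Proto-differentiability of $F$ at $(\bar x,\bar u)\in\operatorname{gph}F$: the sets $(\operatorname{gph}F-(\bar x,\bar u))/\tau$ converge (in the Painlevé–Kuratowski sense) to $\operatorname{gph}DF(\bar x\mid\bar u)$ as $\tau\downarrow0$. Semismoothness*: the directional normal cone $N_A(\bar x;u)$ to $A\subseteq\mathbb{R}^d$ at $\bar x\in A$ in direction $u$ is the set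 of limits of $x_k^*\in\hat N_A(\bar x+t_ku_k)$ with $t_k\downarrow0$, $u_k\to u$, $\bar x+t_ku_k\in A$. $A$ is semismooth* at $\bar x$ if $\langle x^*,u\rangle=0$ for all $u\in\mathbb{R}^d$ and $x^*\in N_A(\bar x;u)$. A set-valued map is semismooth* at a point of its graph if its graph is semismooth* there. Semismoothness: a function $\Phi:\mathbb{R}^d\to\mathbb{R}^n$ (defined near $\bar p$) is semismooth at $\bar p$ if it is locally Lipschitz at $\bar p$ and for every $h$ the limit of $Vh'$ over $V\in\partial_C\Phi(\bar p+th')$, $h'\to h$, $t\downarrow0$, exists, where $\partial_C\Phi$ is Clarke's generalized Jacobian (convex hull of limits of Jacobians at nearby differentiability points).
   Formalization: Maximal monotonicity of Q in (a) is claimed only when f(p̄,·) is continuous (it can fail otherwise); the implication condition is the hypothesis, and the kernel condition is only deduced from it, since the claimed equivalence fails (e.g. f = Jx, F = −Jx with J a rotation by 90°). *)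

(* Defs.v *)
From HB Require Import structures.
From mathcomp Require Import all_boot all_order all_algebra.
From mathcomp Require Import all_classical all_reals all_analysis.

Set Implicit Arguments.
Unset Strict Implicit.
Unset Printing Implicit Defensive.

Import Order.TTheory GRing.Theory Num.Theory.
Import numFieldNormedType.Exports.
Local Open Scope classical_set_scope.
Local Open Scope ring_scope.

(* R^n is 'rV[R]_n, and R^n x R^m is 'rV[R]_(n + m) through row_mx, lsubmx and
   rsubmx, so that cones to subsets of R^N also cover graphs. The library norm
   on row vectors is the sup norm: its topology is the usual one, but metric
   quantities are stated with the Euclidean norm enorm. *)

Section Euclidean.
Context {R : realType}.

Definition dotv n (u v : 'rV[R]_n) : R := \sum_(i < n) u ord0 i * v ord0 i.

Definition enorm n (u : 'rV[R]_n) : R := Num.sqrt (dotv u u).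

End Euclidean.

Section SetValuedMaps.
Context {R : realType}.

Definition gph n m (S : 'rV[R]_n -> set 'rV[R]_m) : set 'rV[R]_(n + m) :=
  [set z | S (lsubmx z) (rsubmx z)].

Definition inverse_map n m (S : 'rV[R]_n -> set 'rV[R]_m) :
    'rV[R]_m -> set 'rV[R]_n :=
  fun y => [set x | S x y].

Definition map_kernel n m (S : 'rV[R]_n -> set 'rV[R]_m) : set 'rV[R]_n :=
  inverse_map S 0.

Definition monotone_map n (Q : 'rV[R]_n -> set 'rV[R]_n) : Prop :=
  forall x0 x1 v0 v1, Q x0 v0 -> Q x1 v1 -> 0 <= dotv (v1 - v0) (x1 - x0).

Definition maximally_monotone n (Q : 'rV[R]_n -> set 'rV[R]_n) : Prop :=
  monotone_map Q /\
  forall Q', monotone_map Q' -> gph Q `<=` gph Q' -> gph Q' `<=` gph Q.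

(* The value of S where S is single-valued; arbitrary elsewhere. *)
Definition value_at n m (S : 'rV[R]_n -> set 'rV[R]_m) (x : 'rV[R]_n) :
    'rV[R]_m :=
  xget 0 (S x).

Definition lipschitz_single_valued_on n m (S : 'rV[R]_n -> set 'rV[R]_m)
    (U : set 'rV[R]_n) : Prop :=
  (forall x, U x -> exists y, S x = [set y]) /\
  exists k : R, forall x x', U x -> U x' ->
    enorm (value_at S x - value_at S x') <= k * enorm (x - x').

Definition locally_lipschitz n m (S : 'rV[R]_n -> set 'rV[R]_m)
    (x : 'rV[R]_n) : Prop :=
  exists2 U : set 'rV[R]_n, nbhs x U & lipschitz_single_valued_on S U.

Definition lipschitz_modulus n m (S : 'rV[R]_n -> set 'rV[R]_m)
    (x : 'rV[R]_n) : \bar R :=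
  limf_esup
    (fun z : 'rV[R]_n * 'rV[R]_n =>
       (enorm (value_at S z.1 - value_at S z.2) / enorm (z.1 - z.2))%:E)
    (within [set z | z.1 != z.2] (nbhs (x, x))).

Definition strongly_metrically_regular n m (Q : 'rV[R]_n -> set 'rV[R]_m)
    (x : 'rV[R]_n) (y : 'rV[R]_m) : Prop :=
  Q x y /\
  exists V W, [/\ nbhs y V, nbhs x W
    & lipschitz_single_valued_on (fun y' => inverse_map Q y' `&` W) V].

End SetValuedMaps.

Section Cones.
Context {R : realType} {N : nat}.
Implicit Types (A : set 'rV[R]_N) (x u v w : 'rV[R]_N) (t : nat -> R).

Definition decreases_to0 t : Prop :=
  (forall k, 0 < t k) /\ t @ \oo --> (0 : R).

Definition tangent_cone A x : set 'rV[R]_N :=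
  [set w | exists t (wk : nat -> 'rV[R]_N),
    [/\ decreases_to0 t, wk @ \oo --> w & forall k, A (x + t k *: wk k)]].

Definition regular_normal_cone A x : set 'rV[R]_N :=
  [set v | forall e : R, 0 < e ->
    \forall y \near x, A y -> dotv v (y - x) <= e * enorm (y - x)].

Definition normal_cone A x : set 'rV[R]_N :=
  [set v | exists xk vk : nat -> 'rV[R]_N,
    [/\ forall k, A (xk k), xk @ \oo --> x,
        forall k, regular_normal_cone A (xk k) (vk k) & vk @ \oo --> v]].

Definition directional_normal_cone A x u : set 'rV[R]_N :=
  [set v | exists t (uk vk : nat -> 'rV[R]_N),
    [/\ decreases_to0 t, uk @ \oo --> u, forall k, A (x + t k *: uk k),
        forall k, regular_normal_cone A (x + t k *: uk k) (vk k)
      & vk @ \oo --> v]].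

Definition semismooth_star A x : Prop :=
  forall u v, directional_normal_cone A x u v -> dotv v u = 0.

(* Painleve-Kuratowski limits of a family of sets C tau as tau decreases to 0. *)
Definition outer_limit (C : R -> set 'rV[R]_N) : set 'rV[R]_N :=
  [set w | exists t (wk : nat -> 'rV[R]_N),
    [/\ decreases_to0 t, wk @ \oo --> w & forall k, C (t k) (wk k)]].

Definition inner_limit (C : R -> set 'rV[R]_N) : set 'rV[R]_N :=
  [set w | forall t, decreases_to0 t ->
    exists2 wk : nat -> 'rV[R]_N,
      wk @ \oo --> w & \forall k \near \oo, C (t k) (wk k)].

Definition PK_converges (C : R -> set 'rV[R]_N) (D : set 'rV[R]_N) : Prop :=
  outer_limit C = D /\ inner_limit C = D.

End Cones.

Section GeneralizedDerivatives.
Context {R : realType}.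

Definition graphical_derivative n m (S : 'rV[R]_n -> set 'rV[R]_m)
    (x : 'rV[R]_n) (y : 'rV[R]_m) : 'rV[R]_n -> set 'rV[R]_m :=
  fun w => [set z | tangent_cone (gph S) (row_mx x y) (row_mx w z)].

Definition coderivative n m (S : 'rV[R]_n -> set 'rV[R]_m)
    (x : 'rV[R]_n) (y : 'rV[R]_m) : 'rV[R]_m -> set 'rV[R]_n :=
  fun u => [set v | normal_cone (gph S) (row_mx x y) (row_mx v (- u))].

Definition proto_differentiable n m (S : 'rV[R]_n -> set 'rV[R]_m)
    (x : 'rV[R]_n) (y : 'rV[R]_m) : Prop :=
  PK_converges
    (fun tau : R => [set tau^-1 *: (z - row_mx x y) | z in gph S])
    (gph (graphical_derivative S x y)).

(* ||A|| = max {||w|| : w in A} and ||H|| = max {||H q|| : ||q|| <= 1}, as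
   suprema in the extended reals; has_max says that a supremum is attained. *)
Definition norms n (A : set 'rV[R]_n) : set (\bar R) :=
  [set (enorm w)%:E | w in A].

Definition setnorm n (A : set 'rV[R]_n) : \bar R := ereal_sup (norms A).

Definition unit_ball_setnorms n m (H : 'rV[R]_n -> set 'rV[R]_m) :
    set (\bar R) :=
  [set setnorm (H q) | q in [set q | enorm q <= 1]].

Definition outer_norm n m (H : 'rV[R]_n -> set 'rV[R]_m) : \bar R :=
  ereal_sup (unit_ball_setnorms H).

Definition has_max (A : set (\bar R)) : Prop := A (ereal_sup A).

Definition has_directional_derivative n m (s : 'rV[R]_n -> 'rV[R]_m)
    (x q : 'rV[R]_n) (l : 'rV[R]_m) : Prop :=
  (fun t : R => t^-1 *: (s (x + t *: q) - s x)) @ 0^'+ --> l.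

(* Library Jacobians act on row vectors: 'd s x v = v *m 'J s x, so 'J s x is
   the transpose of the usual Jacobian matrix. *)

Definition continuously_differentiable_at n m (s : 'rV[R]_n -> 'rV[R]_m)
    (x : 'rV[R]_n) : Prop :=
  (\forall y \near x, differentiable s y) /\
  {for x, continuous (fun y => 'J s y)}.

Definition convex_hull n m (B : set 'M[R]_(n, m)) : set 'M[R]_(n, m) :=
  smallest (fun A => @convex_set R 'M[R]_(n, m) A) B.

Definition clarke_jacobian n m (s : 'rV[R]_n -> 'rV[R]_m) (x : 'rV[R]_n) :
    set 'M[R]_(n, m) :=
  convex_hull [set V | exists xk : nat -> 'rV[R]_n,
    [/\ xk @ \oo --> x, forall k, differentiable s (xk k)
      & (fun k => 'J s (xk k)) @ \oo --> V]].

Definition semismooth n m (s : 'rV[R]_n -> 'rV[R]_m) (x : 'rV[R]_n) : Prop :=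
  locally_lipschitz (fun y => [set s y]) x /\
  forall h : 'rV[R]_n, exists l : 'rV[R]_m, forall e : R, 0 < e ->
    \forall h' \near h & t \near 0^'+,
      forall V, clarke_jacobian s (x + t *: h') V -> enorm (h' *m V - l) < e.

End GeneralizedDerivatives.

Section GeneralizedEquation.
Context {R : realType} {d n : nat}.
Variables (f : 'rV[R]_d -> 'rV[R]_n -> 'rV[R]_n).
Variables (F : 'rV[R]_n -> set 'rV[R]_n).

Definition joint (z : 'rV[R]_(d + n)) : 'rV[R]_n := f (lsubmx z) (rsubmx z).

Definition partial_map (p : 'rV[R]_d) (x : 'rV[R]_n) : set 'rV[R]_n :=
  [set f p x + u | u in F x].

Definition joint_map (z : 'rV[R]_(d + n)) : set 'rV[R]_n :=
  partial_map (lsubmx z) (rsubmx z).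

Definition solution_map (p : 'rV[R]_d) : set 'rV[R]_n :=
  [set x | partial_map p x 0].

(* D_x f(p, x) and its adjoint, both as maps of row vectors. *)
Definition partial_jacobian (p : 'rV[R]_d) (x w : 'rV[R]_n) : 'rV[R]_n :=
  w *m 'J (f p) x.

Definition partial_jacobian_adj (p : 'rV[R]_d) (x w : 'rV[R]_n) : 'rV[R]_n :=
  w *m ('J (f p) x)^T.

End GeneralizedEquation.

(* Main.v *)
(* Minimizing |f p x + u - y| plus a quadratic penalty over gph F gives, unless
   the residual vanishes, a regular normal to gph F that the coderivative condition
   excludes near the reference point; hence f p x + u = y is solvable with linear
   estimates, uniformly in p.  Testing monotonicity against the solutions for
   nearby right-hand sides makes the solution globally unique, which yields strong
   metric regularity and the Lipschitz continuity of S.  Points of gph F with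
   residual o(t) therefore stay within o(t) of the solution: this gives the formula
   for DS and, under proto-differentiability, directional derivatives.  The modulus
   estimate is a mean value inequality for contingent derivatives.  For (d), exact
   penalization turns a regular normal to gph S into one to gph F at a nearby point
   with a bounded multiplier, and semismoothness* passes to the limit.  Maximality
   of f(pbar, .) + F comes from Minty's theorem with a skew perturbation, applied to
   the product of F with the inverse of f(pbar, .) and followed by the removal of
   a vanishing regularization. *)
Require Import Defs.
From HB Require Import structures.
From mathcomp Require Import all_boot all_order all_algebra.
From mathcomp Require Import all_classical all_reals all_analysis.
From mathcomp Require Import ring lra.

Set Implicit Arguments.
Unset Strict Implicit.
Unset Printing Implicit Defensive.

Import Order.TTheory GRing.Theory Num.Theory.
Import numFieldNormedType.Exports.
Local Open Scope classical_set_scope.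
Local Open Scope ring_scope.

(** * Euclidean geometry of row vectors *)

(** One variational lemma serves both the solvability estimate and the decoupling of normals. Its
    objective contains [Num.sqrt (dotv (h z) (h z) + dl)]: with [dl = 0] this is the norm of the
    residual, smooth where the residual is nonzero, which is the case to be refuted; with [dl > 0]
    it stays smooth on the constraint itself, where multipliers are extracted. The quadratic term
    keeps minimizers off the boundary of the ball, and its gradient is the only error in the normal
    obtained.

    Monotonicity of [f p] is global in x while differentiability is local. Hence uniqueness holds in
    the whole space, and [solution_map] itself, without truncation to a neighbourhood, is
    single-valued near [pbar].

    For maximality the obstacle is that Minty's theorem concerns one map, not a sum. Taking v = g x
    as a second unknown turns the sum into a product map plus the skew coupling (v, - x); the
    identity in Minty's theorem then also acts on v, and rescaling v by eta makes this side effect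
    the removable perturbation [g (x - eta ^+ 2 *: v)]. *)

Section EuclideanSpace.
Context {R : realType}.

Section Dot.
Context {n : nat}.
Implicit Types u v w : 'rV[R]_n.

Lemma dotvC u v : dotv u v = dotv v u.
Proof. by apply: eq_bigr => i _; rewrite mulrC. Qed.

Lemma dotvDl u v w : dotv (u + v) w = dotv u w + dotv v w.
Proof. by rewrite -big_split; apply: eq_bigr => i _; rewrite mxE mulrDl. Qed.

Lemma dotvZl a u v : dotv (a *: u) v = a * dotv u v.
Proof. by rewrite /dotv mulr_sumr; apply: eq_bigr => i _; rewrite mxE mulrA. Qed.

Lemma dotvNl u v : dotv (- u) v = - dotv u v.
Proof. by rewrite -scaleN1r dotvZl mulN1r. Qed.

Lemma dotvBl u v w : dotv (u - v) w = dotv u w - dotv v w.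
Proof. by rewrite dotvDl dotvNl. Qed.

Lemma dotvDr u v w : dotv w (u + v) = dotv w u + dotv w v.
Proof. by rewrite !(dotvC w) dotvDl. Qed.

Lemma dotvZr a u v : dotv u (a *: v) = a * dotv u v.
Proof. by rewrite !(dotvC u) dotvZl. Qed.

Lemma dotvNr u v : dotv u (- v) = - dotv u v.
Proof. by rewrite !(dotvC u) dotvNl. Qed.

Lemma dotvBr u v w : dotv w (u - v) = dotv w u - dotv w v.
Proof. by rewrite !(dotvC w) dotvBl. Qed.

Lemma dotv0l u : dotv 0 u = 0.
Proof. by rewrite -(scale0r u) dotvZl mul0r. Qed.

Lemma dotv0r u : dotv u 0 = 0.
Proof. by rewrite dotvC dotv0l. Qed.

Definition dotvE := (dotvDl, dotvDr, dotvNl, dotvNr, dotvZl, dotvZr, dotv0l, dotv0r).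

Lemma dotv_suml I (r : seq I) (P : pred I) (F : I -> 'rV[R]_n) v :
  dotv (\sum_(i <- r | P i) F i) v = \sum_(i <- r | P i) dotv (F i) v.
Proof.
elim/big_rec2: _ => [|i x y _ <-]; [exact: dotv0l | exact: dotvDl].
Qed.

Lemma dotv_sqrD u v : dotv (u + v) (u + v) = dotv u u + 2 * dotv u v + dotv v v.
Proof. by rewrite dotvDl !dotvDr (dotvC v u) mulr_natl mulr2n !addrA. Qed.

Lemma dotv_sqrB u v : dotv (u - v) (u - v) = dotv u u - 2 * dotv u v + dotv v v.
Proof. by rewrite dotv_sqrD !(dotvNl, dotvNr) opprK mulrN. Qed.

Lemma dotvv_ge0 u : 0 <= dotv u u.
Proof. by apply: sumr_ge0 => i _; rewrite -expr2 sqr_ge0. Qed.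

Lemma dotvv_eq0 u : dotv u u = 0 -> u = 0.
Proof.
move=> /eqP; rewrite psumr_eq0 => [/allP u0|i _]; last by rewrite -expr2 sqr_ge0.
apply/rowP => i; rewrite mxE; apply/eqP.
by move: (u0 i (mem_index_enum i)); rewrite mulf_eq0 orbb.
Qed.

Lemma enorm_ge0 u : 0 <= enorm u.
Proof. exact: sqrtr_ge0. Qed.
Hint Resolve enorm_ge0 : core.

Lemma sqr_enorm u : enorm u ^+ 2 = dotv u u.
Proof. by rewrite sqr_sqrtr// dotvv_ge0. Qed.

Lemma enorm0 : enorm (0 : 'rV[R]_n) = 0.
Proof. by rewrite /enorm dotv0l sqrtr0. Qed.

Lemma enorm0_eq0 u : enorm u = 0 -> u = 0.
Proof. by move=> u0; apply: dotvv_eq0; rewrite -sqr_enorm u0 expr0n. Qed.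

Lemma enorm_gt0 u : (0 < enorm u) = (u != 0).
Proof.
rewrite lt_neqAle enorm_ge0 andbT eq_sym; congr (~~ _).
by apply/eqP/eqP => [/enorm0_eq0//|->]; rewrite enorm0.
Qed.

Lemma enormZ a u : enorm (a *: u) = `|a| * enorm u.
Proof. by rewrite /enorm !dotvE mulrA -expr2 sqrtrM ?sqr_ge0// sqrtr_sqr. Qed.

Lemma enormN u : enorm (- u) = enorm u.
Proof. by rewrite -scaleN1r enormZ normrN1 mul1r. Qed.

Lemma enormBC u v : enorm (u - v) = enorm (v - u).
Proof. by rewrite -enormN opprB. Qed.

Lemma cauchy_schwarz u v : dotv u v <= enorm u * enorm v.
Proof.
have [v0|v0] := eqVneq v 0; first by rewrite v0 dotv0r enorm0 mulr0.
have [uv0|/ltW uv0] := leP (dotv u v) 0; first by rewrite (le_trans uv0) ?mulr_ge0.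
rewrite -(@ler_pXn2r _ 2)// ?nnegrE ?mulr_ge0// exprMn !sqr_enorm.
have vv0 : 0 < dotv v v by rewrite -sqr_enorm exprn_gt0// enorm_gt0.
have := dotvv_ge0 (dotv v v *: u - dotv u v *: v).
rewrite !dotvE (dotvC v u) => h.
have {h} : 0 <= dotv v v * (dotv u u * dotv v v - dotv u v ^+ 2) by nra.
by rewrite pmulr_rge0// subr_ge0.
Qed.

Lemma cauchy_schwarzN u v : - (enorm u * enorm v) <= dotv u v.
Proof. by rewrite lerNl -dotvNl -(enormN u) cauchy_schwarz. Qed.

Lemma enormD u v : enorm (u + v) <= enorm u + enorm v.
Proof.
rewrite -(@ler_pXn2r _ 2)// ?nnegrE ?addr_ge0// sqr_enorm !dotvE (dotvC v u).
have := cauchy_schwarz u v; rewrite sqrrD !sqr_enorm; lra.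
Qed.

Lemma enormB u v : enorm (u - v) <= enorm u + enorm v.
Proof. by rewrite (le_trans (enormD _ _))// enormN. Qed.

Lemma enorm_triangle v u w : enorm (u - w) <= enorm (u - v) + enorm (v - w).
Proof. by rewrite (le_trans _ (enormD _ _))// addrA subrK. Qed.

Lemma enorm_le_add u v : enorm u <= enorm v + enorm (u - v).
Proof. by rewrite (le_trans _ (enormD _ _))// addrC subrK. Qed.

Lemma normr_le_enorm u : `|u| <= enorm u.
Proof.
rewrite [leLHS]/Num.norm /= mx_normrE; apply: bigmax_le => // -[i j] _ /=.
rewrite -sqrtr_sqr ler_sqrt ?dotvv_ge0// /dotv (bigD1 j)//= ord1 -expr2 lerDl.
by apply: sumr_ge0 => k _; rewrite -expr2 sqr_ge0.
Qed.

Lemma coord_le_normr u i : `|u ord0 i| <= `|u|.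
Proof.
by rewrite [leRHS]/Num.norm /= mx_normrE; exact: (le_bigmax _ _ (ord0, i)).
Qed.

Lemma enorm_le_normr u : enorm u <= n%:R * `|u|.
Proof.
rewrite -(@ler_pXn2r _ 2)// ?nnegrE ?mulr_ge0// sqr_enorm exprMn /dotv.
apply: (@le_trans _ _ (\sum_(i < n) `|u| ^+ 2)).
  apply: ler_sum => i _; rewrite -expr2 -real_normK ?num_real//.
  by rewrite ler_pXn2r ?nnegrE// coord_le_normr.
rewrite sumr_const card_ord -[leLHS]mulr_natl; apply: ler_wpM2r; first exact: sqr_ge0.
by rewrite -natrX ler_nat; case: (n) => // k; rewrite leq_pmulr.
Qed.

End Dot.

Lemma dotv_mulmx n m (u : 'rV[R]_n) (A : 'M[R]_(n, m)) (v : 'rV[R]_m) :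
  dotv (u *m A) v = dotv u (v *m A^T).
Proof.
have dE k (a b : 'rV[R]_k) : dotv a b = (a *m b^T) ord0 ord0.
  by rewrite mxE; apply: eq_bigr => i _; rewrite mxE.
by rewrite !dE trmx_mul trmxK mulmxA.
Qed.

Lemma dotv_row_mx n m (a c : 'rV[R]_n) (b d : 'rV[R]_m) :
  dotv (row_mx a b) (row_mx c d) = dotv a c + dotv b d.
Proof.
rewrite /dotv big_split_ord; congr (_ + _); apply: eq_bigr => i _;
by rewrite ?row_mxEl ?row_mxEr.
Qed.

Section SubBlocks.
Context {n m : nat}.
Implicit Types (z : 'rV[R]_(n + m)) (a : 'rV[R]_n) (b : 'rV[R]_m).

Lemma sqr_enorm_row_mx a b :
  enorm (row_mx a b) ^+ 2 = enorm a ^+ 2 + enorm b ^+ 2.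
Proof. by rewrite !sqr_enorm dotv_row_mx. Qed.

Lemma enorm_row_mx_le a b : enorm (row_mx a b) <= enorm a + enorm b.
Proof.
have -> : row_mx a b = row_mx a 0 + row_mx 0 b by rewrite add_row_mx addr0 add0r.
apply: (le_trans (enormD _ _)).
by rewrite /enorm !dotv_row_mx !dotv0l addr0 add0r.
Qed.

Lemma enorm_lsubmx z : enorm (lsubmx z) <= enorm z.
Proof.
rewrite -(@ler_pXn2r _ 2)// ?nnegrE ?enorm_ge0// -{2}[z]hsubmxK sqr_enorm_row_mx.
by rewrite lerDl sqr_ge0.
Qed.

Lemma enorm_rsubmx z : enorm (rsubmx z) <= enorm z.
Proof.
rewrite -(@ler_pXn2r _ 2)// ?nnegrE ?enorm_ge0// -{2}[z]hsubmxK sqr_enorm_row_mx.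
by rewrite lerDr sqr_ge0.
Qed.

Lemma row_mxB a b a' b' : row_mx a b - row_mx a' b' = row_mx (a - a') (b - b').
Proof. by rewrite opp_row_mx add_row_mx. Qed.

End SubBlocks.

Section Topology.
Context {n : nat}.
Implicit Types u v : 'rV[R]_n.

Lemma nbhs_enormP (x : 'rV[R]_n) (U : set 'rV[R]_n) :
  nbhs x U <-> exists2 r : R, 0 < r & forall y, enorm (y - x) < r -> U y.
Proof.
split=> [/nbhs_ballP[r /= r0 rU]|[r r0 rU]].
  exists r => // y yx; apply: rU; rewrite -ball_normE /= distrC.
  exact: le_lt_trans (normr_le_enorm _) yx.
(* [n.+1] in place of [n] keeps the radius positive in dimension 0. *)
apply/nbhs_ballP; exists (r / n.+1%:R) => /= [|y]; first by rewrite divr_gt0.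
rewrite -ball_normE /= distrC ltr_pdivlMr// => yx; apply: rU.
rewrite (le_lt_trans (enorm_le_normr _))// mulrC (le_lt_trans _ yx)//.
by rewrite ler_wpM2l// ler_nat.
Qed.

Lemma cvg_enormP T (F : set_system T) (FF : Filter F) (u : T -> 'rV[R]_n)
    (l : 'rV[R]_n) :
  u @ F --> l <-> forall e : R, 0 < e -> \forall t \near F, enorm (u t - l) < e.
Proof.
split=> [ul e e0|ul U /nbhs_enormP[r r0 rU]].
  by apply: (ul [set v | enorm (v - l) < e]); apply/nbhs_enormP; exists e.
by apply: filterS (ul _ r0) => t /rU.
Qed.

Lemma cvg_enorm T (F : set_system T) (FF : Filter F) (u : T -> 'rV[R]_n)
    (l : 'rV[R]_n) :
  u @ F --> l -> (fun t => enorm (u t)) @ F --> enorm l.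
Proof.
move=> /cvg_enormP ul; apply/cvgrPdist_lt => e e0.
apply: filterS (ul _ e0) => t; apply: le_lt_trans.
rewrite ler_norml; apply/andP; split.
  by rewrite lerNl opprB lerBlDl enorm_le_add.
by rewrite lerBlDl enormBC enorm_le_add.
Qed.

Lemma cvg_dotv T (F : set_system T) (FF : Filter F) (u v : T -> 'rV[R]_n)
    (a b : 'rV[R]_n) :
  u @ F --> a -> v @ F --> b -> (fun t => dotv (u t) (v t)) @ F --> dotv a b.
Proof.
(* Polarization reduces the claim to continuity of the norm. *)
have dotE (x y : 'rV[R]_n) :
    dotv x y = 2^-1 * (enorm (x + y) * enorm (x + y) - enorm x * enorm x
                       - enorm y * enorm y).
  by rewrite -!expr2 !sqr_enorm !dotvE (dotvC y x); field.
move=> ua vb; rewrite dotE; under eq_fun do rewrite dotE.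
by apply: cvgMr; apply: cvgB; [apply: cvgB|]; apply: cvgM; apply: cvg_enorm => //;
  apply: cvgD.
Qed.

Lemma enorm_continuous : continuous (@enorm R n).
Proof. move=> x; exact: (@cvg_enorm _ (nbhs x) _ id x (@cvg_id _ _)). Qed.

(** [k <= phi k] stands for a subsequence: it suffices for passing to limits and comes directly from
    choice at a cluster point. *)
Lemma bounded_subsequence (u : nat -> 'rV[R]_n) (M : R) :
  (forall k, enorm (u k) <= M) ->
  exists (phi : nat -> nat) (l : 'rV[R]_n), (forall k, (k <= phi k)%N) /\ (u \o phi) @ \oo --> l.
Proof.
move=> uM.
have cK : compact [set v : 'rV[R]_n | enorm v <= M].
  apply: bounded_closed_compact.
    exists M; split; first exact: num_real.
    by move=> y My v /= vM; rewrite (le_trans (normr_le_enorm _))// (le_trans vM)// ltW.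
  apply: (@preimage_closed _ _ (@enorm R n) [set x | x <= M]); last exact: closed_le.
  by move=> v _; exact: enorm_continuous.
have [l [lM ll]] : [set v : 'rV[R]_n | enorm v <= M] `&` cluster (u @ \oo) !=set0.
  by apply: (cK (u @ \oo)); exists 0%N => // k _; exact: uM.
have ex k : exists m, (k <= m)%N /\ enorm (u m - l) < k.+1%:R^-1.
  have A : (u @ \oo) [set u m | m in [set m | (k <= m)%N]].
    by exists k => // m /= km; exists m.
  have B : nbhs l [set v | enorm (v - l) < k.+1%:R^-1].
    by apply/nbhs_enormP; exists k.+1%:R^-1 => //; rewrite invr_gt0.
  by have [_ [[m /= km <-] ml]] := ll _ _ A B; exists m.
have [phi phiP] := choice ex; exists phi, l; split; first by move=> k; case: (phiP k).
apply/cvg_enormP => e e0; near=> k.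
rewrite (lt_trans (phiP k).2)//; near: k; exact: near_infty_natSinv_lt (PosNum e0).
Unshelve. all: by end_near. Qed.

End Topology.

End EuclideanSpace.
#[global] Hint Extern 0 (is_true (0 <= _)) => solve [apply: enorm_ge0] : core.

(** * Linearizations and stationarity *)

Section Sequences.
Context {R : realType}.

Lemma cvg_subsequence (T : topologicalType) (u : nat -> T) (l : T) (phi : nat -> nat) :
  (forall k, (k <= phi k)%N) -> u @ \oo --> l -> (u \o phi) @ \oo --> l.
Proof.
move=> phik ul U /ul[M _ MU]; exists M => // k /= Mk.
by apply: MU; exact: leq_trans Mk (phik k).
Qed.

Lemma decreases_to0_subsequence (t : nat -> R) (phi : nat -> nat) :
  (forall k, (k <= phi k)%N) -> decreases_to0 t -> decreases_to0 (t \o phi).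
Proof. by move=> phik [t0 tl]; split => [k|]; [exact: t0|exact: cvg_subsequence]. Qed.

Lemma decreases_to0_natSinv : decreases_to0 (fun k => k.+1%:R^-1 : R).
Proof.
split=> [k|]; first by rewrite invr_gt0.
apply/cvgrPdist_lt => e e0; near=> k.
rewrite sub0r normrN ger0_norm ?invr_ge0//.
by near: k; exact: near_infty_natSinv_lt (PosNum e0).
Unshelve. all: by end_near. Qed.

Lemma cvg_enorm_le n (u : nat -> 'rV[R]_n) (l : 'rV[R]_n) (a : nat -> R) :
  a @ \oo --> (0 : R) -> (forall k, enorm (u k - l) <= a k) -> u @ \oo --> l.
Proof.
move=> /cvgrPdist_lt a0 ua; apply/cvg_enormP => e e0.
apply: filterS (a0 _ e0) => k; rewrite sub0r normrN => ak.
by rewrite (le_lt_trans (ua k))// (le_lt_trans (ler_norm _)).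
Qed.

Lemma entry_le_normr n m (A : 'M[R]_(n, m)) i j : `|A i j| <= `|A|.
Proof. by rewrite [leRHS]/Num.norm /= mx_normrE; exact: (le_bigmax _ _ (i, j)). Qed.

Lemma normr_le_entries n m (A : 'M[R]_(n, m)) (c : R) :
  0 <= c -> (forall i j, `|A i j| <= c) -> `|A| <= c.
Proof.
by move=> c0 Ac; rewrite [leLHS]/Num.norm /= mx_normrE; apply: bigmax_le => // -[].
Qed.

Lemma normr_trmx n m (A : 'M[R]_(n, m)) : `|A^T| = `|A|.
Proof.
have le k l (B : 'M[R]_(k, l)) : `|B^T| <= `|B|.
  by apply: normr_le_entries => // i j; rewrite mxE entry_le_normr.
by apply/eqP; rewrite eq_le le -{1}[A]trmxK le.
Qed.

Section Blocks.
Context {T : Type} {F : set_system T} {FF : Filter F} {n m : nat}.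

Lemma cvg_row_mx (u : T -> 'rV[R]_n) (v : T -> 'rV[R]_m)
    (a : 'rV[R]_n) (b : 'rV[R]_m) :
  u @ F --> a -> v @ F --> b -> (fun t => row_mx (u t) (v t)) @ F --> row_mx a b.
Proof.
move=> /cvg_enormP ua /cvg_enormP vb; apply/cvg_enormP => e e0.
have e2 : 0 < e / 2 by rewrite divr_gt0.
apply: filterS2 (ua _ e2) (vb _ e2) => t u1 v1.
rewrite row_mxB (le_lt_trans (enorm_row_mx_le _ _))//; lra.
Qed.

Lemma cvg_lsubmx (u : T -> 'rV[R]_(n + m)) (a : 'rV[R]_(n + m)) :
  u @ F --> a -> (fun t => lsubmx (u t)) @ F --> lsubmx a.
Proof.
move=> /cvg_enormP ua; apply/cvg_enormP => e /ua; apply: filterS => t.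
by apply: le_lt_trans; rewrite -linearB; exact: enorm_lsubmx.
Qed.

Lemma cvg_rsubmx (u : T -> 'rV[R]_(n + m)) (a : 'rV[R]_(n + m)) :
  u @ F --> a -> (fun t => rsubmx (u t)) @ F --> rsubmx a.
Proof.
move=> /cvg_enormP ua; apply/cvg_enormP => e /ua; apply: filterS => t.
by apply: le_lt_trans; rewrite -linearB; exact: enorm_rsubmx.
Qed.

Lemma cvg_trmx (A : T -> 'M[R]_(n, m)) (B : 'M[R]_(n, m)) :
  A @ F --> B -> (fun t => (A t)^T) @ F --> B^T.
Proof.
move=> /cvgrPdist_lt AB; apply/cvgrPdist_lt => e /AB; apply: filterS => t.
by rewrite -linearB normr_trmx.
Qed.

Lemma enorm_mulmx_le (u : 'rV[R]_n) (A : 'M[R]_(n, m)) :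
  enorm (u *m A) <= (m * n)%:R * `|A| * enorm u.
Proof.
rewrite natrM -!mulrA (le_trans (enorm_le_normr _))// ler_wpM2l//.
apply: normr_le_entries => [|i j]; first by rewrite !mulr_ge0.
rewrite ord1 mxE (le_trans (ler_norm_sum _ _ _))//.
apply: (@le_trans _ _ (\sum_(k < n) `|A| * enorm u)).
  apply: ler_sum => k _; rewrite normrM mulrC ler_pM ?entry_le_normr//.
  exact: le_trans (coord_le_normr _ _) (normr_le_enorm _).
by rewrite sumr_const card_ord mulr_natl.
Qed.

Lemma cvg_mulmx (u : T -> 'rV[R]_n) (a : 'rV[R]_n)
    (A : T -> 'M[R]_(n, m)) (B : 'M[R]_(n, m)) :
  u @ F --> a -> A @ F --> B -> (fun t => u t *m A t) @ F --> a *m B.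
Proof.
move=> /cvg_enormP ua /cvgrPdist_lt AB; apply/cvg_enormP => e e0.
pose c : R := (m * n)%:R; have c0 : 0 <= c by [].
pose e1 := e / (2 * (c * (`|B| + 1) + 1)).
pose e2 := e / (2 * (c * enorm a + 1)).
have B0 : 0 < c * (`|B| + 1) + 1 by rewrite ltr_wpDl// mulr_ge0// addr_ge0.
have a0 : 0 < c * enorm a + 1 by rewrite ltr_wpDl// mulr_ge0.
have e10 : 0 < e1 by rewrite divr_gt0// mulr_gt0.
have e20 : 0 < e2 by rewrite divr_gt0// mulr_gt0.
near=> t.
have -> : u t *m A t - a *m B = (u t - a) *m A t + a *m (A t - B).
  by rewrite mulmxBl mulmxBr addrA subrK.
have ut : enorm (u t - a) < e1 by near: t; exact: ua.
have At2 : `|A t - B| < e2 by rewrite distrC; near: t; exact: AB.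
have At1 : `|A t| <= `|B| + 1.
  rewrite -lerBlDl (le_trans (lerB_dist _ _))//.
  by rewrite ltW// distrC; near: t; exact: AB.
have E1 : e1 * (c * (`|B| + 1) + 1) = e / 2 by rewrite /e1 invfM mulrA divfK ?gt_eqF.
have E2 : e2 * (c * enorm a + 1) = e / 2 by rewrite /e2 invfM mulrA divfK ?gt_eqF.
rewrite (le_lt_trans (enormD _ _))//.
have h1 := enorm_mulmx_le (u t - a) (A t).
have h2 := enorm_mulmx_le a (A t - B).
have g1 : c * `|A t| * enorm (u t - a) <= c * (`|B| + 1) * e1.
  by rewrite ler_pM ?mulr_ge0// ?ler_wpM2l// ltW.
have g2 : c * `|A t - B| * enorm a <= c * e2 * enorm a.
  by rewrite ler_wpM2r// ler_wpM2l// ltW.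
rewrite -/c in h1 h2; nra.
Unshelve. all: by end_near. Qed.

End Blocks.

(** Frechet differentiability in epsilon form for the Euclidean norm, with an explicit matrix:
    composite maps can be given their derivative without computing a library Jacobian. *)
Definition is_linearization n m (h : 'rV[R]_n -> 'rV[R]_m) (x : 'rV[R]_n)
    (D : 'M[R]_(n, m)) : Prop :=
  forall e : R, 0 < e ->
    \forall y \near x, enorm (h y - h x - (y - x) *m D) <= e * enorm (y - x).

Lemma differentiable_linearization n m (h : 'rV[R]_n -> 'rV[R]_m) (x : 'rV[R]_n) :
  differentiable h x -> is_linearization h x ('J h x).
Proof.
move=> dh e e0.
have d0 : 0 < e / m.+1%:R by rewrite divr_gt0.
have /diff_locallyP [_ /eqaddoP /(_ _ d0)] := dh.
move=> hE; rewrite (near_shift 0) subr0; near=> y => /=.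
have : `|h (y + x) - (h x + 'd h x y)| <= e / m.+1%:R * `|y| by near: y.
rewrite addrK opprD addrA mul_rV_lin1.
set o := h (y + x) - h x - _ => h1.
have h2 := normr_le_enorm y.
rewrite (le_trans (enorm_le_normr _))//.
apply: (@le_trans _ _ (m.+1%:R * (e / m.+1%:R * `|y|))).
  by rewrite ler_pM// ler_nat.
by rewrite mulrA mulrCA divff ?mulr1// ler_wpM2l// ltW.
Unshelve. all: by end_near. Qed.

Lemma linearization_continuous n m (h : 'rV[R]_n -> 'rV[R]_m) x (D : 'M[R]_(n, m)) :
  is_linearization h x D -> h @ x --> h x.
Proof.
move=> hD; apply/(cvg_enormP (nbhs_filter x)) => e e0.
pose c : R := (m * n)%:R * `|D| + 1.
have c0 : 0 < c by rewrite ltr_wpDl// mulr_ge0.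
near=> y.
have yle : enorm (y - x) < e / c.
  by near: y; apply/nbhs_enormP; exists (e / c); rewrite ?divr_gt0.
have hle : enorm (h y - h x - (y - x) *m D) <= 1 * enorm (y - x).
  by near: y; exact: hD.
rewrite -[h y - h x](subrK ((y - x) *m D)) (le_lt_trans (enormD _ _))//.
have := enorm_mulmx_le (y - x) D.
have : enorm (y - x) * c < e by rewrite -ltr_pdivlMr.
rewrite /c; lra.
Unshelve. all: by end_near. Qed.

(** Fermat's rule: the stated vector is minus the gradient of the objective, which is differentiable
    at [x1] since the radicand is positive there. Second-order bounds on the increment replace a
    chain rule for the root. *)
Lemma min_regular_normal N m (A : set 'rV[R]_N) (h : 'rV[R]_N -> 'rV[R]_m)
    (D : 'M[R]_(N, m))
    (l x0 x1 : 'rV[R]_N) (C K dl : R) :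
  0 <= C -> 0 <= K -> 0 <= dl -> 0 < dotv (h x1) (h x1) + dl ->
  is_linearization h x1 D ->
  (\forall x \near x1, A x ->
    - dotv l x1 + C * Num.sqrt (dotv (h x1) (h x1) + dl) + K * dotv (x1 - x0) (x1 - x0)
    <= - dotv l x + C * Num.sqrt (dotv (h x) (h x) + dl) + K * dotv (x - x0) (x - x0)) ->
  regular_normal_cone A x1
    (l - (C / Num.sqrt (dotv (h x1) (h x1) + dl)) *: (h x1 *m D^T)
       - (2 * K) *: (x1 - x0)).
Proof.
move=> C0 K0 dl0 s20 dh xmin e e0.
set s := Num.sqrt (dotv (h x1) (h x1) + dl) in xmin *.
have s0 : 0 < s by rewrite sqrtr_gt0.
have ss : s * s = dotv (h x1) (h x1) + dl by rewrite -expr2 sqr_sqrtr// ltW.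
pose c : R := (m * N)%:R * `|D|.
have c0 : 0 <= c by rewrite mulr_ge0.
pose B := C / s * enorm (h x1); have B0 : 0 <= B by rewrite !mulr_ge0// invr_ge0 ltW.
pose E0 := C / s * (c + 1) ^+ 2 / 2 + K.
have D0 : 0 <= E0 by rewrite /E0 addr_ge0// divr_ge0// mulr_ge0 ?sqr_ge0// divr_ge0// ltW.
(* Half of [e] pays for the linearization error, multiplied by [B], and half for the quadratic terms
   collected in [E0]; [e1 <= 1] bounds the increment of h by [(c + 1) * enorm y]. *)
pose e1 := Num.min 1 (e / 2 / (B + 1)).
have e10 : 0 < e1 by rewrite lt_min ltr01 !divr_gt0// ltr_wpDl.
have e11 : e1 <= 1 by rewrite ge_min lexx.
have e1B : e1 * B <= e / 2.
  apply: (@le_trans _ _ (e / 2 / (B + 1) * (B + 1))); last first.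
    by rewrite divfK// gt_eqF// ltr_wpDl.
  apply: ler_pM => //; [exact: ltW|by rewrite ge_min lexx orbT|by rewrite lerDl].
have e2 : 0 < e / 2 / (E0 + 1) by rewrite !divr_gt0// ltr_wpDl.
near=> x.
have rle : enorm (h x - h x1 - (x - x1) *m D) <= e1 * enorm (x - x1).
  by near: x; exact: dh.
have yle : enorm (x - x1) <= e / 2 / (E0 + 1).
  by rewrite ltW//; near: x; apply/nbhs_enormP; exists (e / 2 / (E0 + 1)).
have xminA : A x ->
    - dotv l x1 + C * s + K * dotv (x1 - x0) (x1 - x0) <=
    - dotv l x + C * Num.sqrt (dotv (h x) (h x) + dl) + K * dotv (x - x0) (x - x0).
  by near: x.
move=> Ax; have {xminA}xminA := xminA Ax.
set y := x - x1 in rle yle *; set r := h x - h x1 - y *m D in rle.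
pose b := 2 * dotv (h x1) (y *m D) + e1 * enorm y * (2 * enorm (h x1))
          + (c + 1) ^+ 2 * enorm y ^+ 2.
pose v : 'rV[R]_m := y *m D + r.
have hx : h x = h x1 + v by rewrite /v /r (addrC (y *m _)) subrK addrC subrK.
have sq : dotv (h x) (h x) <= dotv (h x1) (h x1) + b.
  have yr : enorm v <= (c + 1) * enorm y.
    rewrite (le_trans (enormD _ _))// mulrDl lerD ?enorm_mulmx_le//.
    by rewrite (le_trans rle)// ler_wpM2r.
  have vE : dotv (h x1) v = dotv (h x1) (y *m D) + dotv (h x1) r.
    by rewrite dotvDr.
  have := cauchy_schwarz (h x1) r.
  have : enorm (h x1) * enorm r <= e1 * enorm y * enorm (h x1).
    by rewrite mulrC ler_wpM2r.
  have : enorm v ^+ 2 <= (c + 1) ^+ 2 * enorm y ^+ 2.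
    by rewrite -exprMn ler_pXn2r ?nnegrE ?mulr_ge0// addr_ge0.
  rewrite sqr_enorm hx dotv_sqrD vE /b; lra.
(* The root is concave, so its tangent at [s * s] bounds it from above. *)
have sqs : Num.sqrt (dotv (h x) (h x) + dl) <= s + b / (2 * s).
  have sb0 : 0 <= dotv (h x) (h x) + dl by rewrite addr_ge0 ?dotvv_ge0.
  have bE : b = b / (2 * s) * (2 * s) by field; rewrite gt_eqF.
  have b2 := sqr_ge0 (b / (2 * s)).
  set q := b / (2 * s) in bE b2 *.
  have : 0 <= s * (s + 2 * q) by lra.
  rewrite pmulr_rge0// => q0'; have q0 : 0 <= s + q by lra.
  rewrite -(@ler_pXn2r _ 2)// ?nnegrE ?sqrtr_ge0// sqr_sqrtr// sqrrD; lra.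
have E : C * (b / (2 * s)) = C / s * dotv (h x1) (y *m D)
    + e1 * B * enorm y + C / s * (c + 1) ^+ 2 / 2 * enorm y ^+ 2.
  by rewrite /b /B; field; rewrite gt_eqF.
have : C * Num.sqrt (dotv (h x) (h x) + dl) <= C * (s + b / (2 * s)).
  by rewrite ler_wpM2l.
rewrite mulrDr E => sqs'.
pose z : 'rV[R]_N := x1 - x0.
have xE : x - x0 = y + z by rewrite /y /z addrA subrK.
have qE : dotv (x - x0) (x - x0) = enorm y ^+ 2 + 2 * dotv z y + dotv z z.
  by rewrite xE dotv_sqrD sqr_enorm (dotvC z).
have lE : dotv l x = dotv l y + dotv l x1 by rewrite -dotvDr subrK.
rewrite qE lE -/z in xminA.
have -> : dotv (l - (C / s) *: (h x1 *m D^T) - (2 * K) *: z) y =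
    dotv l y - C / s * dotv (h x1) (y *m D) - 2 * K * dotv z y.
  by rewrite 2!dotvBl !dotvZl dotv_mulmx trmxK.
have De : E0 * enorm y <= e / 2.
  apply: (@le_trans _ _ (e / 2 / (E0 + 1) * (E0 + 1))); last first.
    by rewrite divfK// gt_eqF// ltr_wpDl.
  by rewrite mulrC ler_pM// lerDl.
have y0 := enorm_ge0 y.
have : E0 * enorm y ^+ 2 <= e / 2 * enorm y by rewrite expr2 mulrA ler_wpM2r.
have : e1 * B * enorm y <= e / 2 * enorm y by rewrite ler_wpM2r.
move: xminA sqs'; rewrite {1}/E0; lra.
Unshelve. all: by end_near. Qed.

(** Existence by compactness of a closed ball. The last hypothesis places every competitor at least
    as good as [x0] strictly inside, so the minimizer is a free local one on [A] and the ball adds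
    no normal. *)
Lemma interior_min_regular_normal N m (A : set 'rV[R]_N)
    (h : 'rV[R]_N -> 'rV[R]_m) (D : 'rV[R]_N -> 'M[R]_(N, m))
    (l x0 : 'rV[R]_N) (C K dl rho : R) :
  let phi x := - dotv l x + C * Num.sqrt (dotv (h x) (h x) + dl)
               + K * dotv (x - x0) (x - x0) in
  closed A -> A x0 -> 0 <= C -> 0 <= K -> 0 <= dl -> 0 < rho ->
  (forall x, A x -> enorm (x - x0) <= rho -> is_linearization h x (D x)) ->
  (forall x, A x -> enorm (x - x0) <= rho -> phi x <= phi x0 ->
    enorm (x - x0) < rho) ->
  exists x1, [/\ A x1, enorm (x1 - x0) < rho, phi x1 <= phi x0
    & 0 < dotv (h x1) (h x1) + dl -> regular_normal_cone A x1
      (l - (C / Num.sqrt (dotv (h x1) (h x1) + dl)) *: (h x1 *m (D x1)^T)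
         - (2 * K) *: (x1 - x0))].
Proof.
move=> phi clA Ax0 C0 K0 dl0 rho0 hD int.
pose B := A `&` [set x | enorm (x - x0) <= rho].
have cvx (x : 'rV[R]_N) : (fun y : 'rV[R]_N => y - x0) @ x --> x - x0.
  exact: (@cvgB _ _ _ (nbhs x) _ id (cst x0) x x0 (@cvg_id _ _) (cvg_cst _)).
have compB : compact B.
  apply: bounded_closed_compact.
    exists (rho + enorm x0); split; first exact: num_real.
    move=> y My v /= [_ /= vrho]; rewrite (le_trans (normr_le_enorm _))//.
    rewrite (le_trans (enorm_le_add v x0))// ltW// (le_lt_trans _ My)//.
    by rewrite addrC lerD2r.
  apply: closedI => //.
  apply: (@preimage_closed _ _ (fun x : 'rV[R]_N => enorm (x - x0)) [set a : R | a <= rho]).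
    by move=> x _; apply: (@cvg_enorm R N _ (nbhs x) _ _ _ (cvx x)).
  exact: closed_le.
have phic x : B x -> phi @ x --> phi x.
  move=> [Ax /= xrho]; have hc := linearization_continuous (hD x Ax xrho).
  have nf := nbhs_filter x.
  apply: cvgD; last by apply: cvgMr; exact: (cvg_dotv nf (cvx x) (cvx x)).
  apply: cvgD.
    by apply: cvgN; exact: (cvg_dotv nf (cvg_cst l) (@cvg_id _ _)).
  apply: cvgMr; apply: (@cvg_comp _ _ _ _ (@Num.sqrt R) _ _ (nbhs (Num.sqrt (dotv (h x) (h x) + dl)))).
    2: exact: sqrt_continuous.
  by apply: cvgD; [exact: (cvg_dotv nf hc hc)|exact: cvg_cst].
have [||x1 x1B x1min] := @compact_EVT_min _ _ phi B _ compB.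
- by exists x0; split; rewrite //= subrr enorm0 ltW.
- apply: continuous_in_subspaceT => x; rewrite inE => Bx; exact: phic.
have [Ax1 /= x1rho] : B x1 by rewrite inE in x1B.
have x0B : x0 \in B by rewrite inE; split; rewrite //= subrr enorm0 ltW.
have x1rho' : enorm (x1 - x0) < rho by apply: int => //; exact: x1min.
exists x1; split => //; first exact: x1min.
move=> s0; apply: min_regular_normal => //; first exact: hD.
apply/nbhs_enormP; exists (rho - enorm (x1 - x0)); first by rewrite subr_gt0.
move=> y yx1 Ay; apply: x1min; rewrite inE; split => //=.
by rewrite (le_trans (enorm_triangle x1 _ _))// -lerBrDr ltW.
Qed.

End Sequences.

(** * Maximally monotone maps *)

Section MaximalMonotone.
Context {R : realType} {n : nat}.
Implicit Types F : 'rV[R]_n -> set 'rV[R]_n.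

(** The graph enlarged by the point [(x, u)] is still monotone, so maximality absorbs the point. *)
Lemma maximally_monotone_mem F x u : maximally_monotone F ->
  (forall a b, F a b -> 0 <= dotv (b - u) (a - x)) -> F x u.
Proof.
move=> [monoF maxF] xu.
pose F' := fun a => [set b | F a b \/ (a = x /\ b = u)].
have monoF' : monotone_map F'.
  move=> a0 a1 b0 b1 [F0|[-> ->]] [F1|[-> ->]]; first exact: monoF.
  - by rewrite -opprB -(opprB a0) dotvNl dotvNr opprK; exact: xu.
  - exact: xu.
  - by rewrite !subrr dotv0l.
have := maxF _ monoF' _ (row_mx x u); rewrite /gph /= row_mxKl row_mxKr; apply.
- by move=> z /= Fz; left.
- by right.
Qed.

(** Being monotonically related to a fixed point of the graph is a closed condition, so it holds on
    the closure, and maximality then applies. *)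
Lemma maximally_monotone_closed F : maximally_monotone F -> closed (gph F).
Proof.
move=> mF z clz; rewrite /gph /=; apply: maximally_monotone_mem => // a b Fab.
pose g (y : 'rV[R]_(n + n)) := dotv (b - rsubmx y) (a - lsubmx y).
suff : closed [set y | 0 <= g y].
  apply; apply: closureS clz => y /= Fy; exact: mF.1 Fy Fab.
apply: (@preimage_closed _ _ g [set r : R | 0 <= r]); last exact: closed_ge.
move=> y _; apply: (@cvg_dotv R n _ (nbhs y)).
  apply: cvgB; first exact: cvg_cst.
  exact: (cvg_rsubmx (@cvg_id _ (nbhs y))).
apply: cvgB; first exact: cvg_cst.
exact: (cvg_lsubmx (@cvg_id _ (nbhs y))).
Qed.

Lemma gph_row_mx m (S : 'rV[R]_n -> set 'rV[R]_m) x y :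
  gph S (row_mx x y) = S x y.
Proof. by rewrite /gph /= row_mxKl row_mxKr. Qed.

Lemma closed_sequence N (A : set 'rV[R]_N) (u : nat -> 'rV[R]_N) (l : 'rV[R]_N) :
  closed A -> (forall k, A (u k)) -> u @ \oo --> l -> A l.
Proof.
move=> clA Au ul; apply: (@closed_cvg _ _ \oo _ u A clA _ l ul).
by exists 0%N => // k _; exact: Au.
Qed.

Lemma maximally_monotone_cvg F (xk uk : nat -> 'rV[R]_n) (x u : 'rV[R]_n) :
  maximally_monotone F -> (forall k, F (xk k) (uk k)) ->
  xk @ \oo --> x -> uk @ \oo --> u -> F x u.
Proof.
move=> mF Fk xkx uku; rewrite -gph_row_mx.
apply: (closed_sequence (maximally_monotone_closed mF) _ (cvg_row_mx xkx uku)).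
by move=> k; rewrite gph_row_mx.
Qed.

End MaximalMonotone.

Section Linearization.
Context {R : realType}.

Lemma linearization_jacobian n m (h : 'rV[R]_n -> 'rV[R]_m) x (D : 'M[R]_(n, m)) :
  is_linearization h x D -> 'J h x = D.
Proof.
move=> hD.
have cD : continuous (mulmxr D : 'rV[R]_n -> 'rV[R]_m).
  move=> y; apply: (@cvg_mulmx R _ (nbhs y) _ _ _ id y (cst D) D); first exact: cvg_id.
  exact: cvg_cst.
suff dE : 'd h x = mulmxr D :> ('rV[R]_n -> 'rV[R]_m).
  apply/row_matrixP => i; rewrite !rowE mul_rV_lin1 /=.
  by rewrite dE.
apply: diff_unique => //; apply/eqaddoP => e e0.
have d0 : 0 < e / n.+1%:R by rewrite divr_gt0.
have := hD _ d0; rewrite (near_shift 0) subr0; apply: filterS => y /=.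
rewrite /shift /= addrK => hy.
rewrite (le_trans (normr_le_enorm _))//.
rewrite -[X in enorm X]/(h (y + x) - (h x + y *m D)) opprD addrA.
rewrite (le_trans hy)// -mulrA ler_wpM2l ?(ltW e0)//.
by rewrite ler_pdivrMl// (le_trans (enorm_le_normr _))// ler_wpM2r// ler_nat.
Qed.

End Linearization.

(** * Metric regularity from the coderivative condition *)

Section MatrixBlocks.
Context {R : realType}.

Lemma enorm_row_mx0l d n (b : 'rV[R]_n) : enorm (row_mx (0 : 'rV_d) b) = enorm b.
Proof. by rewrite /enorm dotv_row_mx dotv0l add0r. Qed.

Lemma cvg_dsubmx T (G : set_system T) (FF : Filter G) d n m
    (A : T -> 'M[R]_(d + n, m)) (B : 'M[R]_(d + n, m)) :
  A @ G --> B -> (fun t => dsubmx (A t)) @ G --> dsubmx B.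
Proof.
move=> /cvgrPdist_lt AB; apply/cvgrPdist_lt => e /AB; apply: filterS => t.
apply: le_lt_trans; rewrite -linearB; apply: normr_le_entries => // i j.
by rewrite mxE entry_le_normr.
Qed.

Lemma cvg_usubmx T (G : set_system T) (FF : Filter G) d n m
    (A : T -> 'M[R]_(d + n, m)) (B : 'M[R]_(d + n, m)) :
  A @ G --> B -> (fun t => usubmx (A t)) @ G --> usubmx B.
Proof.
move=> /cvgrPdist_lt AB; apply/cvgrPdist_lt => e /AB; apply: filterS => t.
apply: le_lt_trans; rewrite -linearB; apply: normr_le_entries => // i j.
by rewrite mxE entry_le_normr.
Qed.

End MatrixBlocks.

Section Solvability.
Context {R : realType} {d n : nat}.
Context (pbar : 'rV[R]_d) (xbar : 'rV[R]_n).
Context (f : 'rV[R]_d -> 'rV[R]_n -> 'rV[R]_n).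

(** Jacobians act on row vectors from the right, so the derivatives in p and in x are the upper and
    lower row blocks of the joint Jacobian. *)
Definition jacobian_p p x : 'M[R]_(d, n) := usubmx ('J (joint f) (row_mx p x)).
Definition jacobian_x p x : 'M[R]_(n, n) := dsubmx ('J (joint f) (row_mx p x)).
Local Notation Jp := jacobian_p.
Local Notation Jx := jacobian_x.

Lemma joint_row_mx p x : joint f (row_mx p x) = f p x.
Proof. by rewrite /joint row_mxKl row_mxKr. Qed.

Lemma joint_linearization p x : differentiable (joint f) (row_mx p x) ->
  forall e : R, 0 < e -> exists2 r : R, 0 < r &
    forall (p' : 'rV[R]_d) (x' : 'rV[R]_n), enorm (p' - p) < r -> enorm (x' - x) < r ->
    enorm (f p' x' - f p x - ((p' - p) *m Jp p x + (x' - x) *m Jx p x))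
      <= e * (enorm (p' - p) + enorm (x' - x)).
Proof.
move=> /differentiable_linearization df e e0.
have /nbhs_enormP[r r0 rP] := df _ e0.
exists (r / 2) => [|p' x' p'p x'x]; first by rewrite divr_gt0.
have px : enorm (row_mx p' x' - row_mx p x) <= enorm (p' - p) + enorm (x' - x).
  by rewrite row_mxB enorm_row_mx_le.
have := rP (row_mx p' x'); rewrite !joint_row_mx -mul_row_col vsubmxK -row_mxB.
move=> H; rewrite (le_trans (H _))//; last by rewrite ler_wpM2l// ltW.
by rewrite (le_lt_trans px)//; lra.
Qed.

Lemma linearization_partial p x : differentiable (joint f) (row_mx p x) ->
  is_linearization (f p) x (Jx p x).
Proof.
move=> /joint_linearization fl e e0; have [r r0 H] := fl _ e0.
apply/nbhs_enormP; exists r => // y yx.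
have := H p y; rewrite subrr enorm0 mul0mx !add0r; exact.
Qed.

Lemma jacobian_partial p x : differentiable (joint f) (row_mx p x) ->
  'J (f p) x = Jx p x.
Proof. by move=> /linearization_partial/linearization_jacobian. Qed.

Hypothesis f_C1 : continuously_differentiable_at (joint f) (row_mx pbar xbar).

Lemma differentiable_near : exists2 r : R, 0 < r &
  forall (p : 'rV[R]_d) (x : 'rV[R]_n), enorm (p - pbar) < r -> enorm (x - xbar) < r ->
    differentiable (joint f) (row_mx p x).
Proof.
have [/nbhs_enormP[r r0 rP] _] := f_C1.
exists (r / 2) => [|p x pp xx]; first by rewrite divr_gt0.
apply: rP; rewrite row_mxB (le_lt_trans (enorm_row_mx_le _ _))//; lra.
Qed.

Lemma cvg_jacobian (pk : nat -> 'rV[R]_d) (xk : nat -> 'rV[R]_n) :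
  pk @ \oo --> pbar -> xk @ \oo --> xbar ->
  (fun k => 'J (joint f) (row_mx (pk k) (xk k))) @ \oo
    --> 'J (joint f) (row_mx pbar xbar).
Proof.
move=> pkp xkx; have [_ cJ] := f_C1.
exact: (cvg_comp _ _ (cvg_row_mx pkp xkx) cJ).
Qed.

Hypothesis fbar_mono : monotone_map (fun x => [set f pbar x]).

Lemma jacobian_x_psd w : 0 <= dotv (w *m Jx pbar xbar) w.
Proof.
have [|w0] := eqVneq w 0; first by move=> ->; rewrite mul0mx dotv0l.
have {w0}w0 : 0 < enorm w by rewrite enorm_gt0.
rewrite leNgt; apply/negP => neg.
have df : differentiable (joint f) (row_mx pbar xbar).
  by have [/nbhs_singleton] := f_C1.
set a := dotv _ w in neg.
(* With this tolerance the linearization error contributes at most [- a / 2 * t ^+ 2], half of the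
   negative term [t ^+ 2 * a], and monotonicity is violated. *)
pose e := - a / (2 * enorm w ^+ 2).
have e0 : 0 < e by rewrite divr_gt0 ?oppr_gt0// mulr_gt0// exprn_gt0.
have [r r0 H] := joint_linearization df e0.
pose t := r / (2 * enorm w).
have t0 : 0 < t by rewrite divr_gt0// mulr_gt0.
have tw : enorm (t *: w) = r / 2.
  by rewrite enormZ gtr0_norm// /t invfM mulrA divfK// gt_eqF.
have xE : xbar + t *: w - xbar = t *: w by rewrite addrAC subrr add0r.
have := H pbar (xbar + t *: w).
rewrite xE subrr enorm0 mul0mx !add0r tw => /(_ r0).
set g := f pbar _ - f pbar xbar; rewrite -scalemxAl.
have -> : r / 2 < r by lra.
move=> /(_ isT) Hg.
have := @fbar_mono xbar (xbar + t *: w) _ _ erefl erefl.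
rewrite xE -/g => mono.
have gE : dotv g (t *: w) = dotv (g - t *: (w *m Jx pbar xbar)) (t *: w) + t ^+ 2 * a.
  rewrite -{1}[g](subrK (t *: (w *m Jx pbar xbar))) [LHS]dotvDl; congr (_ + _).
  by rewrite dotvZl dotvZr -/a expr2 mulrA.
have := cauchy_schwarz (g - t *: (w *m Jx pbar xbar)) (t *: w).
have : enorm (g - t *: (w *m Jx pbar xbar)) * enorm (t *: w) <= e * (r / 2) * (r / 2).
  by rewrite tw ler_wpM2r// divr_ge0// ltW.
have E : e * (r / 2) * (r / 2) = - a / 2 * t ^+ 2.
  by rewrite /e /t; field; rewrite gt_eqF.
have : t ^+ 2 * a < 0 by rewrite pmulr_rlt0// exprn_gt0.
move: mono; rewrite gE E; lra.
Qed.

Context (F : 'rV[R]_n -> set 'rV[R]_n).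
Hypothesis F_maxmono : maximally_monotone F.
Local Notation ubar := (- f pbar xbar).
Hypothesis regularity : forall w,
  [set partial_jacobian_adj f pbar xbar w + v
     | v in coderivative F xbar ubar w] 0 -> w = 0.

(* Quantitative form of the coderivative criterion, by compactness of the unit
   sphere. *)
Lemma regularity_uniform : exists2 e : R, 0 < e &
  forall (p : 'rV[R]_d) (x u w : 'rV[R]_n) (v : 'rV[R]_(n + n)),
  enorm (p - pbar) < e -> enorm (x - xbar) < e -> enorm (u - ubar) < e ->
  F x u -> enorm w = 1 -> regular_normal_cone (gph F) (row_mx x u) v ->
  e <= enorm (v + row_mx (w *m (Jx p x)^T) w).
Proof.
apply: contrapT => nH.
pose T := ('rV[R]_d * 'rV[R]_n * 'rV[R]_n * 'rV[R]_n * 'rV[R]_(n + n))%type.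
have ex (k : nat) : exists z : T, let: (p, x, u, w, v) := z in
    [/\ enorm (p - pbar) <= k.+1%:R^-1, enorm (x - xbar) <= k.+1%:R^-1 &
        enorm (u - ubar) <= k.+1%:R^-1] /\
    [/\ F x u, enorm w = 1, regular_normal_cone (gph F) (row_mx x u) v &
      enorm (v - - row_mx (w *m (Jx p x)^T) w) <= k.+1%:R^-1].
  apply: contrapT => nex; apply: nH.
  exists k.+1%:R^-1 => [|p x u w v pp xx uu Fxu w1 vN]; first by rewrite invr_gt0.
  rewrite leNgt; apply/negP => lt; apply: nex; exists (p, x, u, w, v).
  by split; split => //; try exact: ltW; rewrite opprK; exact: ltW.
have [z zP] := choice ex.
pose p k := (z k).1.1.1.1; pose x k := (z k).1.1.1.2; pose u k := (z k).1.1.2.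
pose w k := (z k).1.2; pose v k := (z k).2.
have {}zP k : [/\ enorm (p k - pbar) <= k.+1%:R^-1,
      enorm (x k - xbar) <= k.+1%:R^-1 & enorm (u k - ubar) <= k.+1%:R^-1] /\
    [/\ F (x k) (u k), enorm (w k) = 1,
      regular_normal_cone (gph F) (row_mx (x k) (u k)) (v k) &
      enorm (v k - - row_mx (w k *m (Jx (p k) (x k))^T) (w k)) <= k.+1%:R^-1].
  by have := zP k; rewrite /p /x /u /w /v; case: (z k) => [[[[]]]].
have t0 := (@decreases_to0_natSinv R).2.
have px : p @ \oo --> pbar by apply: cvg_enorm_le t0 _ => k; have [[]] := zP k.
have xx : x @ \oo --> xbar by apply: cvg_enorm_le t0 _ => k; have [[]] := zP k.
have uu : u @ \oo --> ubar by apply: cvg_enorm_le t0 _ => k; have [[]] := zP k.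
have [phi [wl [phik wwl]]] : exists (phi : nat -> nat) (l : 'rV[R]_n),
    (forall k, (k <= phi k)%N) /\ (w \o phi) @ \oo --> l.
  by apply: (@bounded_subsequence _ _ w 1) => k; have [_ [_ ->]] := zP k.
have wl1 : enorm wl = 1.
  apply: (cvg_unique _ (cvg_enorm _ wwl)) => //.
  have -> : (fun k => enorm ((w \o phi) k)) = cst 1.
    by apply/funext => k; have [_ [_ ->]] := zP (phi k).
  exact: cvg_cst.
have JJ : (fun k => (Jx (p k) (x k))^T) \o phi @ \oo --> (Jx pbar xbar)^T.
  apply: cvg_subsequence => //; apply: cvg_trmx; apply: cvg_dsubmx.
  exact: cvg_jacobian.
pose b k : 'rV[R]_(n + n) := - row_mx (w k *m (Jx (p k) (x k))^T) (w k).
have bl : (b \o phi) @ \oo --> - row_mx (wl *m (Jx pbar xbar)^T) wl.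
  by apply: cvgN; apply: cvg_row_mx => //; exact: cvg_mulmx wwl JJ.
have vb : (fun k => v k - b k) @ \oo --> (0 : 'rV[R]_(n + n)).
  by apply: cvg_enorm_le t0 _ => k; rewrite subr0; have [_ []] := zP k.
have vl : (v \o phi) @ \oo --> - row_mx (wl *m (Jx pbar xbar)^T) wl.
  have -> : v \o phi = (fun k => v (phi k) - b (phi k) + b (phi k)).
    by apply/funext => k; rewrite subrK.
  by rewrite -[X in _ --> X]add0r; apply: cvgD => //; exact: (cvg_subsequence phik vb).
suff wl0 : wl = 0 by move: wl1; rewrite wl0 enorm0 => /eqP; rewrite eq_sym oner_eq0.
have df : differentiable (joint f) (row_mx pbar xbar).
  by have [/nbhs_singleton] := f_C1.
(* The limit [- row_mx (wl *m (Jx pbar xbar)^T) wl] is a limiting normal to [gph F]; by the sign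
   convention of [coderivative], its first block lies in the coderivative at [wl]. *)
apply: regularity; exists (- (wl *m (Jx pbar xbar)^T)).
  exists (fun k => row_mx (x (phi k)) (u (phi k))), (v \o phi); split.
  - by move=> k; rewrite gph_row_mx; have [_ []] := zP (phi k).
  - exact: cvg_row_mx (cvg_subsequence phik xx) (cvg_subsequence phik uu).
  - by move=> k; have [_ []] := zP (phi k).
  - by rewrite -opp_row_mx.
by rewrite /partial_jacobian_adj jacobian_partial// subrr.
Qed.

(** If the residual were nonzero at the minimizer [z1], its direction w would be a unit vector and
    [- row_mx (w *m (Jx p x)^T) w - (2 * K) *: (z1 - z0)] a regular normal to [gph F], so that
    [regularity_uniform] would give [e <= 2 * K * enorm (z1 - z0)]. The constants make the
    right-hand side at most [e / 2]. *)
Lemma uniform_solvability : exists2 kap : R, 0 < kap & exists2 r : R, 0 < r &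
  forall (p : 'rV[R]_d) (x u y : 'rV[R]_n), enorm (p - pbar) < r -> enorm (x - xbar) < r ->
  enorm (u - ubar) < r -> F x u -> enorm (y - (f p x + u)) < r ->
  exists x' u' : 'rV[R]_n, [/\ F x' u', f p x' + u' = y,
    enorm (x' - x) <= kap * enorm (y - (f p x + u)) &
    enorm (u' - u) <= kap * enorm (y - (f p x + u))].
Proof.
have [e e0 normal_ge] := regularity_uniform.
have [rd rd0 diff_rd] := differentiable_near.
pose eps := e / 4; have eps0 : 0 < eps by rewrite divr_gt0.
pose r0 := Num.min e rd.
have r00 : 0 < r0 by rewrite lt_min e0.
have r0e : r0 <= e by rewrite ge_min lexx.
have r0rd : r0 <= rd by rewrite ge_min lexx orbT.
exists eps^-1; first by rewrite invr_gt0.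
(* The second bound gives [rho < r0 / 2], so the ball searched around [z0] stays within [r0] of the
   reference point. *)
pose r := Num.min (r0 / 2) (eps * r0 / 4).
have r_0 : r <= r0 / 2 by rewrite ge_min lexx.
have r_e : r <= eps * r0 / 4 by rewrite ge_min lexx orbT.
exists r; first by rewrite lt_min !divr_gt0// mulr_gt0.
move=> p x u y pr xr ur Fxu yr.
set eta := enorm _ in yr *.
have [eta0|eta_neq0] := eqVneq eta 0.
  exists x, u; split => //; last 2 first.
  - by rewrite eta0 mulr0 subrr enorm0.
  - by rewrite eta0 mulr0 subrr enorm0.
  by apply/eqP; rewrite eq_sym -subr_eq0; apply/eqP/enorm0_eq0.
have eta0 : 0 < eta by rewrite lt_neqAle eq_sym eta_neq0 enorm_ge0.
pose h (z : 'rV[R]_(n + n)) : 'rV[R]_n := f p (lsubmx z) + rsubmx z - y.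
pose D (z : 'rV[R]_(n + n)) : 'M[R]_(n + n, n) := col_mx (Jx p (lsubmx z)) 1%:M.
pose rho := 2 * eta / eps.
have rho0 : 0 < rho by rewrite divr_gt0// mulr_gt0.
have rhor : rho < r0 / 2.
  rewrite /rho ltr_pdivrMr//; lra.
pose z0 : 'rV[R]_(n + n) := row_mx x u.
have hz0 : enorm (h z0) = eta by rewrite /h /z0 row_mxKl row_mxKr enormBC.
have near_x z : enorm (z - z0) <= rho -> enorm (lsubmx z - xbar) < r0.
  move=> zz0; rewrite (le_lt_trans (enorm_triangle x _ _))//.
  have := enorm_lsubmx (z - z0); rewrite linearB /= row_mxKl; lra.
have near_u z : enorm (z - z0) <= rho -> enorm (rsubmx z - ubar) < r0.
  move=> zz0; rewrite (le_lt_trans (enorm_triangle u _ _))//.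
  have := enorm_rsubmx (z - z0); rewrite linearB /= row_mxKr; lra.
have pr0 : enorm (p - pbar) < r0 by lra.
(* Comparison with [z0] gives [K * enorm (z - z0) ^+ 2 <= eta], that is, distance at most
   [eta / eps]. This is half of [rho], so the minimizer is interior, and it is the claimed bound
   with [kap = eps^-1]. *)
pose K := eps ^+ 2 / eta.
have K0 : 0 < K by rewrite divr_gt0// exprn_gt0.
have sqrtE z : Num.sqrt (dotv (h z) (h z) + 0) = enorm (h z) by rewrite addr0.
have close z : - dotv 0 z + 1 * Num.sqrt (dotv (h z) (h z) + 0)
      + K * dotv (z - z0) (z - z0)
    <= - dotv 0 z0 + 1 * Num.sqrt (dotv (h z0) (h z0) + 0)
      + K * dotv (z0 - z0) (z0 - z0) -> enorm (z - z0) <= eta / eps.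
  rewrite !dotv0l oppr0 !sqrtE hz0 !add0r !mul1r subrr dotv0l mulr0 addr0.
  rewrite -sqr_enorm => le.
  have le2 : K * enorm (z - z0) ^+ 2 <= eta by have := enorm_ge0 (h z); lra.
  rewrite -(@ler_pXn2r _ 2)// ?nnegrE ?divr_ge0 ?(ltW eps0) ?(ltW e0) ?(ltW eta0)//.
  have -> : (eta / eps) ^+ 2 = eta / K by rewrite /K; field; rewrite !gt_eqF.
  by rewrite ler_pdivlMr// mulrC.
have [|||z1 [Fz1 z1rho z1min z1N]] := @interior_min_regular_normal R _ _ (gph F)
    h D 0 z0 1 K 0 rho (maximally_monotone_closed F_maxmono) _ ler01 (ltW K0)
    (lexx 0) rho0.
- by rewrite gph_row_mx.
- move=> z Fz zz0 e1 e10.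
  have dz : differentiable (joint f) (row_mx p (lsubmx z)).
    by apply: diff_rd; have := near_x _ zz0; lra.
  have [r1 r10 H] := joint_linearization dz e10.
  apply/nbhs_enormP; exists r1 => // z' z'z.
  have lz : enorm (lsubmx z' - lsubmx z) <= enorm (z' - z).
    by rewrite -linearB enorm_lsubmx.
  rewrite -[X in X *m D z]hsubmxK /D mul_row_col mulmx1 /h.
  have := H p (lsubmx z'); rewrite subrr enorm0 mul0mx !add0r.
  move=> /(_ r10 (le_lt_trans lz z'z)) le1.
  rewrite (le_trans _ (le_trans le1 _))//; last by rewrite ler_wpM2l// ltW.
  rewrite !linearB /= le_eqVlt; apply/orP; left; apply/eqP; congr enorm.
  by apply/rowP => i; rewrite !mxE; lra.
- move=> z _ _ /close zz0; rewrite (le_lt_trans zz0)// /rho ltr_pM2r ?invr_gt0//.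
  lra.
have {}z1min := close _ z1min.
have Fz1' : F (lsubmx z1) (rsubmx z1) by [].
exists (lsubmx z1), (rsubmx z1); rewrite mulrC.
have xz : enorm (lsubmx z1 - x) <= eta / eps.
  by have := enorm_lsubmx (z1 - z0); rewrite linearB /= row_mxKl; lra.
have uz : enorm (rsubmx z1 - u) <= eta / eps.
  by have := enorm_rsubmx (z1 - z0); rewrite linearB /= row_mxKr; lra.
split => //.
apply: contrapT => hz1.
have h10 : 0 < enorm (h z1).
  by rewrite enorm_gt0 /h subr_eq0; apply/eqP.
have := z1N; rewrite sqrtE addr0 -sqr_enorm exprn_gt0// => /(_ isT) {}z1N.
pose w := (enorm (h z1))^-1 *: h z1.
have w1 : enorm w = 1.
  by rewrite enormZ gtr0_norm ?invr_gt0// mulVf// gt_eqF.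
have z1E : z1 = row_mx (lsubmx z1) (rsubmx z1) by rewrite hsubmxK.
have := z1N; rewrite {1}z1E => /(normal_ge p _ _ w) H.
have := H _ _ _ Fz1' w1.
have -> : 0 - (1 / enorm (h z1)) *: (h z1 *m (D z1)^T) - (2 * K) *: (z1 - z0)
    + row_mx (w *m (Jx p (lsubmx z1))^T) w = - ((2 * K) *: (z1 - z0)).
  rewrite /D tr_col_mx mul_mx_row trmx1 mulmx1 /w -scalemxAl -scale_row_mx.
  by rewrite sub0r mul1r addrAC addNr add0r.
rewrite enormN enormZ gtr0_norm; last exact: mulr_gt0.
have n1 := near_x _ (ltW z1rho); have n2 := near_u _ (ltW z1rho).
have pe : enorm (p - pbar) < e by lra.
have xe : enorm (lsubmx z1 - xbar) < e by lra.
have ue : enorm (rsubmx z1 - ubar) < e by lra.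
move=> /(_ pe xe ue).
have : 2 * K * enorm (z1 - z0) <= 2 * K * (eta / eps).
  by rewrite ler_wpM2l// mulr_ge0// ltW.
have -> : 2 * K * (eta / eps) = 2 * eps by rewrite /K; field; rewrite !gt_eqF.
rewrite /eps; lra.
Qed.

End Solvability.

(** * A mean value inequality from one-sided growth *)

Section DiniBound.
Context {R : realType}.

(** Continuous induction: the supremum of the times at which the bound holds satisfies it by
    continuity, and the forward estimate carries it further unless it is [T]. One-sided growth suits
    maps for which only contingent derivatives are at hand. *)
Lemma dini_bound m (s : R -> 'rV[R]_m) (M T : R) : 0 <= T ->
  (forall t, 0 <= t <= T -> forall e, 0 < e -> exists2 dl : R, 0 < dl &
    forall t', 0 <= t' <= T -> `|t' - t| < dl -> enorm (s t' - s t) < e) ->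
  (forall t, 0 <= t < T -> exists2 dl : R, 0 < dl &
    forall h, 0 < h < dl -> enorm (s (t + h) - s t) <= M * h) ->
  enorm (s T - s 0) <= M * T.
Proof.
move=> T0 cs ds.
pose E := [set t | 0 <= t <= T /\ enorm (s t - s 0) <= M * t].
have E0 : E 0 by split; rewrite ?lexx ?T0// subrr enorm0 mulr0.
have ubE : ubound E T by move=> t [/andP[]].
have supE : has_sup E by split; [exists 0|exists T].
set a := sup E.
have Ea_le t : E t -> t <= a by move=> Et; apply: ub_le_sup => //; exists T.
have a0 : 0 <= a by exact: Ea_le.
have aT : a <= T by apply: ge_sup => //; exists 0.
have aT' : 0 <= a <= T by rewrite a0.
have Ea : E a.
  split => //; apply/ler_addgt0Pr => e e0.
  have e'0 : 0 < e / (2 * (`|M| + 1)) by rewrite divr_gt0// mulr_gt0// ltr_wpDl.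
  have [dl dl0 near_a] := cs a aT' (e / 2) (divr_gt0 e0 (ltr0Sn _ 1)).
  have md0 : 0 < Num.min dl (e / (2 * (`|M| + 1))) by rewrite lt_min dl0.
  have [t [t01 tE] at'] := sup_adherent md0 supE.
  have ta : t <= a by exact: Ea_le.
  have [lt1 lt2] : a - t < dl /\ a - t < e / (2 * (`|M| + 1)).
    by move: at'; rewrite -/a ltrBlDr -ltrBlDl lt_min => /andP.
  have sta : enorm (s t - s a) < e / 2.
    by apply: near_a => //; rewrite distrC ger0_norm// subr_ge0.
  have Mt : M * t <= M * a + e / 2.
    have : (a - t) * (2 * (`|M| + 1)) < e by rewrite -ltr_pdivlMr// mulr_gt0// ltr_wpDl.
    have : - `|M| * (a - t) <= M * (a - t).
      by rewrite ler_wpM2r ?subr_ge0// lerNl -normrN ler_norm.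
    have : 0 <= a - t by rewrite subr_ge0.
    lra.
  rewrite (le_trans (enorm_triangle (s t) _ _))// enormBC; lra.
have [aT1|->//] : a < T \/ T = a.
  by move: aT; rewrite le_eqVlt => /orP[/eqP->|]; [right|left].
  2: by case: Ea.
have [|dl dl0 near_a] := ds a; first by rewrite a0.
pose h := Num.min (dl / 2) (T - a).
have h0 : 0 < h by rewrite lt_min subr_gt0 aT1 divr_gt0.
have hdl : h <= dl / 2 by rewrite ge_min lexx.
have hT : h <= T - a by rewrite ge_min lexx orbT.
have : E (a + h).
  split; first by apply/andP; split; lra.
  rewrite (le_trans (enorm_triangle (s a) _ _))// mulrDr addrC lerD ?Ea.2//.
  by apply: near_a; apply/andP; split; lra.
move=> /Ea_le; lra.
Qed.

End DiniBound.

(** * Uniqueness and Lipschitz stability of solutions *)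

Section Regularity.
Context {R : realType} {d n : nat}.
Context (pbar : 'rV[R]_d) (xbar : 'rV[R]_n).
Context (f : 'rV[R]_d -> 'rV[R]_n -> 'rV[R]_n).
Hypothesis f_C1 : continuously_differentiable_at (joint f) (row_mx pbar xbar).

(** By continuity the Jacobian stays within 1 of its reference value, and the growth bound is
    integrated along segments. In the constant [c + 1], [c] bounds the linear part and 1 is the
    tolerance of the linearization. *)
Lemma joint_locally_lipschitz : exists2 k : R, 0 < k & exists2 r : R, 0 < r &
  forall (p p' : 'rV[R]_d) (x x' : 'rV[R]_n),
  enorm (p - pbar) < r -> enorm (p' - pbar) < r ->
  enorm (x - xbar) < r -> enorm (x' - xbar) < r ->
  enorm (f p' x' - f p x) <= k * (enorm (p' - p) + enorm (x' - x)).
Proof.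
have [rd rd0 diff_rd] := differentiable_near f_C1.
have [_ cJ] := f_C1.
pose J z := 'J (joint f) z.
have : \forall z \near row_mx pbar xbar, `|J (row_mx pbar xbar) - J z| < 1.
  by move/cvgrPdist_lt : cJ; exact.
move=> /nbhs_enormP[rJ rJ0 Jle].
pose c : R := (n * (d + n))%:R * (`|J (row_mx pbar xbar)| + 1).
have c0 : 0 <= c by rewrite mulr_ge0// addr_ge0.
exists (c + 1); first by rewrite ltr_wpDl.
pose r := Num.min rd (rJ / 2).
have rrd : r <= rd by rewrite ge_min lexx.
have rrJ : r <= rJ / 2 by rewrite ge_min lexx orbT.
exists r; first by rewrite lt_min rd0 divr_gt0.
move=> p p' x x' pr p'r xr x'r.
pose D := enorm (p' - p) + enorm (x' - x).
have D0 : 0 <= D by rewrite addr_ge0.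
have seg m (a a' b : 'rV[R]_m) t : 0 <= t <= 1 -> enorm (a - b) < r ->
    enorm (a' - b) < r -> enorm (a + t *: (a' - a) - b) < r.
  move=> /andP[t0 t1] ab a'b.
  have -> : a + t *: (a' - a) - b = (1 - t) *: (a - b) + t *: (a' - b).
    by apply/rowP => i; rewrite !mxE; lra.
  rewrite (le_lt_trans (enormD _ _))// !enormZ !ger0_norm ?subr_ge0//.
  have [->|t0'] := eqVneq t 0; first by rewrite subr0 mul0r mul1r addr0.
  have : t * enorm (a' - b) < t * r by rewrite ltr_pM2l// lt_neqAle eq_sym t0'.
  have : (1 - t) * enorm (a - b) <= (1 - t) * r by rewrite ler_wpM2l ?subr_ge0// ltW.
  lra.
pose pt t : 'rV[R]_d := p + t *: (p' - p); pose xt t : 'rV[R]_n := x + t *: (x' - x).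
have ptB t t' : pt t' - pt t = (t' - t) *: (p' - p).
  by rewrite /pt scalerBl opprD addrACA subrr add0r.
have xtB t t' : xt t' - xt t = (t' - t) *: (x' - x).
  by rewrite /xt scalerBl opprD addrACA subrr add0r.
pose s t := f (pt t) (xt t).
have key t : 0 <= t <= 1 -> exists2 dl : R, 0 < dl &
    forall t', `|t' - t| < dl -> enorm (s t' - s t) <= (c + 1) * D * `|t' - t|.
  move=> t01; have ptr := seg _ _ _ _ _ t01 pr p'r.
  have xtr := seg _ _ _ _ _ t01 xr x'r.
  have dt : differentiable (joint f) (row_mx (pt t) (xt t)).
    by apply: diff_rd; apply: lt_le_trans rrd.
  have [r1 r10 H] := joint_linearization dt ltr01.
  exists (r1 / (D + 1)) => [|t' t't]; first by rewrite divr_gt0// ltr_wpDl.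
  have tD : `|t' - t| * (D + 1) < r1 by rewrite -ltr_pdivlMr// ltr_wpDl.
  have tDD : `|t' - t| * D <= `|t' - t| * (D + 1) by rewrite ler_wpM2l// lerDl.
  have pp : enorm (pt t' - pt t) <= `|t' - t| * D.
    by rewrite ptB enormZ ler_wpM2l// lerDl.
  have xx : enorm (xt t' - xt t) <= `|t' - t| * D.
    by rewrite xtB enormZ ler_wpM2l// lerDr.
  have := H (pt t') (xt t') (le_lt_trans pp (le_lt_trans tDD tD))
    (le_lt_trans xx (le_lt_trans tDD tD)).
  rewrite mul1r -/(s t) -/(s t') -mul_row_col vsubmxK ptB xtB -scale_row_mx.
  rewrite -scalemxAl !enormZ -mulrDr -/D => H1.
  set Jt := 'J _ _ in H1.
  have JtD : enorm (row_mx (p' - p) (x' - x) *m Jt) <= c * D.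
    rewrite (le_trans (enorm_mulmx_le _ _))// ler_pM ?mulr_ge0//; last first.
      exact: enorm_row_mx_le.
    rewrite ler_wpM2l// -lerBlDl (le_trans (lerB_dist _ _))//.
    rewrite ltW// distrC; apply: Jle; rewrite row_mxB.
    by rewrite (le_lt_trans (enorm_row_mx_le _ _))//; lra.
  have := enorm_le_add (s t' - s t) ((t' - t) *: (row_mx (p' - p) (x' - x) *m Jt)).
  rewrite enormZ.
  have : `|t' - t| * enorm (row_mx (p' - p) (x' - x) *m Jt) <= `|t' - t| * (c * D).
    by rewrite ler_wpM2l.
  lra.
have s1 : s 1 = f p' x'.
  by rewrite /s /pt /xt !scale1r (addrC p) (addrC x) !subrK.
have s0 : s 0 = f p x by rewrite /s /pt /xt !scale0r !addr0.
rewrite -s1 -s0 -/D -[leRHS]mulr1; apply: dini_bound => //.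
  move=> t t01 e e0; have [dl dl0 H] := key t t01.
  have b0 : 0 < (c + 1) * D + 1 by rewrite ltr_wpDl// mulr_ge0// addr_ge0.
  exists (Num.min dl (e / ((c + 1) * D + 1))); first by rewrite lt_min dl0 divr_gt0.
  move=> t' _; rewrite lt_min => /andP[t'dl t'e].
  have : `|t' - t| * ((c + 1) * D + 1) < e by rewrite -ltr_pdivlMr.
  have := H _ t'dl.
  have [->|tt'] := eqVneq t' t; first by rewrite !subrr enorm0 normr0 mulr0.
  have : 0 < `|t' - t| by rewrite normr_gt0 subr_eq0.
  lra.
move=> t /andP[t0 t1]; have [|dl dl0 H] := key t; first by rewrite t0 ltW.
exists dl => // h /andP[h0 hdl].
have hE : t + h - t = h by rewrite addrAC subrr add0r.
by have := H (t + h); rewrite hE gtr0_norm//; exact.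
Qed.

Context (F : 'rV[R]_n -> set 'rV[R]_n).
Hypothesis F_maxmono : maximally_monotone F.
Hypothesis f_mono : \forall p \near pbar, monotone_map (fun x => [set f p x]).
Local Notation ubar := (- f pbar xbar).
Hypothesis regularity : forall w,
  [set partial_jacobian_adj f pbar xbar w + v
     | v in coderivative F xbar ubar w] 0 -> w = 0.
Hypothesis xbar_sol : solution_map f F pbar xbar.

Lemma F_xbar : F xbar ubar.
Proof.
by move: xbar_sol => [u Fu /eqP]; rewrite addrC addr_eq0 => /eqP <-.
Qed.

(* Local solvability forces global uniqueness: test monotonicity against the
   solution for the perturbed right-hand side y + t (a - x'). *)
Lemma strong_solvability : exists2 kap : R, 0 < kap & exists2 r : R, 0 < r &
  forall (p : 'rV[R]_d) (x u y : 'rV[R]_n), enorm (p - pbar) < r ->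
  enorm (x - xbar) < r -> enorm (u - ubar) < r -> F x u ->
  enorm (y - (f p x + u)) < r ->
  exists x' u' : 'rV[R]_n, [/\ F x' u', f p x' + u' = y,
    enorm (x' - x) <= kap * enorm (y - (f p x + u)),
    enorm (u' - u) <= kap * enorm (y - (f p x + u)) &
    forall a b, F a b -> f p a + b = y -> a = x'].
Proof.
have [kap kap0 [r r0 solve]] := uniform_solvability f_C1 F_maxmono regularity.
have /nbhs_enormP[rm rm0 mono] := f_mono.
exists kap => //; pose r1 := Num.min rm (r / (kap + 1)).
have k10 : 0 < kap + 1 by rewrite addr_gt0.
have r1rm : r1 <= rm by rewrite ge_min lexx.
have r1k : r1 * (kap + 1) <= r by rewrite -ler_pdivlMr// ge_min lexx orbT.
have r10 : 0 < r1 by rewrite lt_min rm0 divr_gt0.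
have kr1 : 0 < kap * r1 by rewrite mulr_gt0.
have r1r : r1 <= r by lra.
exists r1 => // p x u y pr xr ur Fxu yr.
have [x' [u' [Fx' eqy x'x u'u]]] : exists x' u' : 'rV[R]_n, [/\ F x' u',
    f p x' + u' = y, enorm (x' - x) <= kap * enorm (y - (f p x + u)) &
    enorm (u' - u) <= kap * enorm (y - (f p x + u))].
  by apply: solve => //; apply: lt_le_trans r1r.
exists x', u'; split => // a b Fab eqa.
have kyr : kap * enorm (y - (f p x + u)) < kap * r1 by rewrite ltr_pM2l.
have x'r : enorm (x' - xbar) < r.
  rewrite (le_lt_trans (enorm_triangle x _ _))//; lra.
have u'r : enorm (u' - ubar) < r.
  rewrite (le_lt_trans (enorm_triangle u _ _))//; lra.
set D := enorm (a - x').
have D0 : 0 <= D by exact: enorm_ge0.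
(* The first bound keeps the perturbed right-hand side inside the solvability radius; the second
   gives [t * kap <= 2^-1]. Then x2 is within [D / 2] of x', and monotonicity, which yields
   [D ^+ 2 <= dotv (a - x') (x2 - x')], leaves only [D = 0]. *)
pose t := Num.min (r / (2 * (D + 1))) (2^-1 / kap).
have t0 : 0 < t by rewrite lt_min !divr_gt0// mulr_gt0// ltr_wpDl.
have tD : t * (D + 1) <= r / 2.
  rewrite -ler_pdivlMr ?ltr_wpDl//.
  have -> : r / 2 / (D + 1) = r / (2 * (D + 1)) by rewrite invfM mulrA.
  by rewrite ge_min lexx.
have tk : t * kap <= 2^-1 by rewrite -ler_pdivlMr// ge_min lexx orbT.
pose y' := y + t *: (a - x').
have y'E : y' - (f p x' + u') = t *: (a - x') by rewrite eqy /y' addrAC subrr add0r.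
have y'D : enorm (y' - (f p x' + u')) = t * D by rewrite y'E enormZ gtr0_norm.
have [|x2 [u2 [Fx2 eqx2 x2x' _]]] := @solve p x' u' y' (lt_le_trans pr r1r) x'r u'r Fx'.
  by rewrite y'D; lra.
rewrite y'D in x2x'.
have monof := mono p (lt_le_trans pr r1rm) a x2 _ _ erefl erefl.
have monoF := F_maxmono.1 _ _ _ _ Fab Fx2.
have sum : dotv (f p x2 - f p a) (x2 - a) + dotv (u2 - b) (x2 - a)
    = t * dotv (a - x') (x2 - a).
  rewrite -dotvDl -dotvZl; congr dotv.
  by rewrite addrACA -opprD eqx2 eqa /y' addrAC subrr add0r.
have : 0 <= dotv (a - x') (x2 - a) by rewrite -(pmulr_rge0 _ t0) -sum addr_ge0.
have -> : dotv (a - x') (x2 - a) = dotv (a - x') (x2 - x') - D ^+ 2.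
  by rewrite sqr_enorm -dotvBr opprB addrA subrK.
have := cauchy_schwarz (a - x') (x2 - x').
have : enorm (a - x') * enorm (x2 - x') <= D * (kap * (t * D)) by rewrite ler_wpM2l.
have : t * kap * D ^+ 2 <= 2^-1 * D ^+ 2 by rewrite ler_wpM2r// sqr_ge0.
move=> h1 h2 h3 h4.
have D20 : D ^+ 2 <= 0 by lra.
have /eqP : D ^+ 2 = 0 by apply/eqP; rewrite eq_le D20 sqr_ge0.
by rewrite sqrf_eq0 => /eqP /enorm0_eq0 /eqP; rewrite subr_eq0 => /eqP.
Qed.

(** The pair [(x, u)] solves the problem for [(p', y')] up to a residual controlled by the changes
    of p and y. Solving from there and identifying the result with x' by global uniqueness gives the
    estimate for every solution x', wherever it lies. *)
Lemma solution_stability : exists2 kap : R, 0 < kap & exists2 r : R, 0 < r &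
  forall (p : 'rV[R]_d) (y : 'rV[R]_n), enorm (p - pbar) < r -> enorm y < r ->
  exists x u : 'rV[R]_n, [/\ F x u, f p x + u = y,
    enorm (x - xbar) <= kap * (enorm (p - pbar) + enorm y),
    (forall a b, F a b -> f p a + b = y -> a = x) &
    forall (p' : 'rV[R]_d) (y' x' u' : 'rV[R]_n), enorm (p' - pbar) < r ->
      enorm y' < r -> F x' u' -> f p' x' + u' = y' ->
      enorm (x' - x) <= kap * (enorm (p' - p) + enorm (y' - y))].
Proof.
have [kap kap0 [r r0 solve]] := strong_solvability.
have [k k0 [rk rk0 flip]] := joint_locally_lipschitz.
pose K := kap * (k + 1); have k10 : 0 < k + 1 by rewrite addr_gt0.
have K0 : 0 < K by rewrite mulr_gt0.
exists K => //.
pose rr := Num.min r rk.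
have rr0 : 0 < rr by rewrite lt_min r0.
have rrr : rr <= r by rewrite ge_min lexx.
have rrk : rr <= rk by rewrite ge_min lexx orbT.
(* The term [2 * (K * r1)] bounds the displacement of x and u from the reference pair, and the new
   residual is below [2 * (k * r1) + 2 * r1]; [M] keeps both below [rr]. *)
pose M := 2 * (K + k + 2).
have M0 : 0 < M by rewrite mulr_gt0// ?addr_gt0.
pose r1 := rr / M.
have r10 : 0 < r1 by rewrite divr_gt0.
have r1M : r1 * M = rr by rewrite divfK// gt_eqF.
have Kr1 : 0 < K * r1 by rewrite mulr_gt0.
have kr1 : 0 < k * r1 by rewrite mulr_gt0.
have hM : 2 * (K * r1) + 2 * (k * r1) + 4 * r1 = rr by rewrite -r1M /M; lra.
exists r1 => // p y pr yr.
have xbr : enorm (xbar - xbar) < r1 by rewrite subrr enorm0.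
have ubr : enorm (ubar - ubar) < r by rewrite subrr enorm0.
have pbr : enorm (pbar - pbar) < r1 by rewrite subrr enorm0.
have r1rr : r1 <= rr by lra.
have r1r : r1 <= r by lra.
have r1k : r1 <= rk by lra.
have fb : enorm (f p xbar - f pbar xbar) <= k * enorm (p - pbar).
  have := flip _ _ _ _ (lt_le_trans pbr r1k) (lt_le_trans pr r1k)
    (lt_le_trans xbr r1k) (lt_le_trans xbr r1k).
  by rewrite [enorm (xbar - _)](_ : _ = 0) ?addr0// subrr enorm0.
have kp : k * enorm (p - pbar) <= k * r1 by rewrite ler_wpM2l ?(ltW k0)// ltW.
have yE : enorm (y - (f p xbar + ubar)) <= enorm y + k * enorm (p - pbar).
  by rewrite (le_trans (enormB _ _))// lerD2l.
have [|x [u [Fx eqx xx uu uniq]]] := @solve p xbar ubar y (lt_le_trans pr r1r)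
    (lt_le_trans xbr r1r) ubr F_xbar.
  by rewrite (le_lt_trans yE)//; lra.
have yKE : kap * enorm (y - (f p xbar + ubar)) <= K * (enorm (p - pbar) + enorm y).
  rewrite /K -mulrA ler_wpM2l ?(ltW kap0)// (le_trans yE)//.
  have := enorm_ge0 (p - pbar); have : 0 <= k * enorm y by rewrite mulr_ge0 ?(ltW k0).
  lra.
exists x, u; split => //; first exact: le_trans yKE.
move=> p' y' x' u' p'r y'r Fx' eqx'.
have near_b : K * (enorm (p - pbar) + enorm y) <= K * (r1 + r1).
  by rewrite ler_wpM2l ?(ltW K0)// lerD// ltW.
have xr : enorm (x - xbar) < rr by rewrite (le_lt_trans xx)//; lra.
have ur : enorm (u - ubar) < rr by rewrite (le_lt_trans uu)//; lra.
have ff := flip _ _ _ _ (lt_le_trans pr r1k) (lt_le_trans p'r r1k)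
    (lt_le_trans xr rrk) (lt_le_trans xr rrk).
rewrite subrr enorm0 addr0 in ff.
have y'E : enorm (y' - (f p' x + u)) <= enorm (y' - y) + k * enorm (p' - p).
  have -> : y' - (f p' x + u) = (y' - y) - (f p' x - f p x).
    by rewrite -eqx; apply/rowP => i; rewrite !mxE; lra.
  by rewrite (le_trans (enormB _ _))// lerD2l.
have [|x2 [u2 [Fx2 eqx2 x2x _ uniq2]]] := @solve p' x u y' (lt_le_trans p'r r1r)
    (lt_le_trans xr rrr) (lt_le_trans ur rrr) Fx.
  rewrite (le_lt_trans y'E)//.
  have : enorm (y' - y) <= enorm y' + enorm y by exact: enormB.
  have : k * enorm (p' - p) <= k * (r1 + r1).
    rewrite ler_wpM2l ?(ltW k0)// (le_trans (enorm_triangle pbar _ _))//.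
    by rewrite (enormBC pbar) lerD// ltW.
  lra.
rewrite (uniq2 _ _ Fx' eqx') (le_trans x2x)// /K -mulrA ler_wpM2l ?(ltW kap0)//.
rewrite (le_trans y'E)//.
have := enorm_ge0 (p' - p); have : 0 <= k * enorm (y' - y) by rewrite mulr_ge0 ?(ltW k0).
lra.
Qed.

Lemma value_at_set1 m k (S : 'rV[R]_m -> set 'rV[R]_k) x y :
  S x = [set y] -> value_at S x = y.
Proof.
move=> SE; have : S x (value_at S x) by apply: xgetPex; exists y; rewrite SE.
by rewrite {1}SE.
Qed.

Lemma strong_metric_regularity :
  strongly_metrically_regular (partial_map f F pbar) xbar 0.
Proof.
have [kap kap0 [r r0 stab]] := solution_stability.
have pbr : enorm (pbar - pbar) < r by rewrite subrr enorm0.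
(* Uniqueness is global, so the whole space serves as the neighbourhood of [xbar]. *)
split => //; exists [set y | enorm y < r], setT; split.
- by apply/nbhs_enormP; exists r => // y; rewrite subr0.
- exact: filterT.
pose Q' (y : 'rV[R]_n) := inverse_map (partial_map f F pbar) y `&` setT.
have Q'P y : enorm y < r -> exists x u, [/\ Q' y = [set x], F x u, f pbar x + u = y &
    forall y' x' u', enorm y' < r -> F x' u' -> f pbar x' + u' = y' ->
      enorm (x' - x) <= kap * enorm (y' - y)].
  move=> yr; have [x [u [Fx eqx _ uniq lip]]] := stab pbar y pbr yr.
  exists x, u; split => //.
    rewrite /Q' setIT; apply/seteqP; split => a /=; first by move=> [b /uniq]; exact.
    by move=> ->; exists u.
  move=> y' x' u' y'r Fx' eqx'; have := lip _ _ _ _ pbr y'r Fx' eqx'.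
  by rewrite subrr enorm0 add0r.
split; first by move=> y yr; have [x [u [xE _ _ _]]] := Q'P y yr; exists x.
exists kap => y y' yr y'r.
have [x [u [xE Fx eqx _]]] := Q'P y yr.
have [x' [u' [x'E Fx' eqx' lip]]] := Q'P y' y'r.
by rewrite (value_at_set1 xE) (value_at_set1 x'E); exact: lip eqx.
Qed.

(** The interface for what follows: a Lipschitz single-valued [s] near [pbar], and an error bound by
    the residual for points of [gph F] near the reference pair. The derivative formulas and the
    semismoothness results rest on these facts in place of the regularity condition. *)
Lemma solution_map_local : exists2 kap : R, 0 < kap & exists2 r : R, 0 < r &
  let s := value_at (solution_map f F) in
  [/\ forall p : 'rV[R]_d, enorm (p - pbar) < r -> solution_map f F p = [set s p],
      forall p : 'rV[R]_d, enorm (p - pbar) < r -> F (s p) (- f p (s p)),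
      forall p p' : 'rV[R]_d, enorm (p - pbar) < r -> enorm (p' - pbar) < r ->
        enorm (s p - s p') <= kap * enorm (p - p'),
      s pbar = xbar &
      forall (p : 'rV[R]_d) (x u : 'rV[R]_n), enorm (p - pbar) < r ->
        enorm (x - xbar) < r -> enorm (u - ubar) < r -> F x u ->
        enorm (f p x + u) < r -> enorm (s p - x) <= kap * enorm (f p x + u)].
Proof.
have [k1 k10 [r1 r10 stab]] := solution_stability.
have [k2 k20 [r2 r20 solve]] := strong_solvability.
exists (Num.max k1 k2); first by rewrite lt_max k10.
have le1 : k1 <= Num.max k1 k2 by rewrite le_max lexx.
have le2 : k2 <= Num.max k1 k2 by rewrite le_max lexx orbT.
pose r := Num.min r1 r2.
have rr1 : r <= r1 by rewrite ge_min lexx.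
have rr2 : r <= r2 by rewrite ge_min lexx orbT.
exists r; first by rewrite lt_min r10.
move=> s; have z0 : enorm (0 : 'rV[R]_n) < r1 by rewrite enorm0.
have solE p x u : F x u -> f p x + u = 0 -> u = - f p x.
  by move=> _ /eqP; rewrite addrC addr_eq0 => /eqP.
have sE p : enorm (p - pbar) < r -> solution_map f F p = [set s p].
  move=> pr; have [x [u [Fx eqx _ uniq _]]] := stab p 0 (lt_le_trans pr rr1) z0.
  suff SE : solution_map f F p = [set x] by rewrite {1}SE /s (value_at_set1 SE).
  apply/seteqP; split => a /=; first by move=> [b /uniq]; exact.
  by move=> ->; exists u.
have sF p : enorm (p - pbar) < r -> F (s p) (- f p (s p)).
  move=> pr; have : solution_map f F p (s p) by rewrite sE.
  by move=> [u Fu eqs]; rewrite -(solE _ _ _ Fu eqs).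
have s0 p : f p (s p) + - f p (s p) = 0 by rewrite subrr.
split => //.
- move=> p p' pr p'r.
  have [x [u [Fx eqx _ uniq lip]]] := stab p' 0 (lt_le_trans p'r rr1) z0.
  have -> : s p' = x by exact: uniq (sF _ p'r) (s0 _).
  have := lip _ _ _ _ (lt_le_trans pr rr1) z0 (sF _ pr) (s0 _).
  rewrite subrr enorm0 addr0 => /le_trans; apply.
  by rewrite ler_wpM2r.
- have : solution_map f F pbar xbar by [].
  by rewrite sE ?subrr ?enorm0 ?lt_min ?r10.
- move=> p x u pr xr ur Fx fr.
  have [|x' [u' [Fx' eqx' x'x _ uniq]]] := @solve p x u 0 (lt_le_trans pr rr2)
    (lt_le_trans xr rr2) (lt_le_trans ur rr2) Fx.
    by rewrite sub0r enormN (lt_le_trans fr rr2).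
  rewrite (uniq _ _ (sF _ pr) (s0 _)) (le_trans x'x)//.
  by rewrite sub0r enormN ler_wpM2r.
Qed.

End Regularity.

(** * Graphical derivatives of Lipschitz selections *)

Section TangentCones.
Context {R : realType}.

Lemma decreases_to0_lt (t : nat -> R) (a : R) :
  decreases_to0 t -> 0 < a -> \forall k \near \oo, t k < a.
Proof.
move=> [t0 /cvgrPdist_lt tl] a0; apply: filterS (tl _ a0) => k.
by rewrite sub0r normrN gtr0_norm.
Qed.

Lemma cvg_add_scale n (x q : 'rV[R]_n) (t : nat -> R) (qk : nat -> 'rV[R]_n) :
  decreases_to0 t -> qk @ \oo --> q -> (fun k => x + t k *: qk k) @ \oo --> x.
Proof.
move=> [_ tl] qkq; rewrite -[X in _ --> X]addr0 -(scale0r q).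
by apply: cvgD; [exact: cvg_cst|exact: cvgZ].
Qed.

Lemma tangent_cone_eventually N (A : set 'rV[R]_N) x (w : 'rV[R]_N)
    (t : nat -> R) (wk : nat -> 'rV[R]_N) :
  decreases_to0 t -> wk @ \oo --> w ->
  (\forall k \near \oo, A (x + t k *: wk k)) -> tangent_cone A x w.
Proof.
move=> tl wkw [M _ MA]; have phik k : (k <= k + M)%N by rewrite leq_addr.
exists (t \o (addn^~ M)), (wk \o (addn^~ M)); split.
- exact: decreases_to0_subsequence.
- exact: cvg_subsequence.
- by move=> k; apply: MA => /=; rewrite leq_addl.
Qed.

(** Diagonal choice: for each k a step of size at most [k.+1%:R^-1] and a direction that close to
    [wk k]. *)
Lemma tangent_cone_closed N (A : set 'rV[R]_N) x (wk : nat -> 'rV[R]_N) (w : 'rV[R]_N) :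
  (forall k, tangent_cone A x (wk k)) -> wk @ \oo --> w -> tangent_cone A x w.
Proof.
move=> wkT wkw.
have ex (k : nat) : exists z : R * 'rV[R]_N, [/\ 0 < z.1, z.1 <= k.+1%:R^-1,
    enorm (z.2 - wk k) <= k.+1%:R^-1 & A (x + z.1 *: z.2)].
  have [t [v [tl /cvg_enormP vl Av]]] := wkT k.
  have k0 : 0 < (k.+1%:R^-1 : R) by rewrite invr_gt0.
  have [M _ MP] := filterI (decreases_to0_lt tl k0) (vl _ k0).
  have [tM vM] := MP M (leqnn M).
  by exists (t M, v M); split; rewrite ?ltW//= ?tl.1.
have [z zP] := choice ex.
have tn := @decreases_to0_natSinv R.
exists (fun k => (z k).1), (fun k => (z k).2); split.
- split=> [k|]; first by have [] := zP k.
  apply: (squeeze_cvgr _ (@cvg_cst _ _ _ _ _) tn.2); apply: nearW => k.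
  by have [z0 zk _ _] := zP k; rewrite zk ltW.
- have dz : (fun k => (z k).2 - wk k) @ \oo --> (0 : 'rV[R]_N).
    by apply: cvg_enorm_le tn.2 _ => k; rewrite subr0; have [] := zP k.
  have -> : (fun k => (z k).2) = (fun k => (z k).2 - wk k + wk k).
    by apply/funext => k; rewrite subrK.
  by rewrite -[X in _ --> X]add0r; apply: cvgD => //; exact: dz.
- by move=> k; have [] := zP k.
Qed.

Lemma cvg_enorm_bound n (u : nat -> 'rV[R]_n) (l : 'rV[R]_n) (M : R) :
  (\forall k \near \oo, enorm (u k) <= M) -> u @ \oo --> l -> enorm l <= M.
Proof.
move=> uM /cvg_enormP ul; rewrite leNgt; apply/negP => lM.
have lM' : 0 < enorm l - M by rewrite subr_gt0.
have [k [k1 k2]] := filter_ex (filterI uM (ul _ lM')).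
have := enorm_le_add l (u k); rewrite enormBC /= in k1 k2 *; lra.
Qed.

End TangentCones.

Section LipschitzSelection.
Context {R : realType} {d n : nat}.
Context (S : 'rV[R]_d -> set 'rV[R]_n) (s : 'rV[R]_d -> 'rV[R]_n).
Context (pbar : 'rV[R]_d) (kap r : R).
Hypothesis kap0 : 0 < kap.
Hypothesis r0 : 0 < r.
Hypothesis SE : forall p : 'rV[R]_d, enorm (p - pbar) < r -> S p = [set s p].
Hypothesis s_lip : forall p p' : 'rV[R]_d, enorm (p - pbar) < r -> enorm (p' - pbar) < r ->
  enorm (s p - s p') <= kap * enorm (p - p').

Local Notation DS p := (graphical_derivative S p (s p)).

Lemma near_ball (p : 'rV[R]_d) (pk : nat -> 'rV[R]_d) :
  enorm (p - pbar) < r -> pk @ \oo --> p ->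
  \forall k \near \oo, enorm (pk k - pbar) < r.
Proof.
move=> pr /cvg_enormP pkp; have e0 : 0 < r - enorm (p - pbar) by rewrite subr_gt0.
apply: filterS (pkp _ e0) => k pkr.
by rewrite (le_lt_trans (enorm_triangle p _ _))// -ltrBrDr.
Qed.

Lemma near_ball_line (p q : 'rV[R]_d) (t : nat -> R) :
  enorm (p - pbar) < r -> decreases_to0 t ->
  \forall k \near \oo, enorm (p + t k *: q - pbar) < r.
Proof.
by move=> pr tl; exact: (near_ball pr (cvg_add_scale (qk := fun=> q) tl (cvg_cst q))).
Qed.

Lemma graphical_derivative_quotient (p q : 'rV[R]_d) (w : 'rV[R]_n)
    (t : nat -> R) (qk : nat -> 'rV[R]_d) :
  enorm (p - pbar) < r -> decreases_to0 t -> qk @ \oo --> q ->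
  (fun k => (t k)^-1 *: (s (p + t k *: qk k) - s p)) @ \oo --> w -> DS p q w.
Proof.
move=> pr tl qkq sw.
apply: (tangent_cone_eventually tl (cvg_row_mx qkq sw)).
near=> k.
have pkr : enorm (p + t k *: qk k - pbar) < r.
  near: k; exact: (near_ball pr (cvg_add_scale tl qkq)).
rewrite scale_row_mx add_row_mx scalerA divff ?gt_eqF ?tl.1// scale1r.
by rewrite [s p + _]addrC subrK gph_row_mx SE.
Unshelve. all: by end_near. Qed.

(** The Lipschitz bound allows the converging directions of the tangent cone to be replaced by the
    fixed direction [q]. *)
Lemma graphical_derivativeP (p q : 'rV[R]_d) (w : 'rV[R]_n) :
  enorm (p - pbar) < r ->
  DS p q w <-> exists2 t : nat -> R, decreases_to0 t &
    (fun k => (t k)^-1 *: (s (p + t k *: q) - s p)) @ \oo --> w.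
Proof.
move=> pr; split=> [[t [z [tl zl Sz]]]|[t tl sw]]; last first.
  exact: (graphical_derivative_quotient pr tl (cvg_cst q) sw).
exists t => //.
have ql : (fun k => lsubmx (z k)) @ \oo --> q.
  by rewrite -[X in _ --> X](row_mxKl q w); exact: cvg_lsubmx.
have wl : (fun k => rsubmx (z k)) @ \oo --> w.
  by rewrite -[X in _ --> X](row_mxKr q w); exact: cvg_rsubmx.
apply/cvg_enormP => e e0.
have k1 : 0 < e / (2 * kap) by rewrite divr_gt0// mulr_gt0.
have e2 : 0 < e / 2 by rewrite divr_gt0.
have /cvg_enormP/(_ _ k1) qn := ql.
have /cvg_enormP/(_ _ e2) wn := wl.
have pn := near_ball pr (cvg_add_scale tl ql).
have pn' := near_ball_line q pr tl.
near=> k.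
have pk : enorm (p + t k *: lsubmx (z k) - pbar) < r by near: k.
have pk' : enorm (p + t k *: q - pbar) < r by near: k.
have qk : enorm (lsubmx (z k) - q) < e / (2 * kap) by near: k.
have wk : enorm (rsubmx (z k) - w) < e / 2 by near: k.
have t0 : 0 < t k by exact: tl.1.
have := Sz k; rewrite -{1}[z k]hsubmxK scale_row_mx add_row_mx gph_row_mx SE// => swk.
have -> : (t k)^-1 *: (s (p + t k *: q) - s p) - w =
    (t k)^-1 *: (s (p + t k *: q) - s (p + t k *: lsubmx (z k))) + (rsubmx (z k) - w).
  rewrite -swk addrA; congr (_ - _).
  by rewrite opprD addrA [in RHS]scalerBr scalerA mulVf ?gt_eqF// scale1r subrK.
rewrite (le_lt_trans (enormD _ _))// enormZ gtr0_norm ?invr_gt0//.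
have := s_lip pk' pk; rewrite opprD addrACA subrr add0r -scalerBr enormZ gtr0_norm//.
rewrite enormBC in qk; rewrite mulrCA -ler_pdivrMl// => lip.
have : enorm (q - lsubmx (z k)) * (2 * kap) < e by rewrite -ltr_pdivlMr// mulr_gt0.
lra.
Unshelve. all: by end_near. Qed.

Lemma graphical_derivative_bound (p q : 'rV[R]_d) (w : 'rV[R]_n) :
  enorm (p - pbar) < r -> DS p q w -> enorm w <= kap * enorm q.
Proof.
move=> pr /(graphical_derivativeP _ _ pr)[t tl sw].
apply: cvg_enorm_bound sw.
apply: filterS (near_ball_line q pr tl) => k pk.
rewrite enormZ gtr0_norm ?invr_gt0 ?tl.1// ler_pdivrMl ?tl.1//.
by have := s_lip pk pr; rewrite addrAC subrr add0r enormZ gtr0_norm ?tl.1// mulrCA.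
Qed.

(** Quotients along any prescribed steps are eventually bounded by [kap * enorm q], so a subsequence
    converges. The mean value argument exploits that [t] can be prescribed. *)
Lemma graphical_derivative_cluster (p q : 'rV[R]_d) (t : nat -> R) :
  enorm (p - pbar) < r -> decreases_to0 t ->
  exists (phi : nat -> nat) (w : 'rV[R]_n), [/\ forall k, (k <= phi k)%N,
    (fun k => ((t \o phi) k)^-1 *: (s (p + (t \o phi) k *: q) - s p)) @ \oo --> w &
    DS p q w].
Proof.
move=> pr tl.
have [M _ MP] := near_ball_line q pr tl.
pose u k := (t (k + M))^-1 *: (s (p + t (k + M) *: q) - s p).
have [phi [w [phik uw]]] : exists (phi : nat -> nat) (l : 'rV[R]_n),
    (forall k, (k <= phi k)%N) /\ (u \o phi) @ \oo --> l.
  apply: (@bounded_subsequence _ _ u (kap * enorm q)) => k.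
  rewrite /u enormZ gtr0_norm ?invr_gt0 ?tl.1// ler_pdivrMl ?tl.1//.
  have pk : enorm (p + t (k + M) *: q - pbar) < r by apply: MP => /=; rewrite leq_addl.
  by have := s_lip pk pr; rewrite addrAC subrr add0r enormZ gtr0_norm ?tl.1// mulrCA.
have psik k : (k <= phi k + M)%N by rewrite (leq_trans (phik k))// leq_addr.
exists (fun k => (phi k + M)%N), w; split => //.
apply/(graphical_derivativeP _ _ pr); exists (t \o (fun k => (phi k + M)%N)) => //.
exact: decreases_to0_subsequence.
Qed.

Lemma graphical_derivative_ex (p q : 'rV[R]_d) :
  enorm (p - pbar) < r -> exists w, DS p q w.
Proof.
move=> pr; have [phi [w [_ _ DSw]]] :=
  graphical_derivative_cluster q pr (@decreases_to0_natSinv R).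
by exists w.
Qed.

Lemma graphical_derivative_closed (p : 'rV[R]_d) (zk : nat -> 'rV[R]_(d + n)) z :
  (forall k, DS p (lsubmx (zk k)) (rsubmx (zk k))) -> zk @ \oo --> z ->
  DS p (lsubmx z) (rsubmx z).
Proof.
move=> zkT zkz; rewrite /graphical_derivative /= hsubmxK.
apply: (tangent_cone_closed _ zkz) => k.
by have := zkT k; rewrite /graphical_derivative /= hsubmxK.
Qed.

Lemma graphical_derivative0 (p : 'rV[R]_d) : enorm (p - pbar) < r -> DS p 0 0.
Proof.
move=> pr; apply/graphical_derivativeP => //.
exists (fun k => k.+1%:R^-1); first exact: decreases_to0_natSinv.
under eq_fun do rewrite scaler0 addr0 subrr scaler0.
exact: cvg_cst.
Qed.

(** Serves both maxima in the modulus estimate: [A] is the part of the graph of the derivative over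
    one direction, or over the unit ball. A near-maximizing sequence has a convergent subsequence
    whose limit attains the supremum. *)
Lemma enorm_rsubmx_max (A : set 'rV[R]_(d + n)) (b : R) :
  A !=set0 -> (forall z, A z -> enorm z <= b) ->
  (forall (zk : nat -> 'rV[R]_(d + n)) z, (forall k, A (zk k)) -> zk @ \oo --> z -> A z) ->
  exists2 z, A z & forall z', A z' -> enorm (rsubmx z') <= enorm (rsubmx z).
Proof.
move=> [z0 Az0] Ab Acl.
pose E := [set enorm (rsubmx z) | z in A].
have supE : has_sup E.
  split; first by exists (enorm (rsubmx z0)), z0.
  by exists b => _ [z Az <-]; rewrite (le_trans (enorm_rsubmx z))// Ab.
have Ele z : A z -> enorm (rsubmx z) <= sup E.
  by move=> Az; apply: sup_upper_bound => //; exists z.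
have ex (k : nat) : exists z : 'rV[R]_(d + n), A z /\ sup E - k.+1%:R^-1 < enorm (rsubmx z).
  have k0 : 0 < (k.+1%:R^-1 : R) by rewrite invr_gt0.
  by have [_ [z Az <-] lt] := sup_adherent k0 supE; exists z.
have [zk zkP] := choice ex.
have [phi [z [phik zz]]] : exists (phi : nat -> nat) (l : 'rV[R]_(d + n)),
    (forall k, (k <= phi k)%N) /\ (zk \o phi) @ \oo --> l.
  by apply: (@bounded_subsequence _ _ zk b) => k; apply: Ab; have [] := zkP k.
exists z; first by apply: Acl zz => k; have [] := zkP (phi k).
move=> z' /Ele /le_trans; apply.
apply/ler_addgt0Pr => e e0.
have e2 : 0 < e / 2 by rewrite divr_gt0.
have /cvg_enormP/(_ _ e2) zn := zz.
have tn := decreases_to0_lt (decreases_to0_subsequence phik (@decreases_to0_natSinv R)) e2.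
have [k [/= k1 k2]] := filter_ex (filterI zn tn).
have [_ supk] := zkP (phi k).
have : enorm (rsubmx (zk (phi k))) <= enorm (rsubmx z) + enorm (zk (phi k) - z).
  rewrite (le_trans (enorm_le_add _ (rsubmx z)))// lerD2l -linearB.
  exact: enorm_rsubmx.
move: (_.+1%:R^-1) k2 supk => a k2 supk; lra.
Qed.

Lemma ereal_sup_attained (A : set (\bar R)) a :
  A a -> (forall b, A b -> (b <= a)%E) -> ereal_sup A = a.
Proof.
move=> Aa Ale; apply/eqP; rewrite eq_le; apply/andP; split.
  exact: ge_ereal_sup.
exact: ereal_sup_ubound.
Qed.

Lemma setnorm_attained (p q : 'rV[R]_d) : enorm (p - pbar) < r ->
  exists2 w, DS p q w & setnorm (DS p q) = (enorm w)%:E.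
Proof.
move=> pr.
pose A := [set z : 'rV[R]_(d + n) | lsubmx z = q /\ DS p (lsubmx z) (rsubmx z)].
have Aq w : DS p q w -> A (row_mx q w) by rewrite /A /= row_mxKl row_mxKr.
have [||zk z Az zz|z [zq DSz] zmax] := @enorm_rsubmx_max A (enorm q + kap * enorm q).
- by have [w /Aq] := graphical_derivative_ex q pr; exists (row_mx q w).
- move=> z [zq DSz]; rewrite -[z]hsubmxK (le_trans (enorm_row_mx_le _ _))//.
  by rewrite zq in DSz *; rewrite lerD2l; exact: graphical_derivative_bound DSz.
- split; last by apply: graphical_derivative_closed zz => k; have [] := Az k.
  apply: (@cvg_unique _ _ (lsubmx \o zk @ \oo)) => //; first exact: cvg_lsubmx.
  have -> : lsubmx \o zk = cst q by apply/funext => k /=; have [] := Az k.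
  exact: cvg_cst.
exists (rsubmx z); first by rewrite -zq.
apply: ereal_sup_attained; first by exists (rsubmx z) => //; rewrite -zq.
by move=> _ [w DSw <-]; rewrite lee_fin; have := zmax _ (Aq _ DSw); rewrite row_mxKr.
Qed.

Lemma norms_has_max (p q : 'rV[R]_d) :
  enorm (p - pbar) < r -> has_max (norms (DS p q)).
Proof.
move=> pr; have [w DSw sE] := setnorm_attained q pr.
by rewrite /has_max -/(setnorm _) sE; exists w.
Qed.

Lemma unit_ball_setnorms_has_max (p : 'rV[R]_d) :
  enorm (p - pbar) < r -> has_max (unit_ball_setnorms (fun q => DS p q)).
Proof.
move=> pr.
pose A := [set z : 'rV[R]_(d + n) | enorm (lsubmx z) <= 1 /\ DS p (lsubmx z) (rsubmx z)].
have [||zk z Az zz|z [z1 DSz] zmax] := @enorm_rsubmx_max A (1 + kap).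
- exists 0; split; first by rewrite linear0 enorm0.
  by rewrite !linear0; exact: graphical_derivative0.
- move=> z [z1 DSz]; rewrite -[z]hsubmxK (le_trans (enorm_row_mx_le _ _))// lerD//.
  rewrite (le_trans (graphical_derivative_bound pr DSz))//.
  by rewrite -[leRHS]mulr1 ler_wpM2l// ltW.
- split; last by apply: graphical_derivative_closed zz => k; have [] := Az k.
  apply: (@cvg_enorm_bound _ _ (fun k => lsubmx (zk k))); last exact: cvg_lsubmx.
  by apply: nearW => k; have [] := Az k.
have [w DSw sE] := setnorm_attained (lsubmx z) pr.
rewrite /has_max (@ereal_sup_attained _ (setnorm (DS p (lsubmx z)))).
- by exists (lsubmx z).
- by exists (lsubmx z).
move=> _ [q q1 <-]; have [w' DSw' ->] := setnorm_attained q pr.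
have w'z : enorm w' <= enorm (rsubmx z).
  by have := zmax (row_mx q w'); rewrite row_mxKr; apply; split; rewrite ?row_mxKl ?row_mxKr.
apply: (@le_trans _ _ (enorm (rsubmx z))%:E); first by rewrite lee_fin.
by apply: ereal_sup_ubound; exists (rsubmx z).
Qed.

Lemma outer_norm_ge (p q : 'rV[R]_d) w : enorm q <= 1 -> DS p q w ->
  ((enorm w)%:E <= outer_norm (fun q => DS p q))%E.
Proof.
move=> q1 DSw; apply: (@le_trans _ _ (setnorm (DS p q))).
  by apply: ereal_sup_ubound; exists w.
by apply: ereal_sup_ubound; exists q.
Qed.

(** If growth at rate [M + eta] occurred for arbitrarily small steps on the segment from p to p', a
    cluster point of the quotients would be a derivative of norm at least [M + eta] in a unit
    direction. The choice [eta = e / D] spreads the slack [e] over the length [D]. *)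
Lemma lipschitz_of_outer_norm (M : R) (p p' : 'rV[R]_d) : 0 <= M ->
  (forall p1 : 'rV[R]_d, enorm (p1 - pbar) < r -> (outer_norm (fun q => DS p1 q) <= M%:E)%E) ->
  enorm (p - pbar) < r -> enorm (p' - pbar) < r ->
  enorm (s p' - s p) <= M * enorm (p' - p).
Proof.
move=> M0 DSM pr p'r.
have [pp'|pp'] := eqVneq p' p; first by rewrite pp' !subrr !enorm0 mulr0.
have D0 : 0 < enorm (p' - p) by rewrite enorm_gt0 subr_eq0.
set D := enorm (p' - p) in D0 *.
pose q := D^-1 *: (p' - p).
have q1 : enorm q = 1 by rewrite enormZ gtr0_norm ?invr_gt0// mulVf// gt_eqF.
have pD : p + D *: q = p' by rewrite scalerA divff ?gt_eqF// scale1r addrC subrK.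
have seg t : 0 <= t <= D -> enorm (p + t *: q - pbar) < r.
  move=> /andP[t0 tD].
  have [->|tneq0] := eqVneq t 0; first by rewrite scale0r addr0.
  have t0' : 0 < t by rewrite lt_neqAle eq_sym tneq0.
  have -> : p + t *: q - pbar = (1 - t / D) *: (p - pbar) + (t / D) *: (p' - pbar).
    by rewrite /q; apply/rowP => i; rewrite !mxE; field; rewrite gt_eqF.
  have tD1 : t / D <= 1 by rewrite ler_pdivrMr// mul1r.
  have tD0 : 0 < t / D by rewrite divr_gt0.
  rewrite (le_lt_trans (enormD _ _))// !enormZ !ger0_norm ?subr_ge0// ?(ltW tD0)//.
  have : t / D * enorm (p' - pbar) < t / D * r by rewrite ltr_pM2l.
  have : (1 - t / D) * enorm (p - pbar) <= (1 - t / D) * r.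
    by rewrite ler_wpM2l ?subr_ge0// ltW.
  lra.
apply/ler_addgt0Pr => e e0.
pose eta := e / D; have eta0 : 0 < eta by rewrite divr_gt0.
pose g t := s (p + t *: q).
have gE : s p' - s p = g D - g 0 by rewrite /g pD scale0r addr0.
have -> : M * D + e = (M + eta) * D by rewrite mulrDl divfK// gt_eqF.
rewrite gE; apply: dini_bound; first exact: ltW.
  move=> t tD e1 e10; exists (e1 / kap) => [|t' t'D tt']; first by rewrite divr_gt0.
  rewrite (le_lt_trans (s_lip (seg _ t'D) (seg _ tD)))//.
  rewrite opprD addrACA subrr add0r -scalerBl enormZ q1 mulr1.
  by rewrite mulrC -ltr_pdivlMr.
move=> t /andP[t0 tD]; have ptr : enorm (p + t *: q - pbar) < r.
  by apply: seg; rewrite t0 ltW.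
apply: contrapT => nH.
have ex (k : nat) : exists h, [/\ 0 < h, h <= k.+1%:R^-1 &
    (M + eta) * h <= enorm (g (t + h) - g t)].
  apply: contrapT => nex; apply: nH; exists k.+1%:R^-1; first by rewrite invr_gt0.
  move=> h /andP[h0 hk]; rewrite leNgt; apply/negP => lt; apply: nex.
  by exists h; split => //; exact: ltW.
have [h hP] := choice ex.
have hl : decreases_to0 h.
  split=> [k|]; first by have [] := hP k.
  apply: (squeeze_cvgr _ (@cvg_cst _ _ _ _ _) (@decreases_to0_natSinv R).2).
  by apply: nearW => k; have [h0 hk _] := hP k; rewrite hk ltW.
have [phi [w [phik sw DSw]]] := graphical_derivative_cluster q ptr hl.
have wM : enorm w <= M.
  have := le_trans (outer_norm_ge _ DSw) (DSM _ ptr).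
  by rewrite lee_fin q1; apply.
have : M + eta <= enorm w.
  rewrite leNgt; apply/negP => wM'.
  have e2 : 0 < M + eta - enorm w by rewrite subr_gt0.
  have /cvg_enormP/(_ _ e2)/filter_ex[k /= swk] := sw.
  have [h0 _ hk] := hP (phi k).
  have := enorm_le_add ((h (phi k))^-1 *: (s (p + t *: q + h (phi k) *: q) - s (p + t *: q))) w.
  have : M + eta <= enorm ((h (phi k))^-1 *: (s (p + t *: q + h (phi k) *: q) - s (p + t *: q))).
    rewrite enormZ gtr0_norm ?invr_gt0// ler_pdivlMl// mulrC.
    by rewrite -addrA -scalerDl; exact: hk.
  lra.
lra.
Qed.

End LipschitzSelection.

(** * First-order behaviour of the solution map *)

Section FirstOrder.
Context {R : realType} {d n : nat}.
Context (pbar : 'rV[R]_d) (xbar : 'rV[R]_n).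
Context (f : 'rV[R]_d -> 'rV[R]_n -> 'rV[R]_n) (F : 'rV[R]_n -> set 'rV[R]_n).
Hypothesis f_C1 : continuously_differentiable_at (joint f) (row_mx pbar xbar).
Local Notation S := (solution_map f F).
Local Notation s := (value_at S).
Local Notation ubar := (- f pbar xbar).
Local Notation DS := (graphical_derivative S pbar xbar).
Context (kap r : R).
Hypothesis kap0 : 0 < kap.
Hypothesis r0 : 0 < r.
Hypothesis SE : forall p : 'rV[R]_d, enorm (p - pbar) < r -> S p = [set s p].
Hypothesis sF : forall p : 'rV[R]_d, enorm (p - pbar) < r -> F (s p) (- f p (s p)).
Hypothesis s_lip : forall p p' : 'rV[R]_d,
  enorm (p - pbar) < r -> enorm (p' - pbar) < r ->
  enorm (s p - s p') <= kap * enorm (p - p').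
Hypothesis s_pbar : s pbar = xbar.
Hypothesis s_residual : forall (p : 'rV[R]_d) (x u : 'rV[R]_n),
  enorm (p - pbar) < r -> enorm (x - xbar) < r -> enorm (u - ubar) < r ->
  F x u -> enorm (f p x + u) < r -> enorm (s p - x) <= kap * enorm (f p x + u).

Lemma pbar_ball : enorm (pbar - pbar) < r.
Proof. by rewrite subrr enorm0. Qed.

Lemma graphical_derivative_solutionP (q : 'rV[R]_d) (w : 'rV[R]_n) :
  DS q w <-> exists2 t : nat -> R, decreases_to0 t &
    (fun k => (t k)^-1 *: (s (pbar + t k *: q) - xbar)) @ \oo --> w.
Proof.
by have := graphical_derivativeP kap0 SE s_lip q w pbar_ball; rewrite s_pbar.
Qed.

Lemma joint_quotient (t : nat -> R) (qk : nat -> 'rV[R]_d) (wk : nat -> 'rV[R]_n)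
    (q : 'rV[R]_d) (w : 'rV[R]_n) :
  decreases_to0 t -> qk @ \oo --> q -> wk @ \oo --> w ->
  (fun k => (t k)^-1 *: (f (pbar + t k *: qk k) (xbar + t k *: wk k) - f pbar xbar))
    @ \oo --> q *m jacobian_p f pbar xbar + w *m jacobian_x f pbar xbar.
Proof.
move=> tl qkq wkw.
have df : differentiable (joint f) (row_mx pbar xbar) by have [/nbhs_singleton] := f_C1.
pose L k : 'rV[R]_n := qk k *m jacobian_p f pbar xbar + wk k *m jacobian_x f pbar xbar.
have LL : L @ \oo --> q *m jacobian_p f pbar xbar + w *m jacobian_x f pbar xbar.
  by apply: cvgD; apply: cvg_mulmx => //; exact: cvg_cst.
pose g k : 'rV[R]_n :=
  (t k)^-1 *: (f (pbar + t k *: qk k) (xbar + t k *: wk k) - f pbar xbar) - L k.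
have gl : g @ \oo --> (0 : 'rV[R]_n).
  apply/cvg_enormP => e e0.
  pose b := enorm q + enorm w + 2.
  have b0 : 0 < b by rewrite ltr_wpDl// addr_ge0.
  have [r1 r10 H] := joint_linearization df (divr_gt0 e0 b0).
  have /cvg_enormP/(_ _ r10) pn := cvg_add_scale (x := pbar) tl qkq.
  have /cvg_enormP/(_ _ r10) xn := cvg_add_scale (x := xbar) tl wkw.
  have /cvg_enormP/(_ _ ltr01) qn := qkq.
  have /cvg_enormP/(_ _ ltr01) wn := wkw.
  near=> k; rewrite subr0.
  have pk : enorm (pbar + t k *: qk k - pbar) < r1 by near: k.
  have xk : enorm (xbar + t k *: wk k - xbar) < r1 by near: k.
  have qk1 : enorm (qk k - q) < 1 by near: k.
  have wk1 : enorm (wk k - w) < 1 by near: k.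
  have t0 : 0 < t k by exact: tl.1.
  have := H _ _ pk xk.
  have -> : pbar + t k *: qk k - pbar = t k *: qk k by rewrite addrAC subrr add0r.
  have -> : xbar + t k *: wk k - xbar = t k *: wk k by rewrite addrAC subrr add0r.
  rewrite !enormZ gtr0_norm// -!scalemxAl -scalerDr.
  rewrite -/(L k) -mulrDr.
  have -> : f (pbar + t k *: qk k) (xbar + t k *: wk k) - f pbar xbar - t k *: L k
      = t k *: g k.
    by rewrite /g scalerBr scalerA divff ?gt_eqF// scale1r.
  rewrite enormZ gtr0_norm// mulrCA ler_pM2l// => /le_lt_trans; apply.
  rewrite mulrAC ltr_pdivrMr// ltr_pM2l//.
  have := enorm_le_add (qk k) q; have := enorm_le_add (wk k) w; rewrite /b; lra.
have -> : (fun k => (t k)^-1 *: (f (pbar + t k *: qk k) (xbar + t k *: wk k) - f pbar xbar))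
    = (fun k => g k + L k) by apply/funext => k; rewrite subrK.
by rewrite -[X in _ --> X]add0r; apply: cvgD => //; exact: gl.
Unshelve. all: by end_near. Qed.

(** The residual bound divided by [t k]. It replaces approximate solutions built from tangent
    vectors by actual ones without changing the limits of difference quotients. *)
Lemma solution_tracking (t : nat -> R) (pk : nat -> 'rV[R]_d) (xk uk : nat -> 'rV[R]_n) :
  decreases_to0 t -> pk @ \oo --> pbar -> xk @ \oo --> xbar -> uk @ \oo --> ubar ->
  (\forall k \near \oo, F (xk k) (uk k)) ->
  (fun k => (t k)^-1 *: (f (pk k) (xk k) + uk k)) @ \oo --> (0 : 'rV[R]_n) ->
  (fun k => (t k)^-1 *: (s (pk k) - xk k)) @ \oo --> (0 : 'rV[R]_n).
Proof.
move=> tl /cvg_enormP/(_ _ r0) pn /cvg_enormP/(_ _ r0) xn /cvg_enormP/(_ _ r0) un Fn.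
move=> /cvg_enormP res; apply/cvg_enormP => e e0.
have rn := res _ r0; have rne := res _ (divr_gt0 e0 kap0).
have tn := decreases_to0_lt tl ltr01.
near=> k.
have t0 : 0 < t k by exact: tl.1.
have resE : enorm (f (pk k) (xk k) + uk k)
    = t k * enorm ((t k)^-1 *: (f (pk k) (xk k) + uk k) - 0).
  by rewrite subr0 enormZ gtr0_norm ?invr_gt0// mulrA divff ?mul1r// gt_eqF.
have t1 : t k < 1 by near: k.
have res1 : enorm ((t k)^-1 *: (f (pk k) (xk k) + uk k) - 0) < r by near: k.
have res2 : enorm ((t k)^-1 *: (f (pk k) (xk k) + uk k) - 0) < e / kap by near: k.
have sx : enorm (s (pk k) - xk k) <= kap * enorm (f (pk k) (xk k) + uk k).
  apply: s_residual; [by near: k|by near: k|by near: k|by near: k|].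
  by rewrite resE (le_lt_trans _ res1)// ler_piMl// ltW.
rewrite subr0 enormZ gtr0_norm ?invr_gt0// ltr_pdivrMl// (le_lt_trans sx)// resE.
by rewrite mulrCA ltr_pM2l// mulrC -ltr_pdivlMr.
Unshelve. all: by end_near. Qed.

Lemma cvg_joint (pk : nat -> 'rV[R]_d) (xk : nat -> 'rV[R]_n) :
  pk @ \oo --> pbar -> xk @ \oo --> xbar ->
  (fun k => f (pk k) (xk k)) @ \oo --> f pbar xbar.
Proof.
move=> pkp xkx.
have df : differentiable (joint f) (row_mx pbar xbar) by have [/nbhs_singleton] := f_C1.
have -> : (fun k => f (pk k) (xk k)) = joint f \o (fun k => row_mx (pk k) (xk k)).
  by apply/funext => k /=; rewrite joint_row_mx.
rewrite -(joint_row_mx f pbar).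
exact: (cvg_comp _ _ (cvg_row_mx pkp xkx) (differentiable_continuous df)).
Qed.

(** A solution is a point of the graph of [joint_map f F] with value 0, which gives one inclusion.
    Conversely, a tangent with last component 0 yields points whose residual is o(t k), to which
    [solution_tracking] applies. *)
Lemma graphical_derivative_joint (q : 'rV[R]_d) :
  DS q = [set w | graphical_derivative (joint_map f F) (row_mx pbar xbar) 0
                    (row_mx q w) 0].
Proof.
apply/seteqP; split=> w.
  move=> [t [z [tl zl Sz]]]; exists t, (fun k => row_mx (z k) 0); split => //.
    by apply: cvg_row_mx => //; exact: cvg_cst.
  move=> k; rewrite scale_row_mx add_row_mx scaler0 addr0 gph_row_mx.
  exact: Sz.
move=> [t [z [tl zl Gz]]].
pose qk k : 'rV[R]_d := lsubmx (lsubmx (z k)).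
pose wk k : 'rV[R]_n := rsubmx (lsubmx (z k)).
pose yk k : 'rV[R]_n := rsubmx (z k).
have lz : (fun k => lsubmx (z k)) @ \oo --> row_mx q w.
  by rewrite -[X in _ --> X](row_mxKl (row_mx q w) (0 : 'rV[R]_n)); exact: cvg_lsubmx.
have qkq : qk @ \oo --> q by rewrite -[X in _ --> X](row_mxKl q w); exact: cvg_lsubmx.
have wkw : wk @ \oo --> w by rewrite -[X in _ --> X](row_mxKr q w); exact: cvg_rsubmx.
have yk0 : yk @ \oo --> (0 : 'rV[R]_n).
  by rewrite -[X in _ --> X](row_mxKr (row_mx q w) (0 : 'rV[R]_n)); exact: cvg_rsubmx.
pose pk k : 'rV[R]_d := pbar + t k *: qk k; pose xk k : 'rV[R]_n := xbar + t k *: wk k.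
have pkp : pk @ \oo --> pbar by exact: (cvg_add_scale tl qkq).
have xkx : xk @ \oo --> xbar by exact: (cvg_add_scale tl wkw).
(* The element of [F (xk k)] behind the k-th graph point; its residual is exactly [t k *: yk k]. *)
pose uk k : 'rV[R]_n := t k *: yk k - f (pk k) (xk k).
have ykl : (fun k => t k *: yk k) @ \oo --> (0 : 'rV[R]_n).
  by have := cvgZ tl.2 yk0; rewrite scale0r; exact.
have uku : uk @ \oo --> ubar.
  by rewrite -[X in _ --> X]sub0r; apply: cvgB => //; exact: cvg_joint.
have Fk k : F (xk k) (uk k).
  have := Gz k; rewrite -[z k]hsubmxK -[lsubmx (z k)]hsubmxK.
  rewrite !scale_row_mx !add_row_mx add0r gph_row_mx /joint_map row_mxKl row_mxKr.
  by move=> [u Fu fu]; rewrite /uk -fu addrC addKr.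
have Fn : \forall k \near \oo, F (xk k) (uk k) by exact: nearW.
have track := @solution_tracking t pk xk uk tl pkp xkx uku Fn.
have sx : (fun k => (t k)^-1 *: (s (pk k) - xk k)) @ \oo --> (0 : 'rV[R]_n).
  apply: track; rewrite [X in X @ _ --> _](_ : _ = yk)//.
  apply/funext => k; rewrite /uk addrC subrK scalerA mulVf ?gt_eqF ?tl.1//.
  by rewrite scale1r.
rewrite -{1}s_pbar.
apply: (graphical_derivative_quotient SE pbar_ball tl qkq).
have -> : (fun k => (t k)^-1 *: (s (pbar + t k *: qk k) - s pbar)) =
    (fun k => (t k)^-1 *: (s (pk k) - xk k) + wk k).
  apply/funext => k; rewrite s_pbar -[wk k]scale1r -(@mulVf _ (t k)) ?gt_eqF ?tl.1//.
  by rewrite -scalerA -scalerDr; congr (_ *: _); rewrite /xk opprD addrA subrK.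
by rewrite -[X in _ --> X]add0r; apply: cvgD => //; exact: sx.
Qed.

(** At a solution the element of [F] is [- f p x], whose quotients converge by differentiability of
    [f]; so tangents to [gph S] produce tangents to [gph F]. *)
Lemma graphical_derivative_chain (q : 'rV[R]_d) (w : 'rV[R]_n) : DS q w ->
  graphical_derivative F xbar ubar w
    (- (q *m jacobian_p f pbar xbar + w *m jacobian_x f pbar xbar)).
Proof.
move=> /graphical_derivative_solutionP[t tl sw].
pose wk k : 'rV[R]_n := (t k)^-1 *: (s (pbar + t k *: q) - xbar).
have xE k : xbar + t k *: wk k = s (pbar + t k *: q).
  by rewrite scalerA divff ?gt_eqF ?tl.1// scale1r addrC subrK.
pose v : 'rV[R]_n := q *m jacobian_p f pbar xbar + w *m jacobian_x f pbar xbar.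
have vl : (fun k => - ((t k)^-1 *:
    (f (pbar + t k *: q) (xbar + t k *: wk k) - f pbar xbar))) @ \oo --> - v.
  by apply: cvgN; exact: (joint_quotient tl (cvg_cst q) sw).
have wkw : wk @ \oo --> w by [].
apply: (tangent_cone_eventually tl (cvg_row_mx wkw vl)).
near=> k.
rewrite scale_row_mx add_row_mx gph_row_mx xE scalerN scalerA divff ?gt_eqF ?tl.1//.
rewrite scale1r opprB addKr; apply: sF.
by near: k; exact: (near_ball_line q pbar_ball tl).
Unshelve. all: by end_near. Qed.

Hypothesis F_proto : proto_differentiable F xbar ubar.

(** Proto-differentiability realizes the tangent from [graphical_derivative_chain] along every [t],
    not only along the steps that produced [w]. In the residual the quotient of [f] tends to [L] and
    that of [F] to [- L], so the residual is o(t k) and the quotients of [s] inherit the limit. *)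
Lemma solution_quotient_cvg (q : 'rV[R]_d) (w : 'rV[R]_n) (t : nat -> R) :
  DS q w -> decreases_to0 t ->
  (fun k => (t k)^-1 *: (s (pbar + t k *: q) - xbar)) @ \oo --> w.
Proof.
move=> /graphical_derivative_chain DFw tl.
set L := q *m _ + _ in DFw; pose v : 'rV[R]_n := - L.
have [_ inner] := F_proto.
have : gph (graphical_derivative F xbar ubar) (row_mx w v) by rewrite gph_row_mx.
rewrite -inner => /(_ t tl)[z zl Fz].
pose a k : 'rV[R]_n := lsubmx (z k); pose b k : 'rV[R]_n := rsubmx (z k).
have al : a @ \oo --> w by rewrite -[X in _ --> X](row_mxKl w v); exact: cvg_lsubmx.
have bl : b @ \oo --> v by rewrite -[X in _ --> X](row_mxKr w v); exact: cvg_rsubmx.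
pose pk k : 'rV[R]_d := pbar + t k *: q.
pose xk k : 'rV[R]_n := xbar + t k *: a k; pose uk k : 'rV[R]_n := ubar + t k *: b k.
have Fk : \forall k \near \oo, F (xk k) (uk k).
  apply: filterS Fz => k [z' Fz' zE].
  have z'E : z' = row_mx xbar ubar + t k *: z k.
    by rewrite -zE scalerA divff ?gt_eqF ?tl.1// scale1r addrC subrK.
  by move: Fz'; rewrite z'E -{1}[z k]hsubmxK scale_row_mx add_row_mx gph_row_mx.
have sx : (fun k => (t k)^-1 *: (s (pk k) - xk k)) @ \oo --> (0 : 'rV[R]_n).
  apply: (solution_tracking tl _ _ _ Fk).
  - exact: (cvg_add_scale (qk := fun=> q) tl (cvg_cst q)).
  - exact: (cvg_add_scale tl al).
  - exact: (cvg_add_scale tl bl).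
  have -> : (fun k => (t k)^-1 *: (f (pk k) (xk k) + uk k)) = (fun k =>
      (t k)^-1 *: (f (pbar + t k *: q) (xbar + t k *: a k) - f pbar xbar) + b k).
    apply/funext => k; rewrite /uk addrA scalerDr scalerA mulVf ?gt_eqF ?tl.1//.
    by rewrite scale1r.
  rewrite -(subrr L); exact: (cvgD (joint_quotient tl (cvg_cst q) al) bl).
have -> : (fun k => (t k)^-1 *: (s (pbar + t k *: q) - xbar)) =
    (fun k => (t k)^-1 *: (s (pk k) - xk k) + a k).
  apply/funext => k; rewrite -[a k]scale1r -(@mulVf _ (t k)) ?gt_eqF ?tl.1//.
  by rewrite -scalerA -scalerDr; congr (_ *: _); rewrite /xk opprD addrA subrK.
by rewrite -[X in _ --> X]add0r; apply: cvgD => //; exact: sx.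
Qed.

Lemma cvg_right0P (g : R -> 'rV[R]_n) (l : 'rV[R]_n) :
  (forall t, decreases_to0 t -> (g \o t) @ \oo --> l) -> g @ 0^'+ --> l.
Proof.
move=> gl; apply/(cvg_enormP (at_right_proper_filter 0)) => e e0.
apply: contrapT => nH.
have ex (k : nat) : exists t : R, [/\ 0 < t, t <= k.+1%:R^-1 & e <= enorm (g t - l)].
  apply: contrapT => nex; apply: nH.
  have k0 : 0 < (k.+1%:R^-1 : R) by rewrite invr_gt0.
  near=> t; rewrite ltNge; apply/negP => le; apply: nex; exists t; split => //.
  by near: t; exact: nbhs_right_le.
have [t tP] := choice ex.
have tl : decreases_to0 t.
  split=> [k|]; first by have [] := tP k.
  apply: (squeeze_cvgr _ (@cvg_cst _ _ _ _ _) (@decreases_to0_natSinv R).2).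
  by apply: nearW => k; have [h0 hk _] := tP k; rewrite hk ltW.
have /cvg_enormP/(_ _ e0)/filter_ex[k /=] := gl t tl.
by have [_ _] := tP k => /le_lt_trans /[apply]; rewrite ltxx.
Unshelve. all: by end_near. Qed.

Lemma solution_directional_derivative (q : 'rV[R]_d) :
  exists2 w, has_directional_derivative s pbar q w & DS q = [set w].
Proof.
have [w DSw] : exists w, DS q w.
  by rewrite -s_pbar; exact: (graphical_derivative_ex kap0 SE s_lip _ pbar_ball).
exists w.
  rewrite /has_directional_derivative s_pbar.
  by apply: cvg_right0P => t tl; exact: solution_quotient_cvg.
apply/seteqP; split=> [w' DSw'|_ ->//].
have tl := @decreases_to0_natSinv R.
exact: (cvg_unique _ (solution_quotient_cvg DSw' tl) (solution_quotient_cvg DSw tl)).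
Qed.

Lemma directional_derivative_lipschitz (q : 'rV[R]_d) : locally_lipschitz DS q.
Proof.
exists setT; first exact: filterT.
split=> [q' _|]; first by have [w _ ->] := solution_directional_derivative q'; exists w.
exists kap => q1 q2 _ _.
have [w1 _ D1] := solution_directional_derivative q1.
have [w2 _ D2] := solution_directional_derivative q2.
rewrite (value_at_set1 D1) (value_at_set1 D2).
have DS1 : DS q1 w1 by rewrite D1.
have DS2 : DS q2 w2 by rewrite D2.
have tl := @decreases_to0_natSinv R.
apply: cvg_enorm_bound (cvgB (solution_quotient_cvg DS1 tl) (solution_quotient_cvg DS2 tl)).
near=> k.
have p1 : enorm (pbar + k.+1%:R^-1 *: q1 - pbar) < r.
  by near: k; exact: (near_ball_line q1 pbar_ball tl).
have p2 : enorm (pbar + k.+1%:R^-1 *: q2 - pbar) < r.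
  by near: k; exact: (near_ball_line q2 pbar_ball tl).
have k0 : 0 < (k.+1%:R^-1 : R) by rewrite invr_gt0.
rewrite !fctE -scalerBr opprB addrA subrK enormZ gtr0_norm ?invr_gt0// ler_pdivrMl//.
have := s_lip p1 p2; rewrite opprD addrACA subrr add0r -scalerBr enormZ gtr0_norm//.
by rewrite mulrCA.
Unshelve. all: by end_near. Qed.

(** For each neighbourhood in the limit superior, the supremum of the outer norms over it, when
    finite, is a Lipschitz constant on a smaller ball, which is convex and so contains the segments
    of the mean value argument. *)
Lemma lipschitz_modulus_le :
  (lipschitz_modulus S pbar <=
   limf_esup (fun p => outer_norm (graphical_derivative S p (s p))) (nbhs pbar))%E.
Proof.
apply: le_ereal_inf_tmp => _ [A Apbar <-].
set a := ereal_sup _.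
have DSa p : A p -> (outer_norm (graphical_derivative S p (s p)) <= a)%E.
  by move=> Ap; apply: ereal_sup_ubound; exists p.
have a0 : (0 <= a)%E.
  apply: (@le_trans _ _ (outer_norm (graphical_derivative S pbar (s pbar)))); last first.
    by apply: DSa; exact: nbhs_singleton.
  have := outer_norm_ge _ (graphical_derivative0 kap0 SE s_lip pbar_ball).
  by rewrite !enorm0; apply; exact: ler01.
have /nbhs_enormP[r1 r10 r1A] := Apbar.
pose r2 := Num.min r r1.
have r2r : r2 <= r by rewrite ge_min lexx.
have r2r1 : r2 <= r1 by rewrite ge_min lexx orbT.
have r20 : 0 < r2 by rewrite lt_min r0.
pose B := [set p : 'rV[R]_d | enorm (p - pbar) < r2].
have Bn : nbhs pbar B by apply/nbhs_enormP; exists r2.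
apply: (@le_trans _ _ (ereal_sup ((fun z : 'rV[R]_d * 'rV[R]_d =>
    (enorm (s z.1 - s z.2) / enorm (z.1 - z.2))%:E) @`
    [set z | (B z.1 /\ B z.2) /\ z.1 != z.2]))).
  apply: ereal_inf_lbound.
  exists [set z | (B z.1 /\ B z.2) /\ z.1 != z.2] => //.
  by exists (B, B) => //= -[z1 z2] [/= Bz1 Bz2] z12.
apply/ereal_supP => _ [[p p'] /= [[Bp Bp'] pp'] <-].
case: a a0 DSa => [M| |//] M0 DSM; last by rewrite leey.
rewrite lee_fin in M0; rewrite lee_fin ler_pdivrMr ?enorm_gt0 ?subr_eq0//.
apply: (lipschitz_of_outer_norm (r := r2) (kap := kap) (S := S) (pbar := pbar)) => //.
- by move=> p1 p1r; apply: SE; exact: lt_le_trans r2r.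
- by move=> p1 p2 p1r p2r; apply: s_lip; exact: lt_le_trans r2r.
- by move=> p1 p1r; apply: DSM; apply: r1A; exact: lt_le_trans r2r1.
Qed.

End FirstOrder.

(** * Semismoothness of the solution map *)

Section NormalCones.
Context {R : realType}.

(** The first block is unconstrained: moving along [lsubmx v] stays in the set, so the normal
    inequality forces that block to vanish. *)
Lemma regular_normal_preimage_rsubmx d m (B : set 'rV[R]_m) (z v : 'rV[R]_(d + m)) :
  B (rsubmx z) ->
  regular_normal_cone [set y : 'rV[R]_(d + m) | B (rsubmx y)] z v ->
  lsubmx v = 0 /\ regular_normal_cone B (rsubmx z) (rsubmx v).
Proof.
move=> Bz vN; split.
  apply: contrapT => /eqP v0; have {v0}v0 : 0 < enorm (lsubmx v) by rewrite enorm_gt0.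
  have e0 : 0 < enorm (lsubmx v) / 2 by rewrite divr_gt0.
  have /nbhs_enormP[r r0 H] := vN _ e0.
  pose t := r / (2 * enorm (lsubmx v)).
  have t0 : 0 < t by rewrite divr_gt0// mulr_gt0.
  pose y : 'rV[R]_(d + m) := row_mx (t *: lsubmx v) 0.
  have yE : enorm y = t * enorm (lsubmx v).
    by rewrite /enorm dotv_row_mx dotv0l addr0 -/(enorm _) enormZ gtr0_norm.
  have yr : t * enorm (lsubmx v) = r / 2.
    by rewrite /t invfM mulrA divfK// gt_eqF.
  have := H (z + y); rewrite addrAC subrr add0r yE.
  have -> : t * enorm (lsubmx v) < r by rewrite yr; lra.
  have Bzy : B (rsubmx (z + y)) by rewrite linearD /= row_mxKr addr0.
  move=> /(_ isT Bzy).
  rewrite -{1}[v]hsubmxK dotv_row_mx dotv0r addr0 dotvZr -sqr_enorm.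
  have : 0 < t * enorm (lsubmx v) ^+ 2 by rewrite mulr_gt0// exprn_gt0.
  lra.
move=> e e0; have /nbhs_enormP[r r0 H] := vN _ e0.
apply/nbhs_enormP; exists r => // y yr By.
have E : row_mx (lsubmx z) y - z = row_mx 0 (y - rsubmx z).
  by rewrite -{2}[z]hsubmxK row_mxB subrr.
have By' : B (rsubmx (row_mx (lsubmx z) y)) by rewrite row_mxKr.
have := H (row_mx (lsubmx z) y); rewrite E enorm_row_mx0l => /(_ yr By').
by rewrite -{1}[v]hsubmxK dotv_row_mx dotv0r add0r.
Qed.

Lemma jacobian_bound d n (s : 'rV[R]_d -> 'rV[R]_n) (p v : 'rV[R]_d)
    (D : 'M[R]_(d, n)) (kap : R) :
  is_linearization s p D ->
  (\forall p' \near p, enorm (s p' - s p) <= kap * enorm (p' - p)) ->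
  enorm (v *m D) <= kap * enorm v.
Proof.
move=> sD slip.
have [->|v0] := eqVneq v 0; first by rewrite mul0mx !enorm0 mulr0.
have {v0}v0 : 0 < enorm v by rewrite enorm_gt0.
apply/ler_addgt0Pr => e e0.
have /nbhs_enormP[r1 r10 H1] := sD _ (divr_gt0 e0 v0).
have /nbhs_enormP[r2 r20 H2] := slip.
pose r := Num.min r1 r2; have r_0 : 0 < r by rewrite lt_min r10.
pose t := r / (2 * enorm v).
have t0 : 0 < t by rewrite divr_gt0// mulr_gt0.
have pE : p + t *: v - p = t *: v by rewrite addrAC subrr add0r.
have tv : enorm (t *: v) = t * enorm v by rewrite enormZ gtr0_norm.
have tvr : t * enorm v < r.
  have -> : t * enorm v = r / 2 by rewrite /t invfM mulrA divfK// gt_eqF.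
  lra.
have := H1 (p + t *: v); have := H2 (p + t *: v); rewrite pE tv -scalemxAl.
have -> : t * enorm v < r1 by rewrite (lt_le_trans tvr)// ge_min lexx.
have -> : t * enorm v < r2 by rewrite (lt_le_trans tvr)// ge_min lexx orbT.
move=> /(_ isT) h2 /(_ isT).
have -> : e / enorm v * (t * enorm v) = t * e.
  by rewrite mulrCA divfK// gt_eqF.
set g := s _ - s p in h2 *; rewrite enormBC => h1.
have := enorm_le_add (t *: (v *m D)) g.
rewrite enormZ gtr0_norm// => h3.
rewrite -(ler_pM2l t0); lra.
Qed.

(** Paired with a graph increment, the vector gives the inner product of [y] with a linearization
    error, which is small relative to the increment. Jacobians of [s] thus supply the normals to
    which [semismooth_star] is applied. *)
Lemma regular_normal_graph d n (S : 'rV[R]_d -> set 'rV[R]_n)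
    (s : 'rV[R]_d -> 'rV[R]_n) (p : 'rV[R]_d) (D : 'M[R]_(d, n)) (y : 'rV[R]_n) :
  is_linearization s p D ->
  (\forall p' \near p, S p' = [set s p']) ->
  regular_normal_cone (gph S) (row_mx p (s p)) (row_mx (y *m D^T) (- y)).
Proof.
move=> sD SE e e0.
have y1 : 0 < enorm y + 1 by rewrite ltr_wpDl.
have /nbhs_enormP[r1 r10 H1] := sD _ (divr_gt0 e0 y1).
have /nbhs_enormP[r2 r20 H2] := SE.
pose r := Num.min r1 r2; have r_0 : 0 < r by rewrite lt_min r10.
apply/nbhs_enormP; exists r => // z zr.
have pr : enorm (lsubmx z - p) <= enorm (z - row_mx p (s p)).
  by have := enorm_lsubmx (z - row_mx p (s p)); rewrite linearB /= row_mxKl.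
have pr1 : enorm (lsubmx z - p) < r1.
  by rewrite (le_lt_trans pr)// (lt_le_trans zr)// ge_min lexx.
have pr2 : enorm (lsubmx z - p) < r2.
  by rewrite (le_lt_trans pr)// (lt_le_trans zr)// ge_min lexx orbT.
rewrite /gph /= H2// => zE.
have -> : z - row_mx p (s p) = row_mx (lsubmx z - p) (s (lsubmx z) - s p).
  by rewrite -row_mxB -zE hsubmxK.
have := H1 _ pr1; set g := s _ - s p => h1.
rewrite dotv_row_mx dotvNl dotvC -dotv_mulmx dotvC -dotvBr.
have -> : (lsubmx z - p) *m D - g = - (g - (lsubmx z - p) *m D).
  by apply/esym; exact: opprB.
rewrite dotvNr.
have c := cauchy_schwarzN y (g - (lsubmx z - p) *m D).
have le1 : enorm y * enorm (g - (lsubmx z - p) *m D)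
    <= enorm y * (e / (enorm y + 1) * enorm (lsubmx z - p)) by rewrite ler_wpM2l.
have le2 : enorm y * (e / (enorm y + 1)) <= e.
  by rewrite mulrA ler_pdivrMr// mulrC ler_pM2l// lerDl.
have le3 : enorm y * (e / (enorm y + 1) * enorm (lsubmx z - p)) <= e * enorm (lsubmx z - p).
  by rewrite mulrA ler_wpM2r.
have le4 : e * enorm (lsubmx z - p) <= e * enorm (row_mx (lsubmx z - p) g).
  rewrite ler_wpM2l ?(ltW e0)//.
  by have := enorm_lsubmx (row_mx (lsubmx z - p) g); rewrite row_mxKl.
lra.
Qed.

End NormalCones.

Section Semismooth.
Context {R : realType} {d n : nat}.
Context (pbar : 'rV[R]_d) (xbar : 'rV[R]_n).
Context (f : 'rV[R]_d -> 'rV[R]_n -> 'rV[R]_n) (F : 'rV[R]_n -> set 'rV[R]_n).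
Hypothesis f_C1 : continuously_differentiable_at (joint f) (row_mx pbar xbar).
Hypothesis F_closed : closed (gph F).
Local Notation S := (solution_map f F).
Local Notation s := (value_at S).
Local Notation ubar := (- f pbar xbar).
Local Notation Jp := (jacobian_p f).
Local Notation Jx := (jacobian_x f).
Context (kap r : R).
Hypothesis kap0 : 0 < kap.
Hypothesis r0 : 0 < r.
Hypothesis SE : forall p : 'rV[R]_d, enorm (p - pbar) < r -> S p = [set s p].
Hypothesis sF : forall p : 'rV[R]_d, enorm (p - pbar) < r -> F (s p) (- f p (s p)).
Hypothesis s_lip : forall p p' : 'rV[R]_d,
  enorm (p - pbar) < r -> enorm (p' - pbar) < r ->
  enorm (s p - s p') <= kap * enorm (p - p').
Hypothesis s_pbar : s pbar = xbar.
Hypothesis s_residual : forall (p : 'rV[R]_d) (x u : 'rV[R]_n),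
  enorm (p - pbar) < r -> enorm (x - xbar) < r -> enorm (u - ubar) < r ->
  F x u -> enorm (f p x + u) < r -> enorm (s p - x) <= kap * enorm (f p x + u).

Lemma residual_near : exists2 r1 : R, 0 < r1 & r1 <= r /\
  forall (p : 'rV[R]_d) (x u : 'rV[R]_n), enorm (p - pbar) < r1 ->
    enorm (x - xbar) < r1 -> enorm (u - ubar) < r1 ->
    differentiable (joint f) (row_mx p x) /\ enorm (f p x + u) < r.
Proof.
have [rd rd0 diff_rd] := differentiable_near f_C1.
have [k k0 [rk rk0 flip]] := joint_locally_lipschitz f_C1.
pose r2 := r / (2 * k + 1).
have k1 : 0 < 2 * k + 1 by rewrite addr_gt0// mulr_gt0.
have r20 : 0 < r2 by rewrite divr_gt0.
exists (Num.min (Num.min rd rk) (Num.min r r2)); first by rewrite !lt_min rd0 rk0 r0 r20.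
split; first by rewrite !ge_min lexx orbT.
move=> p x u; rewrite !lt_min.
move=> /andP[/andP[pd pk] /andP[_ p2]] /andP[/andP[xd xk] /andP[_ x2]].
move=> /andP[_ /andP[_ u2]]; split; first exact: diff_rd.
have bk : enorm (pbar - pbar) < rk by rewrite subrr enorm0.
have xk0 : enorm (xbar - xbar) < rk by rewrite subrr enorm0.
have h1 := flip _ _ _ _ bk pk xk0 xk.
have -> : f p x + u = (f p x - f pbar xbar) + (u - ubar).
  by rewrite opprK addrACA addNr addr0.
rewrite (le_lt_trans (enormD _ _))//.
have : r2 * (2 * k + 1) = r by rewrite divfK// gt_eqF.
have : k * (enorm (p - pbar) + enorm (x - xbar)) <= k * (r2 + r2).
  by rewrite ler_wpM2l ?(ltW k0)// lerD// ltW.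
lra.
Qed.

(* Exact penalization of the constraint f p x + u = 0 over the points (p, (x, u))
   with (x, u) in gph F; mu is the resulting (bounded) multiplier. *)
Lemma regular_normal_solution : exists2 r1 : R, 0 < r1 &
  forall (p0 : 'rV[R]_d) (x0 : 'rV[R]_n) (ps : 'rV[R]_d) (xs : 'rV[R]_n) (eps rho : R),
  enorm (p0 - pbar) < r1 -> enorm (x0 - xbar) < r1 ->
  enorm (- f p0 x0 - ubar) < r1 -> S p0 x0 ->
  regular_normal_cone (gph S) (row_mx p0 x0) (row_mx ps xs) ->
  0 < eps -> eps <= 1 -> 0 < rho ->
  exists (p : 'rV[R]_d) (x u mu : 'rV[R]_n) (nu : 'rV[R]_(n + n)),
    [/\ F x u, enorm (p - p0) <= rho, enorm (x - x0) <= rho &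
      enorm (u + f p0 x0) <= rho] /\
    [/\ enorm mu <= kap * (enorm xs + 1),
      enorm (ps - mu *m (Jp p x)^T) <= 4 * eps,
      regular_normal_cone (gph F) (row_mx x u) nu &
      enorm (nu - row_mx (xs - mu *m (Jx p x)^T) (- mu)) <= 4 * eps].
Proof.
have [r1 r10 [r1r good]] := residual_near.
exists (r1 / 2); first by rewrite divr_gt0.
move=> p0 x0 ps xs eps rho' p0r x0r u0r Spx0 pxN eps0 eps1 rho'0.
have p0r' : enorm (p0 - pbar) < r by lra.
have x0E : s p0 = x0 by move: Spx0; rewrite SE.
have k1 : 0 < 1 + kap by rewrite addr_gt0.
have /nbhs_enormP[rN rN0 HN] := pxN _ eps0.
(* The three bounds are the requested accuracy, the region of [residual_near], and the region where
   [pxN] applies: moving p by [rho] moves the graph point by at most [(1 + kap) * rho]. *)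
pose rho := Num.min rho' (Num.min (r1 / 4) (rN / (2 * (1 + kap)))).
have rho0 : 0 < rho by rewrite !lt_min rho'0 !divr_gt0// mulr_gt0.
have rhorho' : rho <= rho' by rewrite ge_min lexx.
have rhor1 : rho <= r1 / 4 by rewrite !ge_min lexx orbT.
have rhoN : rho * (2 * (1 + kap)) <= rN.
  by rewrite -ler_pdivlMr ?mulr_gt0// !ge_min lexx !orbT.
pose u0 : 'rV[R]_n := - f p0 x0.
pose z0 : 'rV[R]_(d + (n + n)) := row_mx p0 (row_mx x0 u0).
pose pp (z : 'rV[R]_(d + (n + n))) : 'rV[R]_d := lsubmx z.
pose xx (z : 'rV[R]_(d + (n + n))) : 'rV[R]_n := lsubmx (rsubmx z).
pose uu (z : 'rV[R]_(d + (n + n))) : 'rV[R]_n := rsubmx (rsubmx z).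
pose A := [set z : 'rV[R]_(d + (n + n)) | gph F (rsubmx z)].
have clA : closed A.
  apply: (@preimage_closed _ _ (fun z : 'rV[R]_(d + (n + n)) => rsubmx z) (gph F)) => //.
  by move=> z _; exact: (@cvg_rsubmx R _ (nbhs z) _ d _ id z (@cvg_id _ _)).
pose h (z : 'rV[R]_(d + (n + n))) : 'rV[R]_n := f (pp z) (xx z) + uu z.
pose D (z : 'rV[R]_(d + (n + n))) : 'M[R]_(d + (n + n), n) :=
  col_mx (Jp (pp z) (xx z)) (col_mx (Jx (pp z) (xx z)) 1%:M).
(* The exact penalty weight: replacing x by [s p] changes the linear form by at most
   [enorm xs * (kap * enorm (h z))], and the error term of the normal, with [eps <= 1], adds at most
   [kap * enorm (h z)]. *)
pose C := kap * (enorm xs + 1).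
have xs1 : 0 < enorm xs + 1 by rewrite ltr_wpDl.
have C0 : 0 < C by rewrite mulr_gt0.
(* [dl] and [K] are balanced: on the sphere of radius [rho] the quadratic term is [2 * eps * rho],
   more than the [eps * rho] of the penalty inequality plus [C * dl = eps * rho / 2]. Minimizers are
   therefore interior, and the gradient of the quadratic term is at most [4 * eps]. *)
pose dl := eps * rho / (2 * C).
have dl0 : 0 < dl by rewrite divr_gt0 ?mulr_gt0.
have Cdl : C * dl = eps * rho / 2 by rewrite /dl; field; rewrite gt_eqF.
pose K := 2 * eps / rho.
have K0 : 0 < K by rewrite divr_gt0// mulr_gt0.
pose l : 'rV[R]_(d + (n + n)) := row_mx ps (row_mx xs 0).
have hz0 : h z0 = 0.
  by rewrite /h /pp /xx /uu /z0 !(row_mxKl, row_mxKr) subrr.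
have ppB z z' : enorm (pp z - pp z') <= enorm (z - z').
  by rewrite -linearB enorm_lsubmx.
have xxB z z' : enorm (xx z - xx z') <= enorm (z - z').
  by rewrite -!linearB (le_trans (enorm_lsubmx _))// enorm_rsubmx.
have uuB z z' : enorm (uu z - uu z') <= enorm (z - z').
  by rewrite -!linearB (le_trans (enorm_rsubmx _))// enorm_rsubmx.
have pz0 : pp z0 = p0 by rewrite /pp row_mxKl.
have xz0 : xx z0 = x0 by rewrite /xx row_mxKr row_mxKl.
have uz0 : uu z0 = u0 by rewrite /uu !row_mxKr.
have pnear z : enorm (z - z0) <= rho -> enorm (pp z - pbar) < r1.
  move=> zr; have := ppB z z0; rewrite pz0 => h1.
  by rewrite (le_lt_trans (enorm_triangle p0 _ _))//; lra.
have xnear z : enorm (z - z0) <= rho -> enorm (xx z - xbar) < r1.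
  move=> zr; have := xxB z z0; rewrite xz0 => h1.
  by rewrite (le_lt_trans (enorm_triangle x0 _ _))//; lra.
have unear z : enorm (z - z0) <= rho -> enorm (uu z - ubar) < r1.
  move=> zr; have := uuB z z0; rewrite uz0 => h1.
  by rewrite (le_lt_trans (enorm_triangle u0 _ _))//; lra.
have zE z : z = row_mx (pp z) (row_mx (xx z) (uu z)) by rewrite !hsubmxK.
(* Compare z with the true graph point over the same p: the normal inequality handles [s p], and the
   error bound by the residual handles the distance from x to [s p]. *)
have penalty z : A z -> enorm (z - z0) <= rho ->
    dotv l (z - z0) <= C * enorm (h z) + eps * enorm (z - z0).
  move=> Az zr.
  have [_ hzr] := good _ _ _ (pnear _ zr) (xnear _ zr) (unear _ zr).
  have sx : enorm (s (pp z) - xx z) <= kap * enorm (h z).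
    apply: s_residual => //; [exact: lt_le_trans (pnear _ zr) r1r|
      exact: lt_le_trans (xnear _ zr) r1r|exact: lt_le_trans (unear _ zr) r1r].
  have pr : enorm (pp z - pbar) < r by exact: lt_le_trans (pnear _ zr) r1r.
  have sp := s_lip pr p0r'; rewrite x0E in sp.
  have ppz := ppB z z0; rewrite pz0 in ppz.
  have := HN (row_mx (pp z) (s (pp z))).
  rewrite row_mxB gph_row_mx dotv_row_mx SE// => HN'.
  have {}HN' := HN' _ erefl.
  have n1 : enorm (row_mx (pp z - p0) (s (pp z) - x0)) < rN.
    rewrite (le_lt_trans (enorm_row_mx_le _ _))//.
    have : kap * enorm (pp z - p0) <= kap * rho.
      by rewrite ler_wpM2l ?(ltW kap0)// (le_trans ppz).
    have : 0 < kap * rho by rewrite mulr_gt0.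
    lra.
  have {}HN' := HN' n1.
  have n2 : enorm (row_mx (pp z - p0) (s (pp z) - x0)) <=
      enorm (z - z0) + kap * enorm (h z).
    have -> : row_mx (pp z - p0) (s (pp z) - x0) =
        row_mx (pp z - p0) (xx z - x0) + row_mx (0 : 'rV_d) (s (pp z) - xx z).
      by rewrite add_row_mx addr0 [_ + (_ - xx z)]addrC addrA subrK.
    rewrite (le_trans (enormD _ _))// lerD ?enorm_row_mx0l//.
    rewrite -(@ler_pXn2r _ 2) ?nnegrE// sqr_enorm_row_mx.
    have -> : z - z0 = row_mx (pp z - p0) (row_mx (xx z - x0) (uu z - u0)).
      by rewrite {1}(zE z) /z0 !row_mxB.
    by rewrite !sqr_enorm_row_mx addrA lerDl sqr_ge0.
  have lE : dotv l (z - z0) = dotv ps (pp z - p0) + dotv xs (s (pp z) - x0)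
      + dotv xs (xx z - s (pp z)).
    have -> : z - z0 = row_mx (pp z - p0) (row_mx (xx z - x0) (uu z - u0)).
      by rewrite {1}(zE z) /z0 !row_mxB.
    rewrite /l !dotv_row_mx dotv0l addr0 -addrA -dotvDr; congr (_ + dotv _ _).
    by rewrite [RHS]addrC addrA subrK.
  have c := cauchy_schwarz xs (xx z - s (pp z)); rewrite (enormBC (xx z)) in c.
  have c2 : enorm xs * enorm (s (pp z) - xx z) <= enorm xs * (kap * enorm (h z)).
    by rewrite ler_wpM2l.
  have c3 : eps * enorm (row_mx (pp z - p0) (s (pp z) - x0)) <=
      eps * (enorm (z - z0) + kap * enorm (h z)).
    by rewrite ler_wpM2l ?(ltW eps0).
  have c4 : eps * (kap * enorm (h z)) <= 1 * (kap * enorm (h z)).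
    by rewrite ler_wpM2r// mulr_ge0// ltW.
  rewrite lE /C; lra.
have dl2 : 0 < dl ^+ 2 by rewrite exprn_gt0.
have sqrt0 : Num.sqrt (dotv (h z0) (h z0) + dl ^+ 2) = dl.
  by rewrite hz0 dotv0l add0r sqrtr_sqr gtr0_norm.
have sqrt_ge z : enorm (h z) <= Num.sqrt (dotv (h z) (h z) + dl ^+ 2).
  by rewrite ler_wsqrtr// lerDl ltW.
have Az0 : A z0 by rewrite /A /= row_mxKr gph_row_mx -x0E /u0 -x0E; exact: sF.
have [||z1 [Az1 z1rho _ z1N]] := @interior_min_regular_normal R _ _ A
    h D l z0 C K (dl ^+ 2) rho clA Az0 (ltW C0) (ltW K0) (ltW dl2) rho0.
- move=> z Az zr e e0.
  have [dz _] := good _ _ _ (pnear _ zr) (xnear _ zr) (unear _ zr).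
  have e2 : 0 < e / 2 by rewrite divr_gt0.
  have [r2 r20 H] := joint_linearization dz e2.
  apply/nbhs_enormP; exists r2 => // z' z'z.
  have hp := le_lt_trans (ppB z' z) z'z; have hx := le_lt_trans (xxB z' z) z'z.
  have := H _ _ hp hx => H1.
  have E : z' - z = row_mx (pp z' - pp z) (row_mx (xx z' - xx z) (uu z' - uu z)).
    by rewrite {1}(zE z') {1}(zE z) !row_mxB.
  have -> : h z' - h z - (z' - z) *m D z = f (pp z') (xx z') - f (pp z) (xx z)
      - ((pp z' - pp z) *m Jp (pp z) (xx z) + (xx z' - xx z) *m Jx (pp z) (xx z)).
    rewrite [in LHS]E /D !mul_row_col mulmx1 /h.
    set a := _ *m Jp _ _; set b := _ *m Jx _ _.
    by apply/rowP => i; rewrite !mxE; ring.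
  rewrite (le_trans H1)//.
  have -> : e * enorm (z' - z) = e / 2 * (enorm (z' - z) + enorm (z' - z)).
    by field.
  by rewrite ler_wpM2l ?(ltW e2)// lerD.
- move=> z Az zr; rewrite sqrt0 subrr dotv0l mulr0 addr0 Cdl -(sqr_enorm (z - z0)) => le.
  have pen := penalty z Az zr.
  rewrite lt_neqAle zr andbT; apply/eqP => zrho.
  have : K * enorm (z - z0) ^+ 2 = 2 * eps * rho.
    by rewrite zrho /K; field; rewrite gt_eqF.
  rewrite dotvBr zrho in pen *.
  have : C * enorm (h z) <= C * Num.sqrt (dotv (h z) (h z) + dl ^+ 2).
    by rewrite ler_wpM2l ?(ltW C0).
  have : 0 < eps * rho by rewrite mulr_gt0.
  rewrite zrho in le; lra.
have s20 : 0 < dotv (h z1) (h z1) + dl ^+ 2 by rewrite ltr_wpDl ?dotvv_ge0.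
have := z1N s20; set sq := Num.sqrt _ => {}z1N.
have sq0 : 0 < sq by rewrite sqrtr_gt0.
pose mu : 'rV[R]_n := (C / sq) *: h z1.
have muC : enorm mu <= C.
  by rewrite enormZ gtr0_norm ?divr_gt0// mulrAC ler_pdivrMr// ler_wpM2l ?(ltW C0)//.
have [nl nr] := regular_normal_preimage_rsubmx Az1 z1N.
have zr1 := ltW z1rho.
pose e : 'rV[R]_(d + (n + n)) := (2 * K) *: (z1 - z0).
have ee : enorm e <= 4 * eps.
  rewrite enormZ gtr0_norm; last by apply: mulr_gt0.
  apply: (@le_trans _ _ (2 * K * rho)); first by rewrite ler_wpM2l// mulr_ge0// ltW.
  by rewrite /K -mulrA divfK ?gt_eqF//; lra.
have vE : l - (C / sq) *: (h z1 *m (D z1)^T) - (2 * K) *: (z1 - z0) =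
    row_mx (ps - mu *m (Jp (pp z1) (xx z1))^T)
      (row_mx (xs - mu *m (Jx (pp z1) (xx z1))^T) (- mu)) - e.
  congr (_ - _); rewrite /l /D !tr_col_mx !mul_mx_row trmx1 mulmx1 /mu -!scalemxAl.
  by rewrite !scale_row_mx !row_mxB sub0r.
move: nl nr; rewrite vE !linearB /= row_mxKl row_mxKr => nl nr.
exists (pp z1), (xx z1), (uu z1), mu; eexists; split; [split|split; last 2 first].
- exact: Az1.
- by have := ppB z1 z0; rewrite pz0; lra.
- by have := xxB z1 z0; rewrite xz0; lra.
- by have := uuB z1 z0; rewrite uz0 /u0 opprK; lra.
- by rewrite hsubmxK; exact: nr.
- rewrite addrAC subrr add0r enormN (le_trans _ ee)//; exact: enorm_rsubmx.
- exact: muC.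
- have -> : ps - mu *m (Jp (pp z1) (xx z1))^T = lsubmx e.
    by apply/eqP; rewrite -subr_eq0; apply/eqP.
  by rewrite (le_trans _ ee)//; exact: enorm_lsubmx.
Qed.

End Semismooth.

Section SemismoothSolution.
Context {R : realType} {d n : nat}.
Context (pbar : 'rV[R]_d) (xbar : 'rV[R]_n).
Context (f : 'rV[R]_d -> 'rV[R]_n -> 'rV[R]_n) (F : 'rV[R]_n -> set 'rV[R]_n).
Hypothesis f_C1 : continuously_differentiable_at (joint f) (row_mx pbar xbar).
Hypothesis F_closed : closed (gph F).
Local Notation S := (solution_map f F).
Local Notation s := (value_at S).
Local Notation ubar := (- f pbar xbar).
Local Notation DS := (graphical_derivative S pbar xbar).
Local Notation Jp := (jacobian_p f).
Local Notation Jx := (jacobian_x f).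
Context (kap r : R).
Hypothesis kap0 : 0 < kap.
Hypothesis r0 : 0 < r.
Hypothesis SE : forall p : 'rV[R]_d, enorm (p - pbar) < r -> S p = [set s p].
Hypothesis sF : forall p : 'rV[R]_d, enorm (p - pbar) < r -> F (s p) (- f p (s p)).
Hypothesis s_lip : forall p p' : 'rV[R]_d,
  enorm (p - pbar) < r -> enorm (p' - pbar) < r ->
  enorm (s p - s p') <= kap * enorm (p - p').
Hypothesis s_pbar : s pbar = xbar.
Hypothesis s_residual : forall (p : 'rV[R]_d) (x u : 'rV[R]_n),
  enorm (p - pbar) < r -> enorm (x - xbar) < r -> enorm (u - ubar) < r ->
  F x u -> enorm (f p x + u) < r -> enorm (s p - x) <= kap * enorm (f p x + u).

(** The decoupling is used with tolerance [k.+1%:R^-1] for normals and [t k * k.+1%:R^-1] for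
    points. The latter is o(t k), so the perturbed points of [gph F] keep the limit direction of the
    original ones; the multipliers, being bounded, converge along a subsequence. *)
Lemma semismooth_star_solution :
  semismooth_star (gph F) (row_mx xbar ubar) ->
  semismooth_star (gph S) (row_mx pbar xbar).
Proof.
move=> Fss u v [t [uk [vk [tl ukl Suk vkN vkl]]]].
have [r1 r10 decouple] := regular_normal_solution f_C1 F_closed kap0 r0 SE sF s_lip s_residual.
pose q : 'rV[R]_d := lsubmx u; pose w : 'rV[R]_n := rsubmx u.
pose ps : 'rV[R]_d := lsubmx v; pose xs : 'rV[R]_n := rsubmx v.
pose qk k : 'rV[R]_d := lsubmx (uk k); pose wk k : 'rV[R]_n := rsubmx (uk k).
pose psk k : 'rV[R]_d := lsubmx (vk k); pose xsk k : 'rV[R]_n := rsubmx (vk k).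
have qkq : qk @ \oo --> q by exact: cvg_lsubmx.
have wkw : wk @ \oo --> w by exact: cvg_rsubmx.
have pskl : psk @ \oo --> ps by exact: cvg_lsubmx.
have xskl : xsk @ \oo --> xs by exact: cvg_rsubmx.
pose p k : 'rV[R]_d := pbar + t k *: qk k; pose x k : 'rV[R]_n := xbar + t k *: wk k.
have pp : p @ \oo --> pbar by exact: (cvg_add_scale tl qkq).
have xx : x @ \oo --> xbar by exact: (cvg_add_scale tl wkw).
have ff : (fun k => - f (p k) (x k)) @ \oo --> ubar.
  by apply: cvgN; exact: cvg_joint.
have pxE k : row_mx pbar xbar + t k *: uk k = row_mx (p k) (x k).
  by rewrite -{1}[uk k]hsubmxK scale_row_mx add_row_mx.
have tn := @decreases_to0_natSinv R.
(* One unit covers [enorm (xsk k) <= enorm xs + 1], valid eventually; the other is the 1 of the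
   multiplier bound. *)
pose Cm := kap * (enorm xs + 2).
pose T := ('rV[R]_d * 'rV[R]_n * 'rV[R]_n * 'rV[R]_n * 'rV[R]_(n + n))%type.
have nearex : \forall k \near \oo, exists z : T, let: (p', x', u', mu, nu) := z in
    [/\ F x' u', enorm (p' - p k) <= t k * k.+1%:R^-1,
      enorm (x' - x k) <= t k * k.+1%:R^-1 &
      enorm (u' + f (p k) (x k)) <= t k * k.+1%:R^-1] /\
    [/\ enorm mu <= Cm, enorm (psk k - mu *m (Jp p' x')^T) <= 4 * k.+1%:R^-1,
      regular_normal_cone (gph F) (row_mx x' u') nu &
      enorm (nu - row_mx (xsk k - mu *m (Jx p' x')^T) (- mu)) <= 4 * k.+1%:R^-1].
  have /cvg_enormP/(_ _ r10) pn := pp.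
  have /cvg_enormP/(_ _ r10) xn := xx.
  have /cvg_enormP/(_ _ r10) fn := ff.
  have /cvg_enormP/(_ _ ltr01) xsn := xskl.
  near=> k.
  have pk : enorm (p k - pbar) < r1 by near: k.
  have xk : enorm (x k - xbar) < r1 by near: k.
  have fk : enorm (- f (p k) (x k) - ubar) < r1 by near: k.
  have xsk1 : enorm (xsk k - xs) < 1 by near: k.
  have k0 : 0 < (k.+1%:R^-1 : R) by rewrite invr_gt0.
  have k1 : (k.+1%:R^-1 : R) <= 1 by rewrite invf_le1// ler1n.
  have Spx : S (p k) (x k) by rewrite -gph_row_mx -pxE.
  have N : regular_normal_cone (gph S) (row_mx (p k) (x k)) (row_mx (psk k) (xsk k)).
    by rewrite hsubmxK -pxE.
  have [p' [x' [u' [mu [nu [H1 [muC H2 H3 H4]]]]]]] :=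
    decouple _ _ _ _ _ _ pk xk fk Spx N k0 k1 (mulr_gt0 (tl.1 k) k0).
  exists (p', x', u', mu, nu); split => //; split => //.
  rewrite (le_trans muC)// ler_wpM2l ?(ltW kap0)//.
  have := enorm_le_add (xsk k) xs; lra.
have [M _ exM] := nearex.
have ex k := exM (k + M)%N (leq_addl k M).
have [z zP] := choice ex.
pose m k := (k + M)%N.
pose p' k : 'rV[R]_d := (z k).1.1.1.1; pose x' k : 'rV[R]_n := (z k).1.1.1.2.
pose u' k : 'rV[R]_n := (z k).1.1.2; pose mu k : 'rV[R]_n := (z k).1.2.
pose nu k : 'rV[R]_(n + n) := (z k).2.
have {}zP k : [/\ F (x' k) (u' k), enorm (p' k - p (m k)) <= t (m k) * (m k).+1%:R^-1,
      enorm (x' k - x (m k)) <= t (m k) * (m k).+1%:R^-1 &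
      enorm (u' k + f (p (m k)) (x (m k))) <= t (m k) * (m k).+1%:R^-1] /\
    [/\ enorm (mu k) <= Cm,
      enorm (psk (m k) - mu k *m (Jp (p' k) (x' k))^T) <= 4 * (m k).+1%:R^-1,
      regular_normal_cone (gph F) (row_mx (x' k) (u' k)) (nu k) &
      enorm (nu k - row_mx (xsk (m k) - mu k *m (Jx (p' k) (x' k))^T) (- mu k))
        <= 4 * (m k).+1%:R^-1].
  by have := zP k; rewrite /p' /x' /u' /mu /nu; case: (z k) => [[[[]]]].
have mk k : (k <= m k)%N by exact: leq_addr.
have [psi [mul [psik muphi]]] : exists (phi : nat -> nat) (l : 'rV[R]_n),
    (forall k, (k <= phi k)%N) /\ (mu \o phi) @ \oo --> l.
  by apply: (@bounded_subsequence _ _ mu Cm) => k; have [_ []] := zP k.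
pose phi k := m (psi k).
have phik k : (k <= phi k)%N by rewrite (leq_trans (psik k)).
have tnphi := (decreases_to0_subsequence phik tn).2.
have t4 : (fun k => 4 * (phi k).+1%:R^-1 : R) @ \oo --> (0 : R).
  by rewrite -[0 in X in _ --> X](mulr0 4); exact: cvgMr.
have tphi := decreases_to0_subsequence phik tl.
pose t' k : R := t (phi k).
have sub_cvg l (a : nat -> 'rV[R]_l) (b : 'rV[R]_l) :
    a @ \oo --> b -> (fun k => a (phi k)) @ \oo --> b.
  by move=> ab; exact: (cvg_subsequence phik ab).
have tt : (fun k => t' k * (phi k).+1%:R^-1) @ \oo --> (0 : R).
  by rewrite -[0 in X in _ --> X](mulr0 0); apply: cvgM; [exact: tphi.2|exact: tnphi].
have add_small l (a b : nat -> 'rV[R]_l) (c : 'rV[R]_l) (e : nat -> R) :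
    b @ \oo --> c -> e @ \oo --> (0 : R) -> (forall k, enorm (a k - b k) <= e k) ->
    a @ \oo --> c.
  move=> bc e0 ab; have -> : a = (fun k => (a k - b k) + b k).
    by apply/funext => k; rewrite subrK.
  rewrite -[X in _ --> X]add0r; apply: cvgD => //.
  by apply: (cvg_enorm_le e0) => k; rewrite subr0.
have p'l : (p' \o psi) @ \oo --> pbar.
  apply: (add_small _ _ (fun k => p (phi k)) _ _ _ tt) => [|k]; first exact: sub_cvg.
  by have [[_ + _ _] _] := zP (psi k).
have x'l : (x' \o psi) @ \oo --> xbar.
  apply: (add_small _ _ (fun k => x (phi k)) _ _ _ tt) => [|k]; first exact: sub_cvg.
  by have [[_ _ + _] _] := zP (psi k).
have JJ := cvg_jacobian f_C1 p'l x'l.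
have JpT : (fun k => (Jp (p' (psi k)) (x' (psi k)))^T) @ \oo --> (Jp pbar xbar)^T.
  by apply: cvg_trmx; exact: cvg_usubmx JJ.
have JxT : (fun k => (Jx (p' (psi k)) (x' (psi k)))^T) @ \oo --> (Jx pbar xbar)^T.
  by apply: cvg_trmx; exact: cvg_dsubmx JJ.
have psE : ps = mul *m (Jp pbar xbar)^T.
  apply: (cvg_unique _ (sub_cvg _ _ _ pskl)) => //.
  apply: (add_small _ _ (fun k => mu (psi k) *m (Jp (p' (psi k)) (x' (psi k)))^T) _ _ _ t4).
    exact: (cvg_mulmx muphi JpT).
  by move=> k; have [_ []] := zP (psi k).
pose nul : 'rV[R]_(n + n) := row_mx (xs - mul *m (Jx pbar xbar)^T) (- mul).
have nuphi : (nu \o psi) @ \oo --> nul.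
  apply: (add_small _ _ (fun k => row_mx (xsk (phi k) -
    mu (psi k) *m (Jx (p' (psi k)) (x' (psi k)))^T) (- mu (psi k))) _ _ _ t4).
    apply: cvg_row_mx; last exact: cvgN.
    by apply: cvgB; [exact: sub_cvg|exact: (cvg_mulmx muphi JxT)].
  by move=> k; have [_ []] := zP (psi k).
pose L : 'rV[R]_n := q *m Jp pbar xbar + w *m Jx pbar xbar.
have fL := sub_cvg _ _ _ (joint_quotient f_C1 tl qkq wkw).
have t'0 k : 0 < t' k by exact: tphi.1.
pose a k : 'rV[R]_n := (t' k)^-1 *: (x' (psi k) - xbar).
pose b k : 'rV[R]_n := (t' k)^-1 *: (u' (psi k) - ubar).
have aw : a @ \oo --> w.
  apply: (add_small _ _ (fun k => wk (phi k)) _ _ _ tnphi) => [|k]; first exact: sub_cvg.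
  have -> : a k - wk (phi k) = (t' k)^-1 *: (x' (psi k) - x (phi k)).
    by rewrite /x opprD addrA scalerBr scalerA mulVf ?gt_eqF// scale1r.
  rewrite enormZ gtr0_norm ?invr_gt0// ler_pdivrMl//.
  by have [[_ _ + _] _] := zP (psi k).
have bL : b @ \oo --> - L.
  apply: (add_small _ _ (fun k => - ((t' k)^-1 *: (f (p (phi k)) (x (phi k)) - f pbar xbar)))
    _ _ _ tnphi) => [|k]; first by apply: cvgN; exact: fL.
  have -> : b k - - ((t' k)^-1 *: (f (p (phi k)) (x (phi k)) - f pbar xbar)) =
      (t' k)^-1 *: (u' (psi k) + f (p (phi k)) (x (phi k))).
    by rewrite opprK -scalerDr opprK addrA addrAC addrK.
  rewrite enormZ gtr0_norm ?invr_gt0// ler_pdivrMl//.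
  by have [[_ _ _ +] _] := zP (psi k).
have zE k : row_mx xbar ubar + t' k *: row_mx (a k) (b k) = row_mx (x' (psi k)) (u' (psi k)).
  rewrite scale_row_mx add_row_mx !scalerA divff ?gt_eqF// !scale1r.
  by congr row_mx; rewrite addrC subrK.
have := Fss (row_mx w (- L)) nul.
(* The multiplier cancels: [ps = mul *m (Jp pbar xbar)^T] matches the [Jp] part of [L], and the two
   [Jx] terms are opposite. *)
have -> : dotv nul (row_mx w (- L)) = dotv v u.
  rewrite -[v]hsubmxK -[u]hsubmxK -/q -/w -/ps -/xs !dotv_row_mx psE.
  rewrite dotvNl dotvNr opprK dotvBl !dotv_mulmx !trmxK /L dotvDr.
  lra.
apply; exists t', (fun k => row_mx (a k) (b k)), (nu \o psi); split => //.
- exact: cvg_row_mx.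
- by move=> k; rewrite zE gph_row_mx; have [[]] := zP (psi k).
- by move=> k; rewrite zE; have [_ []] := zP (psi k).
Unshelve. all: by end_near. Qed.

Hypothesis F_proto : proto_differentiable F xbar ubar.
Hypothesis S_semismooth : semismooth_star (gph S) (row_mx pbar xbar).

Lemma near_solution (p : 'rV[R]_d) : enorm (p - pbar) < r ->
  \forall p' \near p, enorm (p' - pbar) < r.
Proof.
move=> pr; apply/nbhs_enormP; exists (r - enorm (p - pbar)); first by rewrite subr_gt0.
by move=> p' p'p; rewrite (le_lt_trans (enorm_triangle p _ _))// -ltrBrDr.
Qed.

Lemma jacobian_solution_bound (p v : 'rV[R]_d) :
  enorm (p - pbar) < r -> differentiable s p ->
  enorm (v *m 'J s p) <= kap * enorm v.
Proof.
move=> pr /differentiable_linearization sd; apply: (jacobian_bound v sd).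
by apply: filterS (near_solution pr) => p' p'r; exact: s_lip.
Qed.

Lemma jacobian_solution_tr_bound (p : 'rV[R]_d) (y : 'rV[R]_n) :
  enorm (p - pbar) < r -> differentiable s p ->
  enorm (y *m ('J s p)^T) <= kap * enorm y.
Proof.
move=> pr sd; set a := y *m _.
have [->|a0] := eqVneq a 0; first by rewrite enorm0 mulr_ge0// ltW.
have {a0}a0 : 0 < enorm a by rewrite enorm_gt0.
rewrite -(ler_pM2l a0) -expr2 sqr_enorm {1}/a dotv_mulmx trmxK.
rewrite (le_trans (cauchy_schwarz _ _))//.
have : enorm y * enorm (a *m 'J s p) <= enorm y * (kap * enorm a).
  by rewrite ler_wpM2l// jacobian_solution_bound.
lra.
Qed.

(** For y = h' J - l, the vector (y J^T, - y) is a regular normal to [gph S] whose pairing with (h',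
    l) is the squared norm of y. These normals are bounded thanks to the Lipschitz constant, and
    [S_semismooth] makes the limit pairing vanish, so y cannot stay away from 0. *)
Lemma jacobian_solution_cvg (h : 'rV[R]_d) (l : 'rV[R]_n) (e : R) :
  DS h l -> 0 < e -> exists2 dl : R, 0 < dl &
  forall (t : R) (h' : 'rV[R]_d), 0 < t -> t < dl -> enorm (h' - h) < dl ->
    differentiable s (pbar + t *: h') ->
    enorm (h' *m 'J s (pbar + t *: h') - l) < e.
Proof.
move=> DSh e0; apply: contrapT => nH.
have ex (k : nat) : exists z : R * 'rV[R]_d, [/\ 0 < z.1, z.1 <= k.+1%:R^-1,
    enorm (z.2 - h) <= k.+1%:R^-1, differentiable s (pbar + z.1 *: z.2) &
    e <= enorm (z.2 *m 'J s (pbar + z.1 *: z.2) - l)].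
  apply: contrapT => nex; apply: nH; exists k.+1%:R^-1; first by rewrite invr_gt0.
  move=> t h' t0 tk h'h sd; rewrite ltNge; apply/negP => le; apply: nex.
  by exists (t, h'); split => //=; exact: ltW.
have [z zP] := choice ex.
pose t k : R := (z k).1; pose hk k : 'rV[R]_d := (z k).2.
have tn := @decreases_to0_natSinv R.
have tl : decreases_to0 t.
  split=> [k|]; first by have [] := zP k.
  apply: (squeeze_cvgr _ (@cvg_cst _ _ _ _ _) tn.2); apply: nearW => k.
  by have [h0 + _ _ _] := zP k; rewrite -/(t k) => ->; rewrite ltW.
have hl : hk @ \oo --> h by apply: (cvg_enorm_le tn.2) => k; have [] := zP k.
pose p k : 'rV[R]_d := pbar + t k *: hk k.
have ball0 : enorm (pbar - pbar) < r by rewrite subrr enorm0.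
have [M _ Mr] := near_ball ball0 (cvg_add_scale (x := pbar) tl hl).
pose m k := (k + M)%N; have mk k : (k <= m k)%N by exact: leq_addr.
have pr k : enorm (p (m k) - pbar) < r by apply: Mr; exact: leq_addl.
pose J k := 'J s (p (m k)).
have sd k : differentiable s (p (m k)) by have [] := zP (m k).
pose y k : 'rV[R]_n := hk (m k) *m J k - l.
pose nn k : 'rV[R]_(d + n) := row_mx (y k *m (J k)^T) (- y k).
have ybd k : enorm (y k) <= kap * (enorm h + 1) + enorm l.
  rewrite (le_trans (enormB _ _))// lerD2r (le_trans (jacobian_solution_bound _ (pr k) _))//.
  rewrite ler_wpM2l ?(ltW kap0)//.
  have [_ _ + _ _] := zP (m k); rewrite -/(hk (m k)) => hh.
  have k1 : ((m k).+1%:R^-1 : R) <= 1 by rewrite invf_le1// ler1n.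
  by rewrite (le_trans (enorm_le_add _ h))// lerD2l (le_trans hh).
have [psi [nl [psik nnl]]] : exists (phi : nat -> nat) (l : 'rV[R]_(d + n)),
    (forall k, (k <= phi k)%N) /\ (nn \o phi) @ \oo --> l.
  apply: (@bounded_subsequence _ _ nn ((kap + 1) * (kap * (enorm h + 1) + enorm l))) => k.
  rewrite (le_trans (enorm_row_mx_le _ _))// enormN.
  have := jacobian_solution_tr_bound (y k) (pr k) (sd k).
  have : (kap + 1) * enorm (y k) <= (kap + 1) * (kap * (enorm h + 1) + enorm l).
    by rewrite ler_wpM2l// addr_ge0// ltW.
  rewrite -/(J k); lra.
pose phi k := m (psi k); have phik k : (k <= phi k)%N by rewrite (leq_trans (psik k)).
have tphi := decreases_to0_subsequence phik tl.
have hphi : (fun k => hk (phi k)) @ \oo --> h by exact: (cvg_subsequence phik hl).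
(* Quotients at the moving points; the Lipschitz bound compares them with those in the fixed
   direction [h], which tend to [l]. *)
pose wk k : 'rV[R]_n := (t (phi k))^-1 *: (s (p (phi k)) - xbar).
have wl : wk @ \oo --> l.
  have ql := solution_quotient_cvg f_C1 kap0 r0 SE sF s_lip s_pbar s_residual F_proto DSh tphi.
  pose g k : 'rV[R]_n := (t (phi k))^-1 *: (s (pbar + t (phi k) *: h) - xbar).
  have gl : g @ \oo --> l by exact: ql.
  have dl : (fun k => wk k - g k) @ \oo --> (0 : 'rV[R]_n).
    apply/cvg_enormP => e1 e10.
    have /cvg_enormP/(_ _ (divr_gt0 e10 kap0)) hn := hphi.
    have rn := near_ball_line h ball0 tphi.
    near=> k; rewrite subr0 /wk /g -scalerBr opprB addrA subrK.
    have t0 : 0 < t (phi k) by exact: tl.1.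
    rewrite enormZ gtr0_norm ?invr_gt0// ltr_pdivrMl//.
    have p1 : enorm (p (phi k) - pbar) < r by exact: pr.
    have p2 : enorm (pbar + (t \o phi) k *: h - pbar) < r by near: k.
    rewrite (le_lt_trans (s_lip p1 p2))// /p opprD addrACA subrr add0r -scalerBr.
    rewrite enormZ gtr0_norm// mulrCA ltr_pM2l// mulrC -ltr_pdivlMr//.
    by near: k.
  have -> : wk = (fun k => (wk k - g k) + g k) by apply/funext => k; rewrite subrK.
  by rewrite -[X in _ --> X]add0r; apply: cvgD.
have pE k : row_mx pbar xbar + t (phi k) *: row_mx (hk (phi k)) (wk k)
    = row_mx (p (phi k)) (s (p (phi k))).
  rewrite scale_row_mx add_row_mx scalerA divff ?gt_eqF ?tl.1// scale1r.
  by congr row_mx; rewrite addrC subrK.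
have nl0 : dotv nl (row_mx h l) = 0.
  apply: S_semismooth; exists (t \o phi), (fun k => row_mx (hk (phi k)) (wk k)), (nn \o psi).
  split => //.
  - exact: cvg_row_mx.
  - by move=> k; rewrite pE gph_row_mx SE//; exact: pr.
  - move=> k; rewrite pE; apply: regular_normal_graph.
      by apply: differentiable_linearization; exact: sd.
    by apply: filterS (near_solution (pr (psi k))) => p' /SE.
have dotl : (fun k => dotv (nn (psi k)) (row_mx (hk (phi k)) l)) @ \oo --> (0 : R).
  rewrite -nl0; apply: cvg_dotv => //; apply: cvg_row_mx => //; exact: cvg_cst.
have e2 : 0 < e ^+ 2 by rewrite exprn_gt0.
have /cvgrPdist_lt/(_ _ e2)/filter_ex[k] := dotl.
rewrite sub0r normrN /nn dotv_row_mx dotv_mulmx trmxK dotvNl -dotvBr -/(y (psi k)).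
rewrite -sqr_enorm ger0_norm ?sqr_ge0// ltNge => /negP; apply.
rewrite ler_pXn2r ?nnegrE ?(ltW e0)//.
by have [] := zP (phi k).
Unshelve. all: by end_near. Qed.

Lemma semismooth_solution : semismooth s pbar.
Proof.
have ball0 : enorm (pbar - pbar) < r by rewrite subrr enorm0.
split.
  exists [set p | enorm (p - pbar) < r]; first by apply/nbhs_enormP; exists r.
  have vE p : value_at (fun y => [set s y]) p = s p by exact: value_at_set1.
  split=> [p _|]; first by exists (s p).
  by exists kap => p p' pr p'r; rewrite !vE; exact: s_lip.
move=> h.
have [l _ DSE] := solution_directional_derivative f_C1 kap0 r0 SE sF s_lip s_pbar
  s_residual F_proto h.
have DSh : DS h l by rewrite DSE.
exists l => e e0.
have e2 : 0 < e / 2 by rewrite divr_gt0.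
have [dl dl0 Jl] := jacobian_solution_cvg DSh e2.
exists ([set h' | enorm (h' - h) < dl], [set t | 0 < t < dl]).
  split => /=; first by apply/nbhs_enormP; exists dl.
  near=> t; apply/andP; split; near: t; first exact: nbhs_right_gt.
  exact: nbhs_right_lt.
move=> [h' t] /= [h'h /andP[t0 tdl]] V.
rewrite /clarke_jacobian /convex_hull => VH.
(* The bound is a convex condition on V, so it passes to the hull, and its non-strict form with
   [e / 2] survives limits of Jacobians. *)
suff : V \in [set V | enorm (h' *m V - l) <= e / 2] by rewrite inE /=; lra.
rewrite inE; move: V VH; apply: smallest_sub.
  move=> V W lam; rewrite !inE /= => Vl Wl.
  have a0 : 0 <= lam%:num by exact: ge0.
  have a1 : lam%:num <= 1 by exact: le1.
  have -> : conv lam V W = (lam%:num *: V + (1 - lam%:num) *: W : 'M[R]_(d, n)) by [].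
  move: (lam%:num : R) a0 a1 => a a0 a1.
  have -> : h' *m (a *: V + (1 - a) *: W : 'M[R]_(d, n)) - l =
      a *: (h' *m V - l) + (1 - a) *: (h' *m W - l).
    rewrite mulmxDr -!scalemxAr !scalerBr addrACA -opprD -scalerDl.
    by rewrite [a + _]addrC subrK scale1r.
  rewrite (le_trans (enormD _ _))// !enormZ !ger0_norm ?subr_ge0//.
  have : a * enorm (h' *m V - l) <= a * (e / 2) by rewrite ler_wpM2l.
  have : (1 - a) * enorm (h' *m W - l) <= (1 - a) * (e / 2).
    by rewrite ler_wpM2l// subr_ge0.
  lra.
move=> V /= [xk [xkl sd JV]].
(* The differentiability points are written with the same step [t]; the perturbation goes into the
   direction [hk k], which tends to h'. *)
pose hk k : 'rV[R]_d := t^-1 *: (xk k - pbar).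
have hkl : hk @ \oo --> h'.
  have -> : h' = t^-1 *: ((pbar + t *: h') - pbar).
    by rewrite addrAC subrr add0r scalerA mulVf ?gt_eqF// scale1r.
  by apply: cvgZr; apply: cvgB => //; exact: cvg_cst.
have xkE k : xk k = pbar + t *: hk k.
  by rewrite scalerA divff ?gt_eqF// scale1r addrC subrK.
have gl : (fun k => hk k *m 'J s (xk k) - l) @ \oo --> h' *m V - l.
  by apply: cvgB; [exact: cvg_mulmx|exact: cvg_cst].
apply: cvg_enorm_bound gl.
have h'dl : 0 < dl - enorm (h' - h) by rewrite subr_gt0.
have /cvg_enormP/(_ _ h'dl) hn := hkl.
near=> k.
have hkh : enorm (hk k - h) < dl.
  rewrite (le_lt_trans (enorm_triangle h' _ _))// -ltrBrDr; near: k; exact: hn.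
have := Jl t (hk k) t0 tdl hkh; rewrite -xkE => /(_ (sd k)) /ltW; exact.
Unshelve. all: by end_near. Qed.

End SemismoothSolution.

(** * Minty's theorem and sums of maximally monotone maps *)

Section Minty.
Context {R : realType}.

Definition simplex m : set 'rV[R]_m :=
  [set lam | (forall i, 0 <= lam ord0 i) /\ \sum_i lam ord0 i = 1].

Lemma cvg_coord T (G : set_system T) (FF : Filter G) m (u : T -> 'rV[R]_m)
    (l : 'rV[R]_m) i :
  u @ G --> l -> (fun k => u k ord0 i) @ G --> l ord0 i.
Proof.
move=> /cvg_enormP ul; apply/cvgrPdist_lt => e /ul; apply: filterS => k.
apply: le_lt_trans; rewrite distrC (le_trans _ (normr_le_enorm _))//.
by rewrite (le_trans _ (coord_le_normr _ i))// !mxE.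
Qed.

Lemma dotv_mulmx_rows m N (lam : 'rV[R]_m) (X : 'M[R]_(m, N)) u :
  dotv (lam *m X) u = \sum_i lam ord0 i * dotv (row i X) u.
Proof. by rewrite mulmx_sum_row dotv_suml; apply: eq_bigr => i _; rewrite dotvZl. Qed.

Lemma dotv_const_mx1 m (lam : 'rV[R]_m) : dotv lam (const_mx 1) = \sum_i lam ord0 i.
Proof. by apply: eq_bigr => i _; rewrite mxE mulr1. Qed.

Lemma simplex_compact m : compact (@simplex m).
Proof.
apply: bounded_closed_compact.
  exists 1; split; first exact: num_real.
  move=> y y1 lam [lam0 lam1]; apply: normr_le_entries => [|i j].
    by rewrite (le_trans _ (ltW y1)).
  rewrite ord1 ger0_norm// (le_trans _ (ltW y1))// -lam1 (bigD1 j)//= lerDl.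
  exact: sumr_ge0.
have -> : @simplex m = (\bigcap_(i : 'I_m) [set lam : 'rV[R]_m | 0 <= lam ord0 i])
    `&` [set lam | dotv lam (const_mx 1) = 1].
  apply/seteqP; split => lam [lam0 lam1]; split.
  - by move=> i _; exact: lam0.
  - by rewrite /= dotv_const_mx1.
  - by move=> i; exact: lam0.
  - by rewrite -dotv_const_mx1.
apply: closedI.
  apply: closed_bigI => i _.
  apply: (@preimage_closed _ _ (fun lam : 'rV[R]_m => lam ord0 i) [set a : R | 0 <= a]).
    by move=> x _; exact: (@cvg_coord _ (nbhs x) _ _ id _ _ (@cvg_id _ _)).
  exact: closed_ge.
apply: (@preimage_closed _ _ (fun lam : 'rV[R]_m => dotv lam (const_mx 1)) [set a : R | a = 1]).
  by move=> x _; exact: (@cvg_dotv R _ _ (nbhs x) _ id _ _ _ (@cvg_id _ _) (cvg_cst _)).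
exact: closed_eq.
Qed.

(* Stationarity of |lam X|^2 + <lam, sg> at its minimizer over the simplex. *)
Lemma simplex_minimizer m N (X : 'M[R]_(m.+1, N)) (sg : 'rV[R]_m.+1) :
  exists2 lam, simplex lam & forall j,
    2 * dotv (lam *m X) (lam *m X) + dotv lam sg
    <= 2 * dotv (lam *m X) (row j X) + sg ord0 j.
Proof.
pose psi (lam : 'rV[R]_m.+1) := dotv (lam *m X) (lam *m X) + dotv lam sg.
have psic : continuous psi.
  move=> x; have idx : id @ nbhs x --> x by exact: cvg_id.
  have cX : (fun y : 'rV[R]_m.+1 => y *m X) @ nbhs x --> x *m X.
    exact: (cvg_mulmx idx (cvg_cst X)).
  have nf := nbhs_filter x; apply: cvgD; first exact: (cvg_dotv nf cX cX).
  exact: (cvg_dotv nf idx (cvg_cst sg)).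
have deltaS j : simplex (delta_mx ord0 j : 'rV[R]_m.+1).
  split=> [i|]; first by rewrite mxE eqxx /= ler0n.
  rewrite (bigD1 j)//= mxE !eqxx big1 ?addr0// => i ij.
  by rewrite mxE eqxx (negbTE ij).
have [||lam lamS lammin] := @compact_EVT_min _ _ psi (@simplex m.+1) _ (@simplex_compact _).
- by exists (delta_mx ord0 ord0); exact: deltaS.
- exact: continuous_subspaceT.
rewrite inE in lamS; exists lam => // j.
pose y : 'rV[R]_m.+1 := delta_mx ord0 j - lam.
have yX : y *m X = row j X - lam *m X by rewrite mulmxBl -rowE.
have ysg : dotv y sg = sg ord0 j - dotv lam sg.
  rewrite dotvBl; congr (_ - _).
  rewrite /dotv (bigD1 j)//= mxE !eqxx mul1r big1 ?addr0// => i ij.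
  by rewrite mxE eqxx (negbTE ij) mul0r.
suff : 0 <= 2 * dotv (lam *m X) (y *m X) + dotv y sg.
  by rewrite yX ysg dotvBr; lra.
set b := dotv _ (y *m X); set c := dotv y sg.
have key (t : R) : 0 < t -> t <= 1 -> 0 <= (2 * b + c) + t * dotv (y *m X) (y *m X).
  move=> t0 t1.
  have : psi lam <= psi (lam + t *: y).
    apply: lammin; rewrite inE.
    have -> : lam + t *: y = (1 - t) *: lam + t *: delta_mx ord0 j.
      by rewrite scalerBr scalerBl scale1r -addrA [- _ + _]addrC.
    have [d0 d1] := deltaS j; have [l0 l1] := lamS.
    split=> [i|].
      by rewrite !mxE addr_ge0// mulr_ge0 ?subr_ge0// ?(ltW t0)//; have := d0 i; rewrite mxE.
    under eq_bigr do rewrite 3!mxE.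
    rewrite big_split /= -!mulr_sumr l1.
    have -> : \sum_i (delta_mx ord0 j : 'rV[R]_m.+1) ord0 i = 1 by [].
    by rewrite !mulr1 subrK.
  rewrite /psi mulmxDl -scalemxAl dotv_sqrD dotvDl !dotvZl !dotvZr -/b -/c => le.
  by rewrite -(pmulr_rge0 _ t0); lra.
apply/ler_addgt0Pr => e e0.
pose Q := dotv (y *m X) (y *m X) + 1.
have Q0 : 0 < Q by rewrite ltr_wpDl// dotvv_ge0.
pose t := Num.min 1 (e / Q).
have t0 : 0 < t by rewrite lt_min ltr01 divr_gt0.
have t1 : t <= 1 by rewrite ge_min lexx.
have tQ : t * Q <= e by rewrite -ler_pdivlMr// ge_min lexx orbT.
have := key t t0 t1; move: tQ; rewrite /Q; lra.
Qed.

Definition skew_map N (K : 'rV[R]_N -> 'rV[R]_N) : Prop :=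
  forall u v, dotv (K u) v = - dotv u (K v).

Lemma skew_map_self N (K : 'rV[R]_N -> 'rV[R]_N) u : skew_map K -> dotv (K u) u = 0.
Proof. by move=> Ks; have := Ks u u; rewrite (dotvC u); lra. Qed.

(** Since [K] is skew, the i-th expression equals [dotv x x - 2 * dotv x (row i X) - sg ord0 i].
    Minimizing the largest of these over x has the simplex problem as its dual, and the dual
    minimizer gives the candidate [x = lam *m X]; skewness also removes [K] from the averages. *)
Lemma minty_finite m N (K : 'rV[R]_N -> 'rV[R]_N) (a b : 'I_m.+1 -> 'rV[R]_N) :
  skew_map K ->
  (forall i j, 0 <= dotv (b i - b j) (a i - a j)) ->
  exists x, forall i, dotv (b i + x + K x) (x - a i) <= 0.
Proof.
move=> Ks mono.
pose X : 'M[R]_(m.+1, N) := \matrix_i (- (2^-1 *: (b i - a i + K (a i)))).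
pose sg : 'rV[R]_m.+1 := \row_i dotv (b i) (a i).
have [lam [lam0 lam1] lamP] := simplex_minimizer X sg.
set x := lam *m X in lamP.
have xa u : dotv x u = \sum_i lam ord0 i * (- (2^-1 * dotv (b i - a i + K (a i)) u)).
  by rewrite dotv_mulmx_rows; apply: eq_bigr => i _; rewrite rowK dotvNl dotvZl.
pose A : 'M[R]_(m.+1, N) := \matrix_i a i; pose al : 'rV[R]_N := lam *m A.
pose B : 'M[R]_(m.+1, N) := \matrix_i b i; pose bl : 'rV[R]_N := lam *m B.
have alE u : dotv al u = \sum_i lam ord0 i * dotv (a i) u.
  by rewrite dotv_mulmx_rows; apply: eq_bigr => i _; rewrite rowK.
have blE u : dotv bl u = \sum_i lam ord0 i * dotv (b i) u.
  by rewrite dotv_mulmx_rows; apply: eq_bigr => i _; rewrite rowK.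
have sgE : dotv lam sg = \sum_i lam ord0 i * dotv (b i) (a i).
  by rewrite [LHS]/dotv; apply: eq_bigr => i _; rewrite mxE.
have Kal : \sum_i lam ord0 i * dotv (K (a i)) al = 0.
  have : dotv al (K al) = 0 by rewrite dotvC skew_map_self.
  rewrite alE => E; transitivity (- \sum_i lam ord0 i * dotv (a i) (K al)).
    by rewrite -sumrN; apply: eq_bigr => i _; rewrite Ks mulrN.
  by rewrite E oppr0.
have xal : dotv x al = - (2^-1 * (dotv bl al - dotv al al)).
  transitivity (- 2^-1 * (\sum_i lam ord0 i * dotv (b i) al
    - \sum_i lam ord0 i * dotv (a i) al + \sum_i lam ord0 i * dotv (K (a i)) al)).
    rewrite xa -sumrB -big_split mulr_sumr; apply: eq_bigr => i _ /=.
    by rewrite dotvDl dotvBl; ring.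
  by rewrite Kal addr0 mulNr blE (alE al).
(* Pairwise monotonicity averaged with the weights [lam ord0 i * lam ord0 j]: the double sum is
   [2 * (dotv lam sg - dotv bl al)]. *)
have mono_mean : dotv bl al <= dotv lam sg.
  have : 0 <= \sum_i \sum_j lam ord0 i * (lam ord0 j * dotv (b i - b j) (a i - a j)).
    by apply: sumr_ge0 => i _; apply: sumr_ge0 => j _; rewrite !mulr_ge0.
  have -> : \sum_i \sum_j lam ord0 i * (lam ord0 j * dotv (b i - b j) (a i - a j)) =
      \sum_i lam ord0 i * (dotv (b i) (a i) + dotv lam sg
        - dotv (b i) al - dotv bl (a i)).
    apply: eq_bigr => i _; rewrite -mulr_sumr; congr (_ * _).
    rewrite sgE (dotvC (b i) al) alE blE -[dotv (b i) (a i)]mul1r -lam1 mulr_suml.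
    rewrite -big_split -!sumrB; apply: eq_bigr => j _ /=.
    by rewrite dotvBl !dotvBr (dotvC (a j)); ring.
  have -> : \sum_i lam ord0 i * (dotv (b i) (a i) + dotv lam sg
        - dotv (b i) al - dotv bl (a i)) =
      dotv lam sg + dotv lam sg - dotv bl al - dotv bl al.
    transitivity (\sum_i lam ord0 i * dotv (b i) (a i) + \sum_i lam ord0 i * dotv lam sg
      - \sum_i lam ord0 i * dotv (b i) al - \sum_i lam ord0 i * dotv (a i) bl).
      rewrite -big_split -!sumrB; apply: eq_bigr => i _ /=.
      by rewrite (dotvC (a i) bl); ring.
    by rewrite -sgE -blE -alE -mulr_suml lam1 mul1r (dotvC al).
  lra.
exists x => j.
have := lamP j; rewrite rowK mxE dotvNr dotvZr => H.
have E : dotv (b j + x + K x) (x - a j) =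
    dotv x x + dotv x (b j - a j + K (a j)) - dotv (b j) (a j).
  rewrite dotvBr !dotvDl (skew_map_self _ Ks) (Ks x) !dotvDr dotvNr (dotvC x (b j)).
  by rewrite (dotvC x (a j)); ring.
(* By [xal] this square equals [dotv x x + dotv bl al]; with [mono_mean], the bound
   [- (dotv x x + dotv lam sg)] that [H] provides is nonpositive. *)
have := dotvv_ge0 (al - x); rewrite dotv_sqrB (dotvC al x) xal E; lra.
Qed.

Lemma maximally_monotone_nonempty N (M : 'rV[R]_N -> set 'rV[R]_N) :
  maximally_monotone M -> exists a b, M a b.
Proof.
move=> mM; apply: contrapT => nM; apply: (nM); exists 0, 0.
by apply: maximally_monotone_mem => // a b Mab; case: nM; exists a, b.
Qed.

(* Minty's theorem for I + K in place of the identity, K skew. *)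
Lemma minty_skew N (M : 'rV[R]_N -> set 'rV[R]_N) (K : 'rV[R]_N -> 'rV[R]_N) :
  skew_map K -> maximally_monotone M -> exists x, M x (- (x + K x)).
Proof.
move=> Ks mM.
have [a0 [b0 Mab0]] := maximally_monotone_nonempty mM.
pose C (ab : 'rV[R]_N * 'rV[R]_N) :=
  [set x : 'rV[R]_N | dotv (ab.2 + x + K x) (x - ab.1) <= 0].
have CE ab x : dotv (ab.2 + x + K x) (x - ab.1) =
    dotv x x + dotv x (ab.2 - ab.1 + K ab.1) - dotv ab.2 ab.1.
  rewrite dotvBr !dotvDl (skew_map_self _ Ks) (Ks x) !dotvDr dotvNr (dotvC x ab.2).
  by rewrite (dotvC x ab.1); ring.
have Ccl ab : closed (C ab).
  pose g (x : 'rV[R]_N) := dotv x x + dotv x (ab.2 - ab.1 + K ab.1) - dotv ab.2 ab.1.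
  have -> : C ab = g @^-1` [set r : R | r <= 0].
    by apply/seteqP; split => x; rewrite /C /g /= CE.
  apply: preimage_closed; last exact: closed_le.
  move=> x _; have idx : id @ nbhs x --> x by exact: cvg_id.
  have nf := nbhs_filter x; apply: cvgB; last exact: cvg_cst.
  apply: cvgD; first exact: (cvg_dotv nf idx idx).
  exact: (cvg_dotv nf idx (cvg_cst _)).
pose C0 := C (a0, b0).
have C0c : compact C0.
  apply: bounded_closed_compact; last exact: Ccl.
  set c := b0 - a0 + K a0.
  exists (enorm c + `|dotv b0 a0| + 1); split; first exact: num_real.
  move=> y cy x xC0 /=.
  have xle : dotv x x + dotv x c - dotv b0 a0 <= 0.
    by rewrite -[X in X <= _](CE (a0, b0) x).
  rewrite (le_trans (normr_le_enorm _))// (le_trans _ (ltW cy))//.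
  have cs := cauchy_schwarzN x c.
  have := ler_norm (dotv b0 a0); have := enorm_ge0 c => c0 nb.
  rewrite leNgt; apply/negP => lt.
  have x1 : 1 < enorm x by have := normr_ge0 (dotv b0 a0); lra.
  rewrite -sqr_enorm in xle.
  have : enorm x * (enorm c + `|dotv b0 a0| + 1) < enorm x * enorm x.
    by rewrite ltr_pM2l// (lt_trans ltr01).
  have : 1 * `|dotv b0 a0| <= enorm x * `|dotv b0 a0| by rewrite ler_wpM2r// ltW.
  rewrite -expr2; lra.
pose I := ('rV[R]_N * 'rV[R]_N)%type.
pose D : set I := [set ab | M ab.1 ab.2].
(* Compactness of [C0] reduces the claim to finite families. Listing [(a0, b0)] first keeps them
   nonempty and places the common point in [C0]. *)
have := C0c; rewrite compact_In0 => /(_ I D (fun ab => C0 `&` C ab)).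
case=> [|D' D'D|x xC].
- by exists C.
- pose r := (a0, b0) :: finmap.enum_fset D'.
  have rM i : M (nth (a0, b0) r i).1 (nth (a0, b0) r i).2.
    have [ir|ir] := ltnP i (size r); last by rewrite nth_default.
    have : nth (a0, b0) r i \in r by exact: mem_nth.
    rewrite in_cons => /orP[/eqP->//|/D'D]; by rewrite inE.
  have [|x xP] := @minty_finite (size (finmap.enum_fset D')) N K
      (fun i => (nth (a0, b0) r i).1) (fun i => (nth (a0, b0) r i).2) Ks.
    by move=> i j; exact: mM.1.
  have xr ab : ab \in r -> C ab x.
    move=> abr; have ir : (index ab r < size r)%N by rewrite index_mem.
    by have := xP (Ordinal ir); rewrite /= nth_index.
  exists x => ab /= abD'; split; first by apply: xr; rewrite mem_head.
  by apply: xr; rewrite in_cons abD' orbT.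
exists x; apply: maximally_monotone_mem => // a b Mab.
have [_] := xC (a, b) Mab; rewrite /C /=.
by rewrite -[a - x]opprB dotvNr opprK addrA; lra.
Qed.

End Minty.

(** * Maximality of the sum with a continuous monotone map *)

Section ContinuousSum.
Context {R : realType} {n : nat}.
Context (F : 'rV[R]_n -> set 'rV[R]_n) (g : 'rV[R]_n -> 'rV[R]_n).
Hypothesis F_maxmono : maximally_monotone F.
Hypothesis g_mono : monotone_map (fun x => [set g x]).
Hypothesis g_cont : continuous g.

Lemma g_monotone x y : 0 <= dotv (g y - g x) (y - x).
Proof. exact: (g_mono erefl erefl). Qed.

Lemma cvg_g (u : nat -> 'rV[R]_n) (l : 'rV[R]_n) :
  u @ \oo --> l -> (fun k => g (u k)) @ \oo --> g l.
Proof. by move=> ul; apply: (cvg_comp u g ul); exact: g_cont. Qed.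

(** The Minty-Browder argument: test at [c0 + t *: h] with [h = w - g c0], divide by t and let t
    tend to 0; by continuity the limit inequality is [0 <= - dotv h h]. *)
Lemma continuous_monotone_maximal (c0 w : 'rV[R]_n) :
  (forall c, 0 <= dotv (g c - w) (c - c0)) -> w = g c0.
Proof.
move=> H; set h := w - g c0.
suff : 0 <= - dotv h h.
  move=> hh; have hh0 : dotv h h = 0 by apply/eqP; rewrite eq_le dotvv_ge0 -oppr_ge0 hh.
  by apply/eqP; rewrite -subr_eq0; apply/eqP; exact: dotvv_eq0 hh0.
have tn := @decreases_to0_natSinv R.
pose c k : 'rV[R]_n := c0 + k.+1%:R^-1 *: h.
have cl : c @ \oo --> c0 by exact: (cvg_add_scale (qk := fun=> h) tn (cvg_cst h)).
have gl : (fun k => dotv (g (c k) - w) h) @ \oo --> dotv (g c0 - w) h.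
  apply: cvg_dotv; last exact: cvg_cst.
  by apply: cvgB; [exact: cvg_g|exact: cvg_cst].
have -> : - dotv h h = dotv (g c0 - w) h.
  by rewrite -dotvNl; congr dotv; rewrite opprB.
apply: (cvgr_to_ge gl); apply: nearW => k.
have k0 : 0 < (k.+1%:R^-1 : R) by rewrite invr_gt0.
have := H (c k); rewrite /c addrAC subrr add0r dotvZr pmulr_rge0//.
Qed.

(* The product of F - z with the rescaled inverse of g is maximally monotone;
   Minty's theorem for it regularizes the inclusion z in x + F x + g x. *)
Lemma regularized_solution (z : 'rV[R]_n) (eta : R) : 0 < eta ->
  exists x v : 'rV[R]_n, F x (z - x - v) /\ v = g (x - eta ^+ 2 *: v).
Proof.
move=> eta0.
(* With X = (x, xi) and v = xi / eta, the inclusion [M X (- (X + K X))] reads: z - x - v lies in F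
   x, and v = g (x - eta^2 v). The second condition is the graph of the rescaled inverse of [g],
   written without inverting [g]. *)
pose M (X : 'rV[R]_(n + n)) : set 'rV[R]_(n + n) :=
  [set Y | F (lsubmx X) (lsubmx Y + z) /\ rsubmx X = eta *: g (eta *: rsubmx Y)].
pose K (X : 'rV[R]_(n + n)) : 'rV[R]_(n + n) :=
  row_mx (eta^-1 *: rsubmx X) (- (eta^-1 *: lsubmx X)).
have Ks : skew_map K.
  move=> u v; rewrite -[X in dotv _ X = _]hsubmxK -[X in _ = - dotv X _]hsubmxK.
  rewrite /K !dotv_row_mx !dotvNl !dotvNr !dotvZl !dotvZr; ring.
have mM : maximally_monotone M.
  split.
    move=> X0 X1 Y0 Y1 [F0 g0] [F1 g1].
    rewrite -[Y1 - Y0]hsubmxK -[X1 - X0]hsubmxK dotv_row_mx !linearB /= addr_ge0//.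
      have := F_maxmono.1 _ _ _ _ F0 F1.
      by rewrite opprD addrACA subrr addr0.
    rewrite g0 g1 -scalerBr dotvZr -dotvZl scalerBr dotvC; exact: g_monotone.
  move=> M' monoM' MM' Z M'Z.
  pose X : 'rV[R]_(n + n) := lsubmx Z; pose Y : 'rV[R]_(n + n) := rsubmx Z.
  have rel a b c : F a b ->
      0 <= dotv (b - (lsubmx Y + z)) (a - lsubmx X)
         + dotv (g c - eta^-1 *: rsubmx X) (c - eta *: rsubmx Y).
    move=> Fab.
    pose X1 : 'rV[R]_(n + n) := row_mx a (eta *: g c).
    pose Y1 : 'rV[R]_(n + n) := row_mx (b - z) (eta^-1 *: c).
    have M1 : M X1 Y1.
      rewrite /M /X1 /Y1 /= !row_mxKl !row_mxKr subrK scalerA divff ?gt_eqF//.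
      by rewrite scale1r.
    have M'1 : M' X1 Y1.
      have := MM' (row_mx X1 Y1); rewrite !gph_row_mx; apply; exact: M1.
    have := monoM' X X1 Y Y1 M'Z M'1.
    rewrite -[Y in Y1 - Y]hsubmxK -[X in X1 - X]hsubmxK /X1 /Y1 !row_mxB dotv_row_mx.
    have -> : b - z - lsubmx Y = b - (lsubmx Y + z) by rewrite opprD addrA addrAC.
    have -> : dotv (eta^-1 *: c - rsubmx Y) (eta *: g c - rsubmx X) =
        dotv (g c - eta^-1 *: rsubmx X) (c - eta *: rsubmx Y).
      have -> : eta^-1 *: c - rsubmx Y = eta^-1 *: (c - eta *: rsubmx Y).
        by rewrite scalerBr scalerA mulVf ?gt_eqF// scale1r.
      have -> : eta *: g c - rsubmx X = eta *: (g c - eta^-1 *: rsubmx X).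
        by rewrite scalerBr scalerA divff ?gt_eqF// scale1r.
      by rewrite dotvZl dotvZr mulrA mulVf ?gt_eqF// mul1r dotvC.
    by [].
  (* The two terms of [rel] decouple: if the g-term were negative for some c, the F-term would be
     positive for every pair, so the candidate would lie in [gph F]; testing with it then cancels
     the F-term, a contradiction. *)
  have gX : eta^-1 *: rsubmx X = g (eta *: rsubmx Y).
    apply: continuous_monotone_maximal => c; rewrite leNgt; apply/negP => neg.
    have FX : F (lsubmx X) (lsubmx Y + z).
      by apply: maximally_monotone_mem => // a b Fab; have := rel a b c Fab; lra.
    by have := rel _ _ c FX; rewrite subrr dotv0l add0r leNgt neg.
  have FX : F (lsubmx X) (lsubmx Y + z).
    apply: maximally_monotone_mem => // a b Fab.
    by have := rel a b (eta *: rsubmx Y) Fab; rewrite subrr dotv0r addr0.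
  split => //; rewrite -/X -/Y -gX scalerA divff ?gt_eqF// scale1r.
  by [].
have [X [FX gX]] := minty_skew Ks mM.
pose x : 'rV[R]_n := lsubmx X; pose v : 'rV[R]_n := eta^-1 *: rsubmx X.
exists x, v; split.
  move: FX; rewrite linearN linearD /= /K row_mxKl -/x -/v.
  by have -> : - (x + v) + z = z - x - v by rewrite addrC opprD addrA.
rewrite {1}/v {1}gX scalerA mulVf ?gt_eqF// scale1r; congr g.
rewrite linearN linearD /= /K row_mxKr -/x opprD opprK scalerDr scalerN scalerA.
rewrite divff ?gt_eqF// scale1r addrC; congr (_ - _).
by rewrite /v scalerA expr2 mulfK ?gt_eqF.
Qed.

(** Limit of regularized solutions with [eta = k.+1%:R^-1]. Monotonicity against a fixed pair
    [(a, b)] bounds [x k], the square of [v k] absorbing its cross term with [g a]. Monotonicity of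
    [g] between its two arguments bounds [v k] by [g (x k)] in norm, so the shift [ep k *: v k]
    vanishes. *)
Lemma continuous_sum_surjective (z : 'rV[R]_n) : exists x, F x (z - x - g x).
Proof.
have tn := @decreases_to0_natSinv R.
have ex (k : nat) : exists xv : 'rV[R]_n * 'rV[R]_n, F xv.1 (z - xv.1 - xv.2) /\
    xv.2 = g (xv.1 - k.+1%:R^-1 ^+ 2 *: xv.2).
  have k0 : 0 < (k.+1%:R^-1 : R) by rewrite invr_gt0.
  by have [x [v xv]] := regularized_solution z k0; exists (x, v).
have [xv xvP] := choice ex.
pose x k := (xv k).1; pose v k := (xv k).2; pose ep k : R := k.+1%:R^-1 ^+ 2.
have Fk k : F (x k) (z - x k - v k) by have [] := xvP k.
have vE k : v k = g (x k - ep k *: v k) by have [] := xvP k.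
have ep0 k : 0 < ep k by rewrite exprn_gt0// invr_gt0.
have ep1 k : ep k <= 1 by rewrite exprn_ile1// ?invr_ge0// invf_le1// ler1n.
have epl : ep @ \oo --> (0 : R).
  by rewrite -[0 in X in _ --> X](mulr0 0); apply: cvgM; exact: tn.2.
have [a [b Fab]] := maximally_monotone_nonempty F_maxmono.
pose P := enorm (z - a - b - g a); pose Q := enorm (g a) ^+ 2.
have xbd k : enorm (x k - a) <= P + Q + 1.
  have h1 := F_maxmono.1 _ _ _ _ Fab (Fk k).
  have h2 := g_monotone a (x k - ep k *: v k); rewrite -vE in h2.
  have [D DE] : exists D : 'rV[R]_n, D = x k - a by exists (x k - a).
  rewrite -DE in h1 *.
  have xE : z - x k - v k - b = (z - a - b - g a) - D - (v k - g a).
    by rewrite DE; apply/rowP => i; rewrite !mxE; lra.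
  have yE : x k - ep k *: v k - a = D - ep k *: v k by rewrite DE addrAC.
  rewrite xE !(dotvBl, dotvDl) -/P in h1; rewrite yE in h2.
  have h3 : dotv (v k - g a) (D - ep k *: v k) =
      dotv (v k - g a) D - ep k * dotv (v k) (v k) + ep k * dotv (g a) (v k).
    by rewrite dotvBr dotvZr !dotvBl; ring.
  have h4 : dotv (g a) (v k) <= dotv (v k) (v k) + Q.
    have := dotvv_ge0 (v k - g a); rewrite dotv_sqrB (dotvC (g a)) /Q sqr_enorm => h.
    have := dotvv_ge0 (v k); have := dotvv_ge0 (g a); lra.
  have h5 : ep k * dotv (g a) (v k) <= ep k * (dotv (v k) (v k) + Q).
    by rewrite ler_wpM2l ?(ltW (ep0 k)).
  have h6 : ep k * Q <= 1 * Q by rewrite ler_wpM2r// sqr_ge0.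
  have h7 := cauchy_schwarz (z - a - b - g a) D.
  have h8 : enorm D ^+ 2 <= P * enorm D + Q.
    have E : dotv (z - a - b - g a) D = dotv z D - dotv a D - dotv b D - dotv (g a) D.
      by rewrite !dotvBl.
    rewrite sqr_enorm; have := dotvBl (v k) (g a) D; rewrite -/P in h7; lra.
  rewrite leNgt; apply/negP => lt.
  have P0 : 0 <= P by exact: enorm_ge0.
  have Q0 : 0 <= Q by rewrite sqr_ge0.
  have D1 : 1 < enorm D by lra.
  have : (P + Q + 1) * enorm D < enorm D * enorm D by rewrite ltr_pM2r// (lt_trans ltr01).
  have : 1 * Q <= enorm D * Q by rewrite ler_wpM2r// ltW.
  rewrite -expr2; lra.
have [phi [xl [phik xxl]]] : exists (phi : nat -> nat) (l : 'rV[R]_n),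
    (forall k, (k <= phi k)%N) /\ (x \o phi) @ \oo --> l.
  apply: (@bounded_subsequence _ _ x (P + Q + 1 + enorm a)) => k.
  by rewrite (le_trans (enorm_le_add _ a))// addrC lerD2r.
have vx k : enorm (v k) <= enorm (g (x k)).
  have h := g_monotone (x k - ep k *: v k) (x k); rewrite -vE in h.
  have E : x k - (x k - ep k *: v k) = ep k *: v k by rewrite opprB addrC subrK.
  have {}h : 0 <= dotv (g (x k) - v k) (v k).
    by move: h; rewrite E dotvZr pmulr_rge0.
  have := cauchy_schwarz (g (x k)) (v k); rewrite dotvBl -sqr_enorm in h.
  have [->|v0] := eqVneq (v k) 0; first by rewrite enorm0.
  have {}v0 : 0 < enorm (v k) by rewrite enorm_gt0.
  by move=> cs; rewrite -(ler_pM2r v0) -expr2; lra.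
have gxl : (fun k => g (x (phi k))) @ \oo --> g xl.
  exact: (cvg_g xxl).
have evl : (fun k => ep (phi k) *: v (phi k)) @ \oo --> (0 : 'rV[R]_n).
  have el : (fun k => ep (phi k) * enorm (g (x (phi k)))) @ \oo --> (0 : R).
    rewrite -[0 in X in _ --> X](mul0r (enorm (g xl))); apply: cvgM.
      exact: (cvg_subsequence phik epl).
    exact: cvg_enorm.
  apply: (cvg_enorm_le el) => k; rewrite subr0 enormZ gtr0_norm//.
  by rewrite ler_wpM2l ?(ltW (ep0 _)).
have vl : (fun k => v (phi k)) @ \oo --> g xl.
  have yl : (fun k => x (phi k) - ep (phi k) *: v (phi k)) @ \oo --> xl.
    by rewrite -[X in _ --> X]subr0; apply: cvgB.
  have -> : (fun k => v (phi k)) = (fun k => g (x (phi k) - ep (phi k) *: v (phi k))).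
    by apply/funext => k; rewrite -vE.
  exact: cvg_g.
exists xl; apply: (maximally_monotone_cvg F_maxmono (fun k => Fk (phi k)) xxl).
by apply: cvgB => //; apply: cvgB => //; exact: cvg_cst.
Qed.

(** Minty's criterion: as x + F x + g x covers the space, a pair of a monotone extension can be
    tested against a pair of the sum with the same x + y, which forces the two to coincide. *)
Lemma continuous_sum_maximally_monotone :
  maximally_monotone (fun x => [set g x + u | u in F x]).
Proof.
split.
  move=> x0 x1 _ _ [u0 F0 <-] [u1 F1 <-].
  rewrite opprD addrACA dotvDl addr_ge0 ?g_monotone//.
  exact: F_maxmono.1.
move=> Q' monoQ' QQ' Z Q'Z.
pose x0 : 'rV[R]_n := lsubmx Z; pose y0 : 'rV[R]_n := rsubmx Z.
have [x Fx] := continuous_sum_surjective (x0 + y0).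
have Q'x : Q' x (x0 + y0 - x).
  rewrite -gph_row_mx; apply: QQ'; rewrite gph_row_mx; exists (x0 + y0 - x - g x) => //.
  by rewrite addrC subrK.
have := monoQ' _ _ _ _ Q'Z Q'x.
have -> : x0 + y0 - x - rsubmx Z = - (x - x0).
  by rewrite -/y0 opprB addrAC addrK.
rewrite dotvNl -/x0 => h.
have h0 : dotv (x - x0) (x - x0) = 0 by apply/eqP; rewrite eq_le dotvv_ge0 -oppr_ge0 h.
have xE : x = x0 by apply/eqP; rewrite -subr_eq0; apply/eqP; exact: dotvv_eq0.
rewrite /gph /= -/x0 -/y0; exists (x0 + y0 - x - g x); first by rewrite -{1}xE.
by rewrite xE addrC subrK addrC addKr.
Qed.

End ContinuousSum.

(** * The kernel form of the regularity condition *)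

Section KernelCondition.
Context {R : realType} {n : nat}.

(** The quadratic form at [w - t *: c] has linear coefficient [- dotv c c] in t, and nonnegativity
    for small t forces [c = 0]. This converts the kernel of the Jacobian into that of its adjoint,
    which the coderivative condition uses. *)
Lemma psd_kernel_trmx (A : 'M[R]_n) (w : 'rV[R]_n) :
  (forall u, 0 <= dotv (u *m A) u) -> w *m A = 0 -> w *m A^T = 0.
Proof.
move=> Apsd wA; set c := w *m A^T.
have key (t : R) : 0 < t -> dotv c c <= t * dotv (c *m A) c.
  move=> t0; have := Apsd (w - t *: c).
  rewrite mulmxBl wA sub0r -scalemxAl dotvNl dotvZl dotvBr dotvZr (dotv_mulmx c A w) -/c.
  by rewrite -mulrN opprB pmulr_rge0// subr_ge0.
apply: dotvv_eq0; apply/eqP; rewrite eq_le dotvv_ge0 andbT.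
apply/ler_addgt0Pr => e e0; rewrite add0r.
pose Q := dotv (c *m A) c + 1; have Q0 : 0 < Q by rewrite ltr_wpDl.
rewrite (le_trans (key (e / Q) (divr_gt0 e0 Q0)))// mulrAC ler_pdivrMr//.
by rewrite ler_pM2l// lerDl.
Qed.

Lemma normal_cone0 N (A : set 'rV[R]_N) x : A x -> normal_cone A x 0.
Proof.
move=> Ax; exists (fun=> x), (fun=> 0); split => //; [exact: cvg_cst| |exact: cvg_cst].
move=> _ e e0; apply/nbhs_enormP; exists 1 => // y _ _.
by rewrite dotv0l mulr_ge0// ltW.
Qed.

End KernelCondition.

(** Maximality of [Q] concerns the whole space, while [f_C1] controls [f] only near the reference
    point, and a discontinuous monotone function may fail to be maximal; continuity of [f pbar] is
    therefore a premise of that claim. *)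
Theorem proposition3p6 (R : realType) (d n : nat)
    (pbar : 'rV[R]_d) (xbar : 'rV[R]_n)
    (F : 'rV[R]_n -> set 'rV[R]_n)
    (f : 'rV[R]_d -> 'rV[R]_n -> 'rV[R]_n)
    (F_maxmono : maximally_monotone F)
    (f_C1 : continuously_differentiable_at (joint f) (row_mx pbar xbar))
    (f_mono : \forall p \near pbar, monotone_map (fun x => [set f p x])) :
  let S := solution_map f F in
  let ubar := - f pbar xbar in
  let Q := partial_map f F pbar in
  let G := joint_map f F in
  let DS := fun p => graphical_derivative S p (value_at S p) in
  forall (xbar_sol : S pbar xbar)
    (regularity : forall w,
      [set partial_jacobian_adj f pbar xbar w + v
         | v in coderivative F xbar ubar w] 0 -> w = 0),
  (* the kernel form of the regularity condition *)
  map_kernel (fun w => [set partial_jacobian f pbar xbar w])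
    `&` map_kernel (coderivative F xbar ubar) = [set 0] /\
  (* (a) *)
  (strongly_metrically_regular Q xbar 0 /\
   (continuous (f pbar) -> maximally_monotone Q)) /\
  (* (b) *)
  locally_lipschitz S pbar /\
  (* (c) *)
  (proto_differentiable F xbar ubar ->
    [/\ forall q, locally_lipschitz (graphical_derivative S pbar xbar) q,
        forall q, graphical_derivative S pbar xbar q =
          [set w | graphical_derivative G (row_mx pbar xbar) 0
                     (row_mx q w) 0],
        forall q, exists2 w, has_directional_derivative (value_at S) pbar q w
          & graphical_derivative S pbar xbar q = [set w],
        \forall p \near pbar, (forall q, has_max (norms (DS p q))) /\
          has_max (unit_ball_setnorms (DS p))
      & (lipschitz_modulus S pbar <=
         limf_esup (fun p => outer_norm (DS p)) (nbhs pbar))%E]) /\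
  (* (d) *)
  (semismooth_star (gph F) (row_mx xbar ubar) ->
    semismooth_star (gph S) (row_mx pbar xbar) /\
    (proto_differentiable F xbar ubar -> semismooth (value_at S) pbar)).
Proof.
move=> S ubar Q G DS xbar_sol regularity.
have fbar_mono := nbhs_singleton f_mono.
have df : differentiable (joint f) (row_mx pbar xbar).
  by have [/nbhs_singleton] := f_C1.
have [kap kap0 [r r0 [SE sF s_lip s_pbar s_residual]]] :=
  solution_map_local f_C1 F_maxmono f_mono regularity xbar_sol.
have DSbar : DS pbar = graphical_derivative S pbar xbar by rewrite /DS s_pbar.
have S_lip : lipschitz_single_valued_on S [set p | enorm (p - pbar) < r].
  split=> [p pr|]; first by exists (value_at S p); exact: SE.
  by exists kap => p p' pr p'r; exact: s_lip.
have ball_nbhs : nbhs pbar [set p : 'rV[R]_d | enorm (p - pbar) < r].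
  by apply/nbhs_enormP; exists r.
split; [|split; [|split; [|split]]].
- apply/seteqP; split=> [w [Jw Fw]|_ ->].
    apply: regularity; exists 0; first exact: Fw.
    rewrite addr0 /partial_jacobian_adj; apply: psd_kernel_trmx; last exact: (esym Jw).
    by move=> u; rewrite jacobian_partial//; exact: jacobian_x_psd.
  split; first by rewrite /map_kernel /inverse_map /= /partial_jacobian mul0mx.
  rewrite /map_kernel /inverse_map /coderivative /= oppr0 row_mx0.
  by apply: normal_cone0; rewrite gph_row_mx; exact: F_xbar xbar_sol.
- split; first exact: strong_metric_regularity.
  by move=> f_cont; exact: continuous_sum_maximally_monotone.
- by exists [set p | enorm (p - pbar) < r].
- move=> F_proto; split.
  + move=> q; exact: (directional_derivative_lipschitz f_C1 kap0 r0 SE sF s_lip s_pbar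
      s_residual F_proto).
  + move=> q; exact: (graphical_derivative_joint f_C1 kap0 r0 SE s_pbar s_residual).
  + move=> q; exact: (solution_directional_derivative f_C1 kap0 r0 SE sF s_lip s_pbar
      s_residual F_proto).
  + apply: filterS ball_nbhs => p pr; split => [q|].
      exact: (norms_has_max kap0 SE s_lip).
    exact: (unit_ball_setnorms_has_max kap0 SE s_lip).
  + exact: (lipschitz_modulus_le kap0 r0 SE s_lip).
- move=> F_ss.
  have S_ss : semismooth_star (gph S) (row_mx pbar xbar).
    exact: (semismooth_star_solution f_C1 (maximally_monotone_closed F_maxmono) kap0 r0
      SE sF s_lip s_residual).
  split => // F_proto.
  exact: (semismooth_solution f_C1 kap0 r0 SE sF s_lip s_pbar s_residual F_proto S_ss).
Qed.
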